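(* Let $n\ge2$ and let $s\in C^2(\mathbb{R}^{B_{\mathbf 0}^r},\mathbb{R})$ be admissible. Suppose there are adjacent $v_0,w_0\in\mathcal{M}_0$ with $v_0<w_0$, and that there are adjacent $v_1,w_1\in\mathcal{M}_1(v_0,w_0)$ with $v_1<w_1$. Then there is a configuration $U_2\in\mathcal{M}_2(v_1,w_1)$ which is a solution of the Euler–Lagrange equation. Moreover, $\mathcal{M}_2(v_1,w_1)$ is an ordered set, every element of $\mathcal{M}_2(v_1,w_1)$ is a solution of the Euler–Lagrange equation, and every $U\in\mathcal{M}_2(v_1,w_1)$ is strictly $1$-monotone in $\mathbf{i}_1$ and in $\mathbf{i}_2$, i.e. $U<\tau^1_{-1}U$ and $U<\tau^2_{-1}U$.
   Context: Fix integers $n\ge 2$, $r\ge 1$. For $\mathbf{i}\in\mathbb{Z}^n$ let $\|\mathbf{i}\|=\sum_k|\mathbf{i}_k|$, and $B_{\mathbf 0}^r=\{\mathbf{k}\in\mathbb{Z}^n:\|\mathbf{k}\|\le r\}$; $\mathbf{e}_1,\dots,\mathbf{e}_n$ are the standard unit vectors. A function $s\in C^2(\mathbb{R}^{B_{\mathbf 0}^r},\mathbb{R})$ is called admissible if: (S1) $s(u+1_{B_{\mathbf 0}^r})=s(u)$, with $1_{B_{\mathbf 0}^r}$ the constant function $1$; (S2) $s$ is bounded from below and $s(u)\to\infty$ as $|u(\mathbf{k})-u(\mathbf{j})|\to\infty$, for $\mathbf{k},\mathbf{j}\in B_{\mathbf 0}^r$ with $\|\mathbf{k}-\mathbf{j}\|=1$;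 (S3) $\partial_{\mathbf{k},\mathbf{j}}s\le 0$ for $\mathbf{k}\ne\mathbf{j}$ in $B_{\mathbf 0}^r$, and $\partial_{\mathbf{0},\mathbf{j}}s<0$ for $\|\mathbf{j}\|=1$. A configuration is a function $u:\mathbb{Z}^n\to\mathbb{R}$. Shifts: $(\tau^j_{-k}u)(\mathbf{i})=u(\mathbf{i}+k\mathbf{e}_j)$ for $k\in\mathbb{Z}$. Local potentials: $S_{\mathbf{j}}(u)=s\big((\tau^n_{-\mathbf{j}_n}\cdots\tau^1_{-\mathbf{j}_1}u)|_{B_{\mathbf 0}^r}\big)$. A solution of the Euler–Lagrange equation is a configuration $u$ with $\sum_{\mathbf{j}:\|\mathbf{j}-\mathbf{i}\|\le r}\partial_{\mathbf{i}}S_{\mathbf{j}}(u)=0$ for all $\mathbf{i}\in\mathbb{Z}^n$, where $\partial_{\mathbf i}$ is the partial derivative with respect to $u(\mathbf i)$. Orders: $u\le v$ (resp. $u<v$) means $u(\mathbf{i})\le v(\mathbf{i})$ (resp. $u(\mathbf{i})<v(\mathbf{i})$) for all $\mathbf{i}$. A set of configurations is ordered if any two members $u,v$ satisfy $u<v$, $u=v$ or $u>v$. Members $v<w$ of a set $A$ of configurations are adjacent in $A$ if there is no $u\in A$ with $v\le u\le w$, $u\neq v$, $u\ne w$. For $E\subset\mathbb{Z}^n$, $\|u\|_E=\sum_{\mathbf{j}\in E}|u(\mathbf{j})|$. $\Gamma_0$ is the set of configurations with $u(\mathbf{i}+\mathbf{e}_k)=u(\mathbf{i})$ for all $1\le k\le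 n$ (i.e. constants), $J_0(u)=S_{\mathbf{0}}(u)$, $c_0=\inf_{\Gamma_0}J_0$, $\mathcal{M}_0=\{u\in\Gamma_0:J_0(u)=c_0\}$. For $i\in\mathbb{Z}$ set $\mathbf{T}_i=(i,0,\dots,0)$. For $v_0<w_0$ in $\mathcal{M}_0$: $\hat\Gamma_1(v_0,w_0)$ is the set of configurations $u$ with $v_0\le u\le w_0$ and $u(\mathbf{i}+\mathbf{e}_k)=u(\mathbf{i})$ for $2\le k\le n$; $J_{1,i}(u)=S_{\mathbf{T}_i}(u)-c_0$; $J_{1;p,q}(u)=\sum_{i=p}^qJ_{1,i}(u)$; $J_1(u)=\liminf_{p\to-\infty,\,q\to\infty}J_{1;p,q}(u)$; $\Gamma_1(v_0,w_0)=\{u\in\hat\Gamma_1(v_0,w_0): |u(\mathbf{T}_i)-v_0(\mathbf{T}_i)|\to0 \text{ as } i\to-\infty,\ |u(\mathbf{T}_i)-w_0(\mathbf{T}_i)|\to0\text{ as }i\to\infty\}$; $c_1=\inf_{\Gamma_1(v_0,w_0)}J_1$; $\mathcal{M}_1(v_0,w_0)=\{u\in\Gamma_1(v_0,w_0):J_1(u)=c_1\}$. For $v<w$ in $\mathcal{M}_1(v_0,w_0)$: $\hat\Gamma_2(v,w)$ is the set of configurations $u$ with $v\le u\le w$ and $u(\mathbf{i}+\mathbf{e}_k)=u(\mathbf{i})$ for $3\le k\le n$. Put $E_i=\mathbb{Z}\times\{i\}\times\{0\}^{n-2}$. For $u\in\hat\Gamma_2(v,w)$, with the same formulas for $J_{1,i}$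 and $J_{1;p,q}$, the limit $J_1(u)=\lim_{p\to-\infty,q\to\infty}J_{1;p,q}(u)$ exists and equals $c_1+\sum_{\mathbf{j}\in E_0}[S_{\mathbf{j}}(u)-S_{\mathbf{j}}(v)]$. Set $J_{2,i}(u)=J_1(\tau^2_{-i}u)-c_1$, $J_{2;p,q}(u)=\sum_{i=p}^qJ_{2,i}(u)$, $J_2(u)=\liminf_{p\to-\infty,\,q\to\infty}J_{2;p,q}(u)$; $\Gamma_2(v,w)=\{u\in\hat\Gamma_2(v,w):\|u-v\|_{E_i}\to0\text{ as }i\to-\infty,\ \|u-w\|_{E_i}\to0\text{ as }i\to\infty\}$; $c_2(v,w)=\inf_{\Gamma_2(v,w)}J_2$; $\mathcal{M}_2(v,w)=\{u\in\Gamma_2(v,w):J_2(u)=c_2(v,w)\}$. *)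

(* Defs.v *)
From HB Require Import structures.
From mathcomp Require Import all_boot all_order all_algebra.
From mathcomp Require Import all_classical all_reals all_analysis.

Set Implicit Arguments.
Unset Strict Implicit.
Unset Printing Implicit Defensive.

Import Order.TTheory GRing.Theory Num.Theory.
Import numFieldNormedType.Exports.

Local Open Scope classical_set_scope.
Local Open Scope ring_scope.

Notation lattice n := 'rV[int]_n.

Definition lnorm n (i : lattice n) : nat := (\sum_k `|i ord0 k|)%N.

(* The ball B_0^r as an index type; R^(B_0^r) is lball n r -> R *)
Definition lball (n r : nat) := {k : lattice n | (lnorm k <= r)%N}.

(* e_k with the 1-based numbering of coordinates 1 <= k <= n. *)
Definition unitv n (k : nat) : lattice n := \row_(j < n) (j.+1 == k)%:R.

Arguments unitv {n} k.

Definition config (R : realType) (n : nat) := lattice n -> R.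

(* dF/dx_k; the index type T may be infinite, so that it also applies to
   functions of a configuration. *)
Definition partial (R : realType) (T : eqType) (k : T)
    (F : (T -> R) -> R) (x : T -> R) : R :=
  derive1 (fun t : R => F [eta x with k |-> t]) (x k).

(* For a finite index type T, the product topology {ptws T -> R} is the usual
   topology of R^T. *)
Definition C1 (R : realType) (T : eqType) (F : (T -> R) -> R) : Prop :=
  [/\ continuous (F : {ptws T -> R} -> R),
      forall (k : T) (x : T -> R),
        derivable (fun t : R => F [eta x with k |-> t]) (x k) 1 &
      forall k : T, continuous (partial k F : {ptws T -> R} -> R)].

Definition C2 (R : realType) (T : eqType) (F : (T -> R) -> R) : Prop :=
  C1 F /\ forall k : T, C1 (partial k F).

Definition S1 (R : realType) n r (s : (lball n r -> R) -> R) : Prop :=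
  forall u, s (fun k => u k + 1) = s u.

Definition S2 (R : realType) n r (s : (lball n r -> R) -> R) : Prop :=
  (exists m : R, forall u, m <= s u) /\
  (forall k j : lball n r, lnorm (val k - val j) = 1%N ->
    forall M : R, exists C : R, forall u, C <= `|u k - u j| -> M <= s u).

Definition S3 (R : realType) n r (s : (lball n r -> R) -> R) : Prop :=
  (forall k j : lball n r, k != j ->
    forall u, partial k (partial j s) u <= 0) /\
  (forall k j : lball n r, val k = 0 -> lnorm (val j) = 1%N ->
    forall u, partial k (partial j s) u < 0).

Definition admissible (R : realType) n r (s : (lball n r -> R) -> R) : Prop :=
  [/\ S1 s, S2 s & S3 s].

(* tau k a u is tau^k_{-a} u *)
Definition tau (R : realType) n (k : nat) (a : int) (u : config R n) :
    config R n :=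
  fun i => u (i + a *: unitv k).

(* tau^n_{-j_n} ... tau^1_{-j_1} u *)
Definition taus (R : realType) n (j : lattice n) (u : config R n) :
    config R n :=
  foldl (fun v (k : 'I_n) => tau k.+1 (j ord0 k) v) u (enum 'I_n).

Definition local_potential (R : realType) n r (s : (lball n r -> R) -> R)
    (j : lattice n) (u : config R n) : R :=
  s (fun k => taus j u (val k)).

Definition EL_solution (R : realType) n r (s : (lball n r -> R) -> R)
    (u : config R n) : Prop :=
  forall i : lattice n,
    \sum_(j \in [set j | (lnorm (j - i) <= r)%N])
      partial i (local_potential s j) u = 0.

Lemma tausE (R : realType) n (j : lattice n) (u : config R n) :
  taus j u = fun i => u (i + j).
Proof.
have foldlE (l : seq 'I_n) (v : config R n) :
    foldl (fun v (k : 'I_n) => tau k.+1 (j ord0 k) v) v l =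
    fun i => v (i + \sum_(k <- l) j ord0 k *: unitv k.+1).
  elim: l v => [|k l IH] v /=; apply: funext => i.
    by rewrite big_nil addr0.
  by rewrite IH /tau big_cons -addrA [X in v (_ + X)]addrC.
rewrite /taus foldlE; apply: funext => i; congr (u (_ + _)).
rewrite big_enum /=; apply/rowP => l.
rewrite summxE (bigD1 l)//= !mxE eqxx mulr1 big1 ?addr0// => k kl.
by rewrite !mxE eqSS eq_sym (negbTE kl : (k == l :> nat) = false) mulr0.
Qed.

Definition cle (R : realType) n (u v : config R n) : Prop :=
  forall i, u i <= v i.

Definition clt (R : realType) n (u v : config R n) : Prop :=
  forall i, u i < v i.

Definition ordered (R : realType) n (A : set (config R n)) : Prop :=
  forall u v, A u -> A v -> [\/ clt u v, u = v | clt v u].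

Definition adjacent_in (R : realType) n (A : set (config R n))
    (v w : config R n) : Prop :=
  [/\ A v, A w, clt v w &
      ~ exists u, [/\ A u, cle v u, cle u w, u <> v & u <> w]].

Definition periodic_from (R : realType) n (m : nat) (u : config R n) : Prop :=
  forall k, (m <= k <= n)%N -> forall i, u (i + unitv k) = u i.

Definition Gamma0 (R : realType) n : set (config R n) :=
  [set u | periodic_from 1 u].

Definition J0 (R : realType) n r (s : (lball n r -> R) -> R)
    (u : config R n) : R := local_potential s 0 u.

Definition c0 (R : realType) n r (s : (lball n r -> R) -> R) : R :=
  inf [set J0 s u | u in @Gamma0 R n].

Definition M0 (R : realType) n r (s : (lball n r -> R) -> R) :
    set (config R n) :=
  [set u | Gamma0 u /\ J0 s u = c0 s].

(* liminf of a_{p,q} as p -> -oo and q -> +oo (jointly) *)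
Definition liminf_pq (R : realType) (a : int -> int -> \bar R) : \bar R :=
  limf_einf (fun mq : nat * nat => a (- mq.1%:Z) mq.2%:Z)
    (filter_prod \oo \oo).

Definition T_ n (i : int) : lattice n := i *: unitv 1.

Arguments T_ {n} i.

Definition Gammahat1 (R : realType) n (v0 w0 : config R n) :
    set (config R n) :=
  [set u | [/\ cle v0 u, cle u w0 & periodic_from 2 u]].

Definition J1i (R : realType) n r (s : (lball n r -> R) -> R)
    (i : int) (u : config R n) : R :=
  local_potential s (T_ i) u - c0 s.

Definition J1pq (R : realType) n r (s : (lball n r -> R) -> R)
    (p q : int) (u : config R n) : R :=
  \sum_(i \in [set i : int | p <= i <= q]) J1i s i u.

(* Used on Gammahat1 and on Gammahat2; on the latter the liminf is a limit. *)
Definition J1 (R : realType) n r (s : (lball n r -> R) -> R)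
    (u : config R n) : \bar R :=
  liminf_pq (fun p q => (J1pq s p q u)%:E).

Definition Gamma1 (R : realType) n (v0 w0 : config R n) :
    set (config R n) :=
  [set u | [/\ Gammahat1 v0 w0 u,
     `|u (T_ (- i%:Z)) - v0 (T_ (- i%:Z))| @[i --> \oo] --> (0 : R) &
     `|u (T_ i%:Z) - w0 (T_ i%:Z)| @[i --> \oo] --> (0 : R)]].

Definition c1 (R : realType) n r (s : (lball n r -> R) -> R)
    (v0 w0 : config R n) : \bar R :=
  ereal_inf [set J1 s u | u in Gamma1 v0 w0].

Definition M1 (R : realType) n r (s : (lball n r -> R) -> R)
    (v0 w0 : config R n) : set (config R n) :=
  [set u | Gamma1 v0 w0 u /\ J1 s u = c1 s v0 w0].

Definition norm_on (R : realType) n (E : set (lattice n))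
    (u : config R n) : \bar R :=
  (\esum_(j in E) `|u j|%:E)%E.

(* Z x {i} x {0}^(n-2) *)
Definition E_ n (i : int) : set (lattice n) :=
  [set a *: unitv 1 + i *: unitv 2 | a in [set: int]].

Arguments E_ {n} i.

Definition Gammahat2 (R : realType) n (v w : config R n) :
    set (config R n) :=
  [set u | [/\ cle v u, cle u w & periodic_from 3 u]].

Definition J2i (R : realType) n r (s : (lball n r -> R) -> R)
    (v0 w0 : config R n) (i : int) (u : config R n) : \bar R :=
  (J1 s (tau 2 i u) - c1 s v0 w0)%E.

Definition J2pq (R : realType) n r (s : (lball n r -> R) -> R)
    (v0 w0 : config R n) (p q : int) (u : config R n) : \bar R :=
  (\sum_(i \in [set i : int | (p <= i <= q)%R]) J2i s v0 w0 i u)%E.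

Definition J2 (R : realType) n r (s : (lball n r -> R) -> R)
    (v0 w0 : config R n) (u : config R n) : \bar R :=
  liminf_pq (fun p q => J2pq s v0 w0 p q u).

Definition Gamma2 (R : realType) n (v w : config R n) :
    set (config R n) :=
  [set u | [/\ Gammahat2 v w u,
     norm_on (E_ (- i%:Z)) (fun j => u j - v j) @[i --> \oo] --> 0%E &
     norm_on (E_ i%:Z) (fun j => u j - w j) @[i --> \oo] --> 0%E]].

Definition c2 (R : realType) n r (s : (lball n r -> R) -> R)
    (v0 w0 v w : config R n) : \bar R :=
  ereal_inf [set J2 s v0 w0 u | u in Gamma2 v w].

Definition M2 (R : realType) n r (s : (lball n r -> R) -> R)
    (v0 w0 v w : config R n) : set (config R n) :=
  [set u | Gamma2 v w u /\ J2 s v0 w0 u = c2 s v0 w0 v w].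

(* Main.v *)
Require Import Defs.
From mathcomp Require Import all_boot all_order all_algebra.
From mathcomp Require Import all_classical all_reals all_analysis.
From mathcomp Require Import zify ring lra.

Set Implicit Arguments.
Unset Strict Implicit.
Unset Printing Implicit Defensive.

Import Order.TTheory GRing.Theory Num.Theory.
Import numFieldNormedType.Exports.

Local Open Scope classical_set_scope.
Local Open Scope ring_scope.

(** Both heteroclinic problems have the same shape. Cut the configurations
    into cells along one axis: at the first level the cells are the sites
    [T_ i] and the energy of a cell is its local potential minus [c0]; at the
    second level the cells are the rows [E_ i] and the energy of a cell is
    [J1] of the row minus [c1]. In both cases cells interact within distance
    [r], the energy is submodular because the mixed partial derivatives of [s]
    off the diagonal are nonpositive, and a configuration invariant under
    translation of the cells has nonnegative energy, which vanishes only at the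
    two given adjacent minimizers [v < w]. These properties form
    [chain_energy], and the minimization among the configurations that connect
    [v] to [w] is solved once for all chains.

    The infimum of all translates of a periodic configuration is invariant, and
    by submodularity the infimum of almost minimizers is an almost minimizer;
    so a periodic chain has nonnegative energy ([blk_periodic_ge0]). A long
    block whose cells stay near [v] can be closed up into a periodic chain at a
    small cost, hence its energy is almost nonnegative ([blk_lower]). It follows
    that the partial sums of the energy are almost increasing in the window and
    converge, possibly to infinity ([action_of_frequently_le]).

    For the existence of a minimizer, cut a competitor off so that it equals
    [v] far to the left and [w] far to the right ([cutoff]). In a strip of fixed
    width the infimum of sufficiently many translates of an almost minimizer is
    again an almost minimizer and is monotone along the chain
    ([strip_monotone]). Monotone almost minimizers, translated so that they
    cross a fixed level at a fixed cell, have a pointwise cluster point, which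
    is monotone; its limits at the two ends are invariant and have zero energy,
    so they are [v] and [w] ([monotone_end], [action_minimizer_exists]).

    Where a minimizer lies strictly between [v] and [w], both variations are
    admissible; where it touches [v] or [w], one variation is admissible and
    the comparison principle [EL_le] with the solution [v] or [w] gives the
    missing inequality ([minimizer_EL]). Minima and maxima of two minimizers are
    minimizers, so the strong maximum principle [EL_touch] makes the set of
    minimizers ordered; a minimizer and its translate are comparable, and the
    behaviour at infinity selects [U < tau U].

    The passage to the second level rests on the first: [w1] lies below the
    translate of [v1] along the first axis, so that the sum of [w1 - v1] over a
    row telescopes ([gap_sums]) and [J1] is a convergent sum on every row of a
    configuration between [v1] and [w1] ([row_energy_cvg]). The same inequality
    yields the monotonicity in the first variable:
    [U <= w1 <= tau v1 <= tau U]. *)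

(** * Functions of several real variables *)

Section SeveralVariables.
Context {R : realType} {T : eqType}.
Implicit Types (F : (T -> R) -> R) (x y z : T -> R).

Definition upd x k t : T -> R := [eta x with k |-> t].

Lemma updE x k t j : upd x k t j = if j == k then t else x j.
Proof. by []. Qed.

Lemma upd_id x k : upd x k (x k) = x.
Proof. by apply: funext => j; rewrite updE; case: eqP => [->|]. Qed.

Lemma upd_upd x k t t' : upd (upd x k t) k t' = upd x k t'.
Proof. by apply: funext => j; rewrite !updE; case: eqP. Qed.

(** Only separate differentiability: the mean value arguments below move one
    coordinate at a time. *)
Definition partially_derivable F := forall (k : T) x,
  derivable (fun t : R => F (upd x k t)) (x k) 1.

Lemma is_derive_upd F k x (t : R) : partially_derivable F ->
  is_derive t (1 : R) (fun t : R => F (upd x k t))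
    (partial k F (upd x k t)).
Proof.
move=> dF; have := dF k (upd x k t).
rewrite /partial updE eqxx derive1E.
by under eq_fun do rewrite upd_upd; apply: derivableP.
Qed.

Lemma mean_value_coordinate F k x (t : R) : partially_derivable F ->
  exists c, Num.min (x k) t <= c <= Num.max (x k) t /\
    F (upd x k t) - F x = (t - x k) * partial k F (upd x k c).
Proof.
move=> dF.
have seg a b : a <= b -> exists2 c, a <= c <= b &
    F (upd x k b) - F (upd x k a) =
    partial k F (upd x k c) * (b - a).
  move=> ab; have [|c] := @MVT_segment R (fun t => F (upd x k t))
      (fun t => partial k F (upd x k t)) a b ab (fun c _ => is_derive_upd k x c dF).
    apply: continuous_subspaceT => c; apply/differentiable_continuous.
    by apply/derivable1_diffP; have [] := is_derive_upd k x c dF.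
  by rewrite in_itv /= => hc eqc; exists c.
case: (leP (x k) t) => xt.
  have [c hc e] := seg _ _ xt; exists c; split => //.
  by move: e; rewrite upd_id => ->; rewrite mulrC.
have [c hc e] := seg _ _ (ltW xt); exists c; split => //.
by move: e; rewrite upd_id => e; rewrite -opprB e; ring.
Qed.

(** Going from [x] to [y] one coordinate at a time, with the mean value theorem
    on each step, evaluates the partial derivatives at points of the box spanned
    by [x] and [y]. The Lipschitz bound, the monotonicity of the partial
    derivatives and the first-order expansion are all read off this formula. *)
Lemma mean_value_path F x y (l : seq T) : partially_derivable F ->
  uniq l -> (forall k, k \in l) ->
  exists z : T -> T -> R,
    (forall k j, Num.min (x j) (y j) <= z k j <= Num.max (x j) (y j)) /\
    F y - F x = \sum_(k <- l) (y k - x k) * partial k F (z k).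
Proof.
move=> dF ul allP.
(* [g l] has already moved the coordinates of [l] from [x] to [y]. *)
pose g (l : seq T) (j : T) := if j \in l then y j else x j.
suff H (l' : seq T) : uniq l' -> exists z : T -> T -> R,
    (forall k j, Num.min (x j) (y j) <= z k j <= Num.max (x j) (y j)) /\
    F (g l') - F x = \sum_(k <- l') (y k - x k) * partial k F (z k).
  have [z [hz e]] := H l ul; exists z; split => //.
  by rewrite -e; congr (F _ - _); apply: funext => j; rewrite /g allP.
have gb l1 j : Num.min (x j) (y j) <= g l1 j <= Num.max (x j) (y j).
  by rewrite /g; case: ifP => _; rewrite ge_min le_max lexx ?orbT.
elim: l' => [_|k l' IH /= /andP[kl ul']].
  exists (fun _ => x); split; first by move=> _ j; have := gb [::] j.
  rewrite big_nil (_ : g [::] = x) ?subrr//.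
have [z [hz e]] := IH ul'.
have [c [hc ec]] := mean_value_coordinate k (g l') (y k) dF.
have gk : g l' k = x k by rewrite /g (negbTE kl).
exists (fun i => if i == k then upd (g l') k c else z i); split.
  move=> i j; case: eqP => [_|_]; last exact: hz.
  rewrite updE; case: eqP => [->|_]; last exact: gb.
  by rewrite -gk.
rewrite big_cons eqxx.
have -> : g (k :: l') = upd (g l') k (y k).
  apply: funext => j; rewrite updE /g inE; case: eqP => [->|] //.
rewrite (_ : \sum_(j <- l') _ = F (g l') - F x); last first.
  rewrite e; apply: eq_big_seq => j jl.
  by case: eqP => // jk; rewrite -jk jl in kl.
by rewrite -gk -ec; ring.
Qed.

Lemma cvg_ptws (I : Type) (G : set_system I) (FG : Filter G)
    (y : I -> T -> R) x :
  (forall k, y i k @[i --> G] --> x k) ->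
  (y : I -> {ptws T -> R}) @ G --> (x : {ptws T -> R}).
Proof.
move=> yx; apply/cvg_sup => k W.
have /= -> := @nbhsE (initial_topology (fun f : T -> R => f k)) x.
case=> B [[C oC <-] xC] /filterS; apply; apply: (yx k).
exact: open_nbhs_nbhs.
Qed.

(** Continuity for the product topology as a uniform radius on all coordinates:
    a sequence violating it at radii [1 / n] would converge pointwise. *)
Lemma ptws_modulus F x (e : R) :
  continuous (F : {ptws T -> R} -> R) -> 0 < e ->
  exists2 d : R, 0 < d &
    forall y, (forall k, `|y k - x k| <= d) -> `|F y - F x| <= e.
Proof.
move=> cF e0; apply: contrapT => nH.
have H (n : nat) : exists y, (forall k, `|y k - x k| <= n.+1%:R^-1) /\
    e < `|F y - F x|.
  apply: contrapT => nH'; apply: nH; exists n.+1%:R^-1.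
    by rewrite invr_gt0.
  move=> y hy; rewrite leNgt; apply/negP => hF; apply: nH'; by exists y.
have [y hy] := choice H.
have yx : (y : nat -> {ptws T -> R}) @ \oo --> (x : {ptws T -> R}).
  apply: cvg_ptws => k; apply/cvgrPdist_le => a a0.
  have [N _ HN] := near_infty_natSinv_lt (PosNum a0).
  exists N => //= i /HN /= /ltW; rewrite distrC; apply: le_trans.
  by have [+ _] := hy i; apply.
have := cvg_comp _ _ yx (cF x).
move/cvgrPdist_lt => /(_ _ e0) [N _ /(_ N (leqnn N))] /=.
by rewrite distrC; have [_ /lt_trans h /h] := hy N; rewrite ltxx.
Qed.

(** A box is compact by Tychonoff's theorem. *)
Lemma ptws_bounded_on_box F (a b : R) :
  continuous (F : {ptws T -> R} -> R) ->
  exists L : R, 0 <= L /\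
    forall x, (forall k, a <= x k <= b) -> `|F x| <= L.
Proof.
move=> cF.
pose K : set {ptws T -> R} := [set x | forall k, `[a, b]%classic (x k)].
have cK : compact K.
  exact: (@tychonoff T (fun=> R) (fun=> `[a, b]%classic)
    (fun=> @segment_compact R a b)).
have cFK : compact ((F : {ptws T -> R} -> R) @` K).
  by apply: continuous_compact => //; exact: continuous_subspaceT.
have [M [_ HM]] := compact_bounded cFK.
exists (Num.max 0 (M + 1)); split; first by rewrite le_max lexx.
move=> x hx; apply: le_trans (_ : M + 1 <= _); last by rewrite le_max lexx orbT.
apply: (HM (M + 1)); first by rewrite ltrDl.
by exists x => // k /=; rewrite in_itv /= hx.
Qed.

End SeveralVariables.

Section FiniteVariables.
Context {R : realType} {T : eqType} (l : seq T).
Hypotheses (l_uniq : uniq l) (l_all : forall k, k \in l).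
Implicit Types (F : (T -> R) -> R) (x y z : T -> R).

Lemma common_radius (P : T -> R -> Prop) :
  (forall k d d', 0 < d' <= d -> P k d -> P k d') ->
  (forall k, exists2 d, 0 < d & P k d) -> exists2 d, 0 < d & forall k, P k d.
Proof.
move=> Pmon Pex.
suff [d d0 Pd] : exists2 d, 0 < d & forall k, k \in l -> P k d.
  by exists d => // k; exact: Pd.
elim: l => [|k l' [d d0 IH]]; first by exists 1.
have [d' d'0 Pd'] := Pex k; exists (Num.min d d'); first by rewrite lt_min d0.
have m0 : 0 < Num.min d d' by rewrite lt_min d0.
move=> j; rewrite inE => /predU1P[->|jl].
  by apply: Pmon Pd'; rewrite m0 ge_min lexx orbT.
by apply: Pmon (IH _ jl); rewrite m0 ge_min lexx.
Qed.

Lemma C1_partially_derivable F : C1 F -> partially_derivable F.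
Proof. by move=> [_ dF _]. Qed.

Lemma C1_lipschitz_on_box F (a b : R) : C1 F ->
  exists2 L : R, 0 <= L & forall x y,
    (forall k, a <= x k <= b) -> (forall k, a <= y k <= b) ->
    `|F y - F x| <= L * \sum_(k <- l) `|y k - x k|.
Proof.
move=> [_ dF cF].
have [L hL] := choice (fun k => ptws_bounded_on_box a b (cF k)).
have L0 k : 0 <= L k by have [] := hL k.
exists (\sum_(k <- l) L k); first by apply: sumr_ge0 => k _.
move=> x y hx hy.
have [z [hz ->]] := mean_value_path x y dF l_uniq l_all.
apply: le_trans (ler_norm_sum _ _ _) _.
rewrite mulr_sumr; apply: ler_sum => k _; rewrite normrM mulrC ler_wpM2r//.
have [_ hLk] := hL k; apply: le_trans (hLk (z k) _) _.
  move=> j; have /andP[h1 h2] := hz k j.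
  move: (hx j) (hy j) => /andP[x1 x2] /andP[y1 y2]; apply/andP; split.
    by apply: le_trans h1; rewrite le_min x1.
  by apply: le_trans h2 _; rewrite ge_max x2.
by rewrite (bigD1_seq k)//= lerDl; apply: sumr_ge0.
Qed.

(** For the partial derivative [F] of [s] in the direction [j], the partial
    derivatives in the other directions are nonpositive; the term of the
    direction [j] vanishes since [x] and [y] agree there. *)
Lemma nonincreasing_off_coordinate F (j : T) x y :
  partially_derivable F -> (forall k u, k != j -> partial k F u <= 0) ->
  (forall k, x k <= y k) -> x j = y j -> F y <= F x.
Proof.
move=> dF F0 xy xyj; rewrite -subr_le0.
have [z [_ ->]] := mean_value_path x y dF l_uniq l_all.
apply: sumr_le0 => k _; have [->|kj] := eqVneq k j.
  by rewrite xyj subrr mul0r.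
by rewrite mulr_ge0_le0 ?subr_ge0 ?F0.
Qed.

Lemma decreasing_off_coordinate F (j i : T) x y :
  partially_derivable F -> (forall k u, k != j -> partial k F u <= 0) ->
  (forall u, partial i F u < 0) ->
  (forall k, x k <= y k) -> x j = y j -> x i < y i -> F y < F x.
Proof.
move=> dF F0 Fi xy xyj xyi; rewrite -subr_lt0.
have [z [_ ->]] := mean_value_path x y dF l_uniq l_all.
rewrite (bigD1_seq i)//=; apply: (@lt_le_trans _ _ 0) => //.
rewrite -[ltRHS]addr0 ltr_leD//; first by rewrite pmulr_rlt0 ?subr_gt0.
apply: sumr_le0 => k _; have [->|kj] := eqVneq k j.
  by rewrite xyj subrr mul0r.
by rewrite mulr_ge0_le0 ?subr_ge0 ?F0.
Qed.

(** First-order expansion in the direction of the indicator of [D]; it uses the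
    continuity of the partial derivatives, since the points given by the mean
    value formula differ from one coordinate to the next. *)
Lemma C1_expansion F (D : pred T) x (e : R) : C1 F -> 0 < e ->
  exists2 d : R, 0 < d & forall t, `|t| <= d ->
    `|F (fun j => if D j then x j + t else x j) - F x -
      t * \sum_(k <- l | D k) partial k F x| <= e * `|t|.
Proof.
move=> [_ dF cF] e0.
have e1 : 0 < e / (size l).+1%:R by rewrite divr_gt0.
have [d d0 hd] := @common_radius (fun k d => forall y,
    (forall j, `|y j - x j| <= d) ->
    `|partial k F y - partial k F x| <= e / (size l).+1%:R)
  (fun k d d' dd H y hy => H y (fun j => le_trans (hy j) (proj2 (andP dd))))
  (fun k => ptws_modulus x (cF k) e1).
exists d => // t td; set y := fun j => _.
have [z [hz ->]] := mean_value_path x y dF l_uniq l_all.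
rewrite [X in _ - _ * X]big_mkcond mulr_sumr -sumrB.
apply: le_trans (ler_norm_sum _ _ _) _.
have zd k j : `|z k j - x j| <= d.
  apply: le_trans td; have := hz k j; rewrite /y; case: (D j); last first.
    by rewrite minxx maxxx => /le_anti <-; rewrite subrr normr0.
  move: (z k j) (x j) => a b /andP[]; rewrite ge_min le_max.
  by have [t0|t0] := ger0P t; move=> /orP[] ? /orP[] ?;
    rewrite ler_norml; apply/andP; split; lra.
apply: le_trans (_ : \sum_(k <- l) e / (size l).+1%:R * `|t| <= _).
  apply: ler_sum => k _; rewrite /y; case: (D k); last first.
    by rewrite subrr mulr0 mul0r subr0 normr0 mulr_ge0// ltW.
  rewrite -[X in `|X - _|]/((x k + t - x k) * _) [x k + t]addrC addrK -mulrBr.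
  by rewrite normrM mulrC ler_wpM2r// hd.
rewrite big_const_seq count_predT iter_addr_0 -[leLHS]mulr_natr.
rewrite [leLHS]mulrAC ler_wpM2r//.
rewrite -mulrA ler_piMr ?(ltW e0)//  mulrC ler_pdivrMr// mul1r ler_nat.
exact: leqnSn.
Qed.

(** The mixed partial derivatives off the diagonal being nonpositive, an
    increment in one coordinate can only decrease when the others grow. *)
Lemma increment_nonincreasing F k x y (a b : R) :
  partially_derivable F -> partially_derivable (partial k F) ->
  (forall j u, j != k -> partial j (partial k F) u <= 0) ->
  (forall j, x j <= y j) -> a <= b ->
  F (upd y k b) - F (upd y k a) <= F (upd x k b) - F (upd x k a).
Proof.
move=> dF dkF F0 xy ab.
pose h t := F (upd y k t) - F (upd x k t).
pose dh t := partial k F (upd y k t) - partial k F (upd x k t).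
have dh_ t : is_derive (t : R) (1 : R) h (dh t).
  by apply: is_deriveB; exact: is_derive_upd.
have [|c _] := @MVT_segment R h dh a b ab (fun c _ => dh_ c).
  apply: continuous_subspaceT => c; apply/differentiable_continuous.
  by apply/derivable1_diffP; have [] := dh_ c.
rewrite /h => e; suff : dh c * (b - a) <= 0 by rewrite -e; lra.
rewrite mulr_le0_ge0 ?subr_ge0// subr_le0.
apply: (nonincreasing_off_coordinate dkF) F0 _ _.
  by move=> j; rewrite !updE; case: eqP.
by rewrite !updE eqxx.
Qed.

(** Raise the coordinates of [min x y] to those of [x] one by one, and
    simultaneously those of [y] to those of [max x y]: each step costs less in
    the upper configuration, by [increment_nonincreasing]. *)
Lemma submodular_of_partial F x y :
  partially_derivable F -> (forall k, partially_derivable (partial k F)) ->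
  (forall j k u, j != k -> partial j (partial k F) u <= 0) ->
  F (fun j => Num.min (x j) (y j)) + F (fun j => Num.max (x j) (y j)) <=
  F x + F y.
Proof.
move=> dF dkF F0.
pose X (l' : seq T) j := if j \in l' then x j else Num.min (x j) (y j).
pose Y (l' : seq T) j := if j \in l' then Num.max (x j) (y j) else y j.
have XY l' j : X l' j <= Y l' j.
  by rewrite /X /Y; case: ifP => _; rewrite ?le_max ?ge_min lexx ?orbT.
suff H l' : uniq l' -> F (Y l') - F y <= F (X l') - F (X [::]).
  have := H l l_uniq.
  have -> : Y l = (fun j => Num.max (x j) (y j)).
    by apply: funext => j; rewrite /Y l_all.
  have -> : X l = x by apply: funext => j; rewrite /X l_all.
  have -> : X [::] = (fun j => Num.min (x j) (y j)) by [].
  lra.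
elim: l' => [_|k l' IH /= /andP[kl /IH {}IH]].
  by rewrite (_ : Y [::] = y) ?subrr.
have [xyk|yxk] := leP (x k) (y k).
  have -> : X (k :: l') = X l'.
    apply: funext => j; rewrite /X inE; case: eqP => //= ->.
    by rewrite (negbTE kl) min_l.
  have -> // : Y (k :: l') = Y l'.
  apply: funext => j; rewrite /Y inE; case: eqP => //= ->.
  by rewrite (negbTE kl) max_r.
have -> : X (k :: l') = upd (X l') k (x k).
  by apply: funext => j; rewrite updE /X inE; case: eqP => //= ->.
have -> : Y (k :: l') = upd (Y l') k (x k).
  apply: funext => j; rewrite updE /Y inE; case: eqP => //= ->.
  by rewrite max_l// ltW.
have := increment_nonincreasing dF (dkF k) (fun j u => @F0 j k u) (XY l')
  (ltW yxk).
have -> : upd (Y l') k (y k) = Y l'.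
  by rewrite -[RHS](upd_id _ k) {3}/Y (negbTE kl).
have -> : upd (X l') k (y k) = X l'.
  by rewrite -[RHS](upd_id _ k) {3}/X (negbTE kl) min_r// ltW.
lra.
Qed.

End FiniteVariables.

(** * The ball of the lattice and periodic configurations *)

Section Ball.
Context (n r : nat).

Lemma lnorm_coord (x : lattice n) j : (`|x ord0 j| <= lnorm x)%N.
Proof. by rewrite /lnorm (bigD1 j)//= leq_addr. Qed.

Lemma lball_finite : {l : seq (lball n r) | uniq l & forall k, k \in l}.
Proof.
exists (undup (pmap insub [seq \row_j ((f j : nat)%:Z - r%:Z) |
    f : {ffun 'I_n -> 'I_(r + r).+1} <- enum {ffun 'I_n -> 'I_(r + r).+1}])).
  exact: undup_uniq.
move=> k; rewrite mem_undup mem_pmap_sub; apply/mapP.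
exists [ffun j => inord `|val k ord0 j + r%:Z|]; first by rewrite mem_enum.
apply/rowP => j; rewrite mxE ffunE.
have kj : (`|val k ord0 j| <= r)%N by exact: leq_trans (lnorm_coord _ _) (valP k).
rewrite inordK; last by lia.
by move: (val k ord0 j) kj => x; lia.
Qed.

Definition ball_enum : seq (lball n r) := s2val lball_finite.

Lemma ball_enum_uniq : uniq ball_enum.
Proof. exact: s2valP lball_finite. Qed.

Lemma mem_ball_enum k : k \in ball_enum.
Proof. exact: s2valP' lball_finite k. Qed.

Lemma lnormN (x : lattice n) : lnorm (- x) = lnorm x.
Proof. by apply: eq_bigr => j _; rewrite !mxE abszN. Qed.

Lemma lnorm0 : @lnorm n 0 = 0%N.
Proof. by apply: big1 => j _; rewrite mxE. Qed.

Lemma lnorm_eq0 (x : lattice n) : lnorm x = 0%N -> x = 0.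
Proof.
move=> x0; apply/rowP => j; rewrite mxE; apply/eqP.
by have := lnorm_coord x j; rewrite x0 leqn0 absz_eq0.
Qed.

Lemma lattice_step (x : lattice n) : x != 0 ->
  exists e : lattice n, lnorm e = 1%N /\ (lnorm (x - e) < lnorm x)%N.
Proof.
move=> x0; have [j xj] : exists j, x ord0 j != 0.
  apply: contrapT => H; move/eqP: x0; apply; apply/rowP => j; rewrite mxE.
  by apply: contrapT => xj; apply: H; exists j; apply/eqP.
pose c : int := sgz (x ord0 j); pose e : lattice n := c *: unitv j.+1.
have ei i : e ord0 i = if i == j then c else 0.
  by rewrite !mxE eqSS val_eqE; case: (i == j); rewrite ?mulr1 ?mulr0.
have xe i : (x - e) ord0 i = x ord0 i - (if i == j then c else 0).
  by rewrite mxE [(- e) _ _]mxE ei.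
exists e; split.
  rewrite /lnorm (bigD1 j)//= ei eqxx big1 ?addn0 => [|i ij].
    by rewrite /c; case: sgzP xj.
  by rewrite ei (negbTE ij).
rewrite /lnorm (bigD1 j)//= [ltnRHS](bigD1 j)//= -addSn leq_add//.
  rewrite xe eqxx /c.
  by case: sgzP xj => //; lia.
apply: leq_sum => i ij.
by rewrite xe (negbTE ij) subr0.
Qed.

(** Any site is reached from [x] through neighbours, since a suitable unit step
    decreases the norm of the difference. *)
Lemma lattice_connected (P : lattice n -> Prop) x :
  (forall y e, lnorm e = 1%N -> P y -> P (y - e)) -> P x -> forall y, P y.
Proof.
move=> Pstep Px y; rewrite -[y](subrK x).
move: {2}(lnorm (y - x)) (leqnn (lnorm (y - x))) => N.
elim: N (y - x) => [|N IH] z zN.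
  by rewrite (@lnorm_eq0 z) ?add0r//; lia.
have [->|z0] := eqVneq z 0; first by rewrite add0r.
have [e [e1 ze]] := lattice_step z0.
have := Pstep _ (- e) _ (IH (z - e) _).
rewrite lnormN e1 => /(_ erefl); rewrite opprK addrAC subrK; apply.
by rewrite -ltnS (leq_trans ze).
Qed.

End Ball.

Section Periodicity.
Context {R : realType} {n : nat}.
Implicit Types (u v : config R n) (x y : lattice n) (m : nat).

(** Two sites that a configuration periodic in the directions above [m]
    cannot tell apart. *)
Definition agree m x y : bool :=
  [forall j : 'I_n, (j < m)%N ==> (x ord0 j == y ord0 j)].

Lemma agreeP m x y :
  reflect (forall j : 'I_n, (j < m)%N -> x ord0 j = y ord0 j) (agree m x y).
Proof.
apply: (iffP forallP) => H j; first by move=> jm; apply/eqP; have /implyP := H j; apply.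
by apply/implyP => jm; apply/eqP/H.
Qed.

Lemma agree_refl m x : agree m x x.
Proof. by apply/agreeP. Qed.

Lemma agree_sym m x y : agree m x y = agree m y x.
Proof. by apply/agreeP/agreeP => H j jm; rewrite H. Qed.

Lemma agree_trans m y x z : agree m x y -> agree m y z -> agree m x z.
Proof.
by move=> /agreeP xy /agreeP yz; apply/agreeP => j jm; rewrite xy// yz.
Qed.

Lemma agreeD m x y z : agree m (x + z) (y + z) = agree m x y.
Proof.
by apply/agreeP/agreeP => H j jm; have := H j jm; rewrite !mxE;
  [apply: addIr | move=> ->].
Qed.

Lemma agree_addl m x y z : agree m (z + x) (z + y) = agree m x y.
Proof. by rewrite ![z + _]addrC agreeD. Qed.

Lemma periodicZ m u (k : 'I_n) (a : int) x : periodic_from m.+1 u ->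
  (m <= k)%N -> u (x + a *: unitv k.+1) = u x.
Proof.
move=> pu mk; have p1 y : u (y + unitv k.+1) = u y.
  by apply: pu; rewrite ltnS mk ltn_ord.
elim: a x => [|a IH|a IH] x; first by rewrite scale0r addr0.
  by rewrite intS scalerDl scale1r addrA IH p1.
by rewrite intS opprD scalerDl scaleN1r addrA IH -p1 subrK.
Qed.

Lemma periodic_agree m u x y : periodic_from m.+1 u -> agree m x y -> u x = u y.
Proof.
move=> pu /agreeP xy.
have H (l : seq 'I_n) (a : 'I_n -> int) z : (forall j : 'I_n, (j < m)%N -> a j = 0) ->
    u (z + \sum_(j <- l) a j *: unitv j.+1) = u z.
  move=> a0; elim: l z => [|j l IH] z; first by rewrite big_nil addr0.
  rewrite big_cons addrA IH; case: (ltnP j m) => jm.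
    by rewrite a0// scale0r addr0.
  exact: (periodicZ _ _ pu jm).
rewrite -(H (enum 'I_n) (fun j => y ord0 j - x ord0 j) x); last first.
  by move=> j jm; rewrite xy// subrr.
congr u; apply/rowP => j; rewrite mxE big_enum /= summxE (bigD1 j)//= big1.
  by rewrite !mxE eqxx mulr1 addr0 addrC subrK.
move=> i ij; rewrite !mxE eqSS eq_sym (negbTE ij : (i == j :> nat) = false).
by rewrite mulr0.
Qed.

End Periodicity.

(** * The Euler-Lagrange operator *)

Definition cmin {R : realType} {n} (u v : config R n) : config R n :=
  fun x => Num.min (u x) (v x).
Definition cmax {R : realType} {n} (u v : config R n) : config R n :=
  fun x => Num.max (u x) (v x).

Lemma ltr_sum_seq {R : realType} {T : eqType} (l : seq T) k (f g : T -> R) :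
  k \in l -> (forall i, f i <= g i) -> f k < g k ->
  \sum_(i <- l) f i < \sum_(i <- l) g i.
Proof.
elim: l => // i l IH; rewrite inE !big_cons => /predU1P[<-|kl] fg fgk.
  by rewrite ltr_leD// ler_sum.
by rewrite ler_ltD// IH.
Qed.

Lemma ler_sum_seq1 {R : realType} {T : eqType} (l : seq T) (P : pred T) k (c : R) :
  k \in l -> P k -> 0 <= c -> c <= \sum_(i <- l | P i) c.
Proof.
move=> kl Pk c0; elim: l kl => // i l IH; rewrite inE big_cons.
have S0 : 0 <= \sum_(i <- l | P i) c by apply: sumr_ge0.
move=> /predU1P[<-|kl]; first by rewrite Pk lerDl.
by case: (P i); rewrite ?IH// (le_trans (IH kl))// lerDr.
Qed.

Section EulerLagrange.
Context {R : realType} {n r : nat} (s : (lball n r -> R) -> R).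
Hypotheses (s_C2 : C2 s) (s_S3 : S3 s) (r_gt0 : (0 < r)%N).
Implicit Types (u v : config R n) (x y : lattice n).

Let bs := ball_enum n r.
Let bs_uniq : uniq bs := ball_enum_uniq n r.
Let bs_all : forall k, k \in bs := @mem_ball_enum n r.

Definition loc u x : lball n r -> R := fun k => u (val k + x).

Lemma local_potentialE x u : local_potential s x u = s (loc u x).
Proof. by rewrite /local_potential tausE. Qed.

(** The left-hand side of the Euler-Lagrange equation, summed over the position
    [k] of the site [x] in the ball centred at [x - k]. *)
Definition EL u x : R :=
  \sum_(k <- ball_enum n r) partial k s (loc u (x - val k)).

Lemma EL_solutionE u : EL_solution s u <-> forall x, EL u x = 0.
Proof.
have H x : \sum_(j \in [set j | (lnorm (j - x) <= r)%N])
    partial x (local_potential s j) u = EL u x.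
  have -> : [set j | (lnorm (j - x) <= r)%N] =
      [set` [seq x - val k | k : lball n r <- bs]].
    apply/seteqP; split => [j /= jx|j /= /mapP[k _ ->]]; last first.
      by rewrite addrAC subrr add0r lnormN; exact: (valP k).
    have xj : (lnorm (x - j) <= r)%N by rewrite -lnormN opprB.
    apply/mapP; exists (exist _ (x - j) xj) => //=.
    by rewrite opprB addrC subrK.
  rewrite -fsbig_seq ?big_map.
    apply: eq_bigr => k _; rewrite /partial.
    have -> : loc u (x - val k) k = u x by rewrite /loc addrC subrK.
    suff -> : (fun t => local_potential s (x - val k) [eta u with x |-> t]) =
        (fun t => s [eta loc u (x - val k) with k |-> t]) by [].
    apply: funext => t; rewrite local_potentialE.
    congr s; apply: funext => k' /=; rewrite /loc /=.
    rewrite addrCA -[X in _ == X](addr0 x).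
    by rewrite (inj_eq (addrI x)) subr_eq0 val_eqE.
  rewrite map_inj_uniq // => k k' /addrI /oppr_inj; exact: val_inj.
by split=> EL0 x; have := EL0 x; rewrite H.
Qed.

Let partially_derivable_s : partially_derivable s.
Proof. by have [/C1_partially_derivable] := s_C2. Qed.

Let partially_derivable_ds k : partially_derivable (partial k s).
Proof. by have [_ /(_ k)/C1_partially_derivable] := s_C2. Qed.

Let mixed_le0 j k (w : lball n r -> R) :
  j != k -> partial j (partial k s) w <= 0.
Proof. by move=> jk; apply: (proj1 s_S3). Qed.

Lemma EL_term_le u v x k : cle u v -> u x = v x ->
  partial k s (loc v (x - val k)) <= partial k s (loc u (x - val k)).
Proof.
move=> uv uvx; apply: (nonincreasing_off_coordinate bs_uniq bs_all).
- exact: partially_derivable_ds.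
- by move=> j w; exact: mixed_le0.
- by move=> j; exact: uv.
- by rewrite /loc addrC subrK.
Qed.

(** Comparison principle: raising the other sites cannot increase a partial
    derivative at [x]. *)
Lemma EL_le u v x : cle u v -> u x = v x -> EL v x <= EL u x.
Proof. by move=> uv uvx; apply: ler_sum => k _; exact: EL_term_le. Qed.

(** Equality in the comparison principle propagates to the neighbours: the
    derivative of [s] in the direction [e] is strictly decreasing in the value
    at the centre of the ball, and for the ball centred at [x - e] the position
    [e] is the site [x]. *)
Lemma EL_touch_neighbour u v x e : cle u v -> u x = v x -> EL u x = EL v x ->
  lnorm e = 1%N -> u (x - e) = v (x - e).
Proof.
move=> uv uvx ELuv e1; apply/eqP; rewrite eq_le uv/= leNgt; apply/negP => ltuv.
have er : (lnorm e <= r)%N by rewrite e1.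
have zr : (lnorm (0 : lattice n) <= r)%N by rewrite lnorm0.
have [k ke] : exists k : lball n r, val k = e by exists (exist _ e er).
have kn : lnorm (val k) = 1%N by rewrite ke.
have [z z0] : exists z : lball n r, val z = 0 by exists (exist _ 0 zr).
suff : EL v x < EL u x by rewrite ELuv ltxx.
apply: (ltr_sum_seq (bs_all k)) => [j|]; first exact: EL_term_le.
apply: (decreasing_off_coordinate bs_uniq bs_all (j := k) (i := z)).
- exact: partially_derivable_ds.
- by move=> j w; exact: mixed_le0.
- by move=> w; exact: (proj2 s_S3 z k z0 kn w).
- by move=> j; exact: uv.
- by rewrite /loc addrC subrK.
- by rewrite /loc z0 add0r ke.
Qed.

(** Strong maximum principle: by connectedness the equality at one site
    propagates to the whole lattice. *)
Lemma EL_touch u v x : cle u v -> u x = v x ->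
  (forall y, EL u y = EL v y) -> u = v.
Proof.
move=> uv uvx ELuv; apply: funext => y.
apply: (@lattice_connected n (fun y => u y = v y) x) => // {}y e e1 uvy.
exact: EL_touch_neighbour.
Qed.

Lemma local_potential_submodular u v x :
  local_potential s x (cmin u v) + local_potential s x (cmax u v) <=
  local_potential s x u + local_potential s x v.
Proof.
rewrite !local_potentialE.
exact: (submodular_of_partial bs_uniq bs_all (loc u x) (loc v x)).
Qed.

Lemma local_potential_lipschitz (a b : R) : exists2 L : R, 0 <= L &
  forall u v x, (forall y, a <= u y <= b) -> (forall y, a <= v y <= b) ->
  `|local_potential s x u - local_potential s x v| <=
    L * \sum_(k <- bs) `|u (val k + x) - v (val k + x)|.
Proof.
have [L L0 hL] := C1_lipschitz_on_box bs_uniq bs_all a b (proj1 s_C2).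
exists L => // u v x hu hv; rewrite !local_potentialE.
by apply: hL => k; [exact: hv | exact: hu].
Qed.

(** Adds [t] on the orbit of [x] under the translations in the directions above
    [m], the smallest change that keeps the periodicity. *)
Definition bump m x t u : config R n :=
  fun y => if agree m y x then u y + t else u y.

Lemma periodic_loc m u x y : periodic_from m.+1 u -> agree m x y ->
  loc u x = loc u y.
Proof.
move=> pu xy; apply: funext => k; apply: (periodic_agree pu).
by rewrite agree_addl.
Qed.

(** The derivative of the energy along the orbit of a site is [EL]: every [k] of
    the ball reaches the orbit from exactly one point of the window [W], and the
    periodicity of [u] brings that point back to [x - k]. The radius [d] does
    not depend on [W], since the points that do not reach the orbit contribute
    nothing. *)
Lemma first_variation m u x e : periodic_from m.+1 u -> 0 < e ->
  exists2 d : R, 0 < d & forall t, `|t| <= d -> forall W : seq (lattice n),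
    uniq W -> {in W &, forall y z, agree m y z -> y = z} ->
    (forall k : lball n r, exists2 y, y \in W & agree m (val k + y) x) ->
    `|\sum_(y <- W) (local_potential s y (bump m x t u) -
                     local_potential s y u) - t * EL u x| <= e * `|t|.
Proof.
move=> pu e0; have e1 : 0 < e / (size bs).+1%:R by rewrite divr_gt0.
pose D (k : lball n r) := [pred k' : lball n r | agree m (val k') (val k)].
have [d d0 hd] := common_radius (l := bs) bs_all (P := fun k d => forall t,
    `|t| <= d -> `|s (fun j => if D k j then loc u (x - val k) j + t
                            else loc u (x - val k) j) - s (loc u (x - val k))
    - t * \sum_(j <- bs | D k j) partial j s (loc u (x - val k))| <=
      e / (size bs).+1%:R * `|t|)
  (fun k d d' dd H t ht => H t (le_trans ht (proj2 (andP dd))))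
  (fun k => C1_expansion bs_uniq bs_all (D k) (loc u (x - val k)) (proj1 s_C2) e1).
exists d => // t td W uW injW coverW.
have locE (k : lball n r) y : agree m (val k + y) x -> loc u y = loc u (x - val k).
  move=> ky; apply: (periodic_loc pu); rewrite -(agree_addl _ _ _ (val k)).
  by rewrite [val k + (x - _)]addrC subrK.
have uniqW (k : lball n r) (f : lattice n -> R) (y : lattice n) : y \in W ->
    agree m (val k + y) x -> \sum_(z <- W | agree m (val k + z) x) f z = f y.
  move=> yW ky; rewrite -big_filter (bigD1_seq y) ?filter_uniq ?mem_filter ?ky//=.
  rewrite big_seq_cond big1 ?addr0// => z /andP[].
  rewrite mem_filter => /andP[kz zW] zy.
  case/eqP: zy; apply: injW => //; rewrite -(agree_addl _ _ _ (val k)).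
  by apply: agree_trans kz _; rewrite agree_sym.
have -> : EL u x = \sum_(y <- W) \sum_(k <- bs | agree m (val k + y) x)
    partial k s (loc u y).
  rewrite (exchange_big_dep predT)//=; apply: eq_bigr => k _.
  have [y yW ky] := coverW k.
  rewrite (uniqW k (fun z => partial k s (loc u z)) y yW ky).
  by rewrite (locE k y ky).
rewrite mulr_sumr -sumrB; apply: le_trans (ler_norm_sum _ _ _) _.
apply: le_trans (_ : \sum_(y <- W) \sum_(k <- bs | agree m (val k + y) x)
   e / (size bs).+1%:R * `|t| <= _).
  apply: ler_sum => y _.
  have [[k ky]|nk] := pselect (exists k : lball n r, agree m (val k + y) x).
    have Dk j : D k j = agree m (val j + y) x.
      rewrite /D /= -(agreeD _ _ _ y).
      apply/idP/idP => H; first exact: agree_trans H ky.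
      by apply: agree_trans H _; rewrite agree_sym.
    have := hd k t td; rewrite -(locE _ _ ky) (eq_bigl _ _ Dk).
    have -> : (fun j => if D k j then loc u y j + t else loc u y j) =
        loc (bump m x t u) y.
      by apply: funext => j; rewrite Dk.
    rewrite -!local_potentialE => /le_trans; apply.
    by apply: (ler_sum_seq1 (bs_all k)) => //; rewrite mulr_ge0// ltW.
  have noP (k : lball n r) : agree m (val k + y) x = false.
    by apply/negP => ky; apply: nk; exists k.
  rewrite !big_pred0// mulr0 subr0 !local_potentialE.
  rewrite (_ : loc (bump m x t u) y = loc u y) ?subrr ?normr0//.
  by apply: funext => k; rewrite /loc /bump noP.
rewrite (exchange_big_dep predT)//=.
apply: le_trans (_ : \sum_(k <- bs) e / (size bs).+1%:R * `|t| <= _).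
  apply: ler_sum => k _; have [y yW ky] := coverW k.
  by rewrite (uniqW k (fun=> _) y yW ky).
rewrite big_const_seq count_predT iter_addr_0 -[leLHS]mulr_natr.
rewrite [leLHS]mulrAC ler_wpM2r//.
rewrite -mulrA ler_piMr ?(ltW e0)//  mulrC ler_pdivrMr// mul1r ler_nat.
exact: leqnSn.
Qed.

End EulerLagrange.

(** * Double limits, almost minimizers, pointwise cluster points *)

Section DoubleLimit.
Context {R : realType}.
Implicit Types (b : nat -> nat -> R) (l : R).

Definition pqcvg b l := forall e, 0 < e -> exists N : nat,
  forall p q, (N <= p)%N -> (N <= q)%N -> `|b p q - l| <= e.

Lemma pqcvg_le b b' l l' : pqcvg b l -> pqcvg b' l' ->
  (exists N : nat, forall p q, (N <= p)%N -> (N <= q)%N -> b p q <= b' p q) ->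
  l <= l'.
Proof.
move=> bl b'l' [N bb']; apply/ler_addgt0Pr => e e0.
have e2 : 0 < e / 2 by rewrite divr_gt0.
have [M hM] := bl _ e2; have [M' hM'] := b'l' _ e2.
pose m := maxn N (maxn M M').
have Nm : (N <= m)%N by rewrite /m; lia.
have Mm : (M <= m)%N by rewrite /m; lia.
have Mm' : (M' <= m)%N by rewrite /m; lia.
have := bb' m m Nm Nm; have := hM m m Mm Mm; have := hM' m m Mm' Mm'.
rewrite !ler_norml => /andP[? ?] /andP[? ?] ?; lra.
Qed.

Lemma pqcvg_uniq b l l' : pqcvg b l -> pqcvg b l' -> l = l'.
Proof.
by move=> bl bl'; apply/le_anti/andP; split; [apply: pqcvg_le bl bl' _ |
  apply: pqcvg_le bl' bl _]; exists 0%N.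
Qed.

Lemma pqcvgD b b' l l' : pqcvg b l -> pqcvg b' l' ->
  pqcvg (fun p q => b p q + b' p q) (l + l').
Proof.
move=> bl b'l' e e0; have e2 : 0 < e / 2 by rewrite divr_gt0.
have [M hM] := bl _ e2; have [M' hM'] := b'l' _ e2.
exists (maxn M M') => p q; rewrite !geq_max => /andP[? ?] /andP[? ?].
rewrite opprD addrACA (le_trans (ler_normD _ _))// (splitr e).
by rewrite lerD ?hM ?hM'.
Qed.

Lemma pqcvgZ b l (c : R) : pqcvg b l -> pqcvg (fun p q => c * b p q) (c * l).
Proof.
move=> bl e e0; have [|M hM] := bl (e / (`|c| + 1)).
  by rewrite divr_gt0// ltr_wpDl.
exists M => p q /hM{}hM /hM{}hM; rewrite -mulrBr normrM.
rewrite (le_trans (ler_wpM2l _ hM))// mulrA ler_pdivrMr ?ltr_wpDl//.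
by rewrite mulrC ler_wpM2l ?(ltW e0)// lerDl.
Qed.

Lemma pqcvg_cst (l : R) : pqcvg (fun _ _ => l) l.
Proof. by move=> e e0; exists 0%N => p q _ _; rewrite subrr normr0 ltW. Qed.

Lemma pqcvg_eventually b b' l : pqcvg b l ->
  (exists N : nat, forall p q, (N <= p)%N -> (N <= q)%N -> b p q = b' p q) ->
  pqcvg b' l.
Proof.
move=> bl [N bb'] e /bl[M hM]; exists (maxn M N) => p q.
rewrite !geq_max => /andP[? ?] /andP[? ?].
by rewrite -bb'// hM.
Qed.

Lemma near_pq (P : nat * nat -> Prop) :
  filter_prod \oo \oo P <->
  exists N : nat, forall p q, (N <= p)%N -> (N <= q)%N -> P (p, q).
Proof.
split=> [[[A B] /= [[N _ NA] [M _ MB]] AB]|[N H]].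
  exists (maxn N M) => p q; rewrite !geq_max => /andP[? ?] /andP[? ?].
  by apply: AB; split => /=; [exact: NA|exact: MB].
exists ([set p | (N <= p)%N], [set q | (N <= q)%N]) => /=.
  by split; exists N.
by move=> [p q] [/= ? ?]; exact: H.
Qed.

Lemma liminf_pq_lim (a : int -> int -> \bar R) b l :
  (forall p q : nat, a (- p%:Z) q%:Z = (b p q)%:E) -> pqcvg b l ->
  liminf_pq a = l%:E.
Proof.
move=> ab bl; rewrite /liminf_pq limf_einfE; apply/eqP; rewrite eq_le.
apply/andP; split.
  apply: ge_ereal_sup => _ [V /near_pq[N NV] <-].
  apply/lee_addgt0Pr => e e0; have [M hM] := bl _ e0.
  pose m := maxn N M; apply: (@le_trans _ _ (a (- m%:Z) m%:Z)).
    apply: ereal_inf_lbound; exists (m, m) => //.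
    by apply: NV; rewrite leq_maxl.
  rewrite ab -EFinD lee_fin.
  have := hM m m (leq_maxr _ _) (leq_maxr _ _); rewrite ler_norml; lra.
apply/lee_addgt0Pr => e e0; have [M hM] := bl _ e0.
rewrite -leeBlDr//; apply: (@le_trans _ _ (ereal_inf
    ((fun mq : nat * nat => a (- mq.1%:Z) mq.2%:Z) @`
      [set mq | (M <= mq.1)%N /\ (M <= mq.2)%N]))).
  apply: le_ereal_inf_tmp => _ [[p q] [/= Mp Mq] <-]; rewrite ab -EFinB lee_fin.
  by have := hM _ _ Mp Mq; rewrite ler_norml; lra.
apply: ereal_sup_ubound; exists [set mq | (M <= mq.1)%N /\ (M <= mq.2)%N] => //.
by apply/near_pq; exists M.
Qed.

Lemma liminf_pq_lt (a : int -> int -> \bar R) b (B : R) :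
  (forall p q : nat, a (- p%:Z) q%:Z = (b p q)%:E) ->
  (liminf_pq a < B%:E)%E ->
  forall N : nat, exists p q, [/\ (N <= p)%N, (N <= q)%N & b p q <= B].
Proof.
move=> ab + N; apply: contraPP => H; apply/negP; rewrite -leNgt.
rewrite /liminf_pq limf_einfE; apply: (@le_trans _ _ (ereal_inf
    ((fun mq : nat * nat => a (- mq.1%:Z) mq.2%:Z) @`
      [set mq | (N <= mq.1)%N /\ (N <= mq.2)%N]))).
  apply: le_ereal_inf_tmp => _ [[p q] [/= Np Nq] <-]; rewrite ab lee_fin.
  by apply/ltW; rewrite ltNge; apply/negP => bB; apply: H; exists p, q.
apply: ereal_sup_ubound; exists [set mq | (N <= mq.1)%N /\ (N <= mq.2)%N] => //.
by apply/near_pq; exists N.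
Qed.

End DoubleLimit.

(** Replaces an exact minimizer in the arguments where the existence of one is
    not yet known. *)
Lemma near_minimum {R : realType} {V : Type} (P : set V) (f : V -> R) (m e : R) :
  P !=set0 -> (forall u, P u -> m <= f u) -> 0 < e ->
  exists2 u, P u & forall u', P u' -> f u <= f u' + e.
Proof.
move=> [u0 Pu0] mf e0; have hinf : has_inf (f @` P).
  by split; [exists (f u0), u0 | exists m => _ [u Pu <-]; exact: mf].
have [_ [u Pu <-] hu] := inf_adherent e0 hinf.
exists u => // u' Pu'; apply: le_trans (ltW hu) _; rewrite lerD2r.
by apply: ge_inf; [case: hinf | exists u'].
Qed.

(** Tychonoff's theorem, in the form of finitely many sites at a time. *)
Lemma cluster_pointwise {R : realType} {T : eqType} (a b : T -> R)
    (y : nat -> T -> R) : (forall i k, a k <= y i k <= b k) ->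
  exists U : T -> R, forall (D : seq T) (e : R) (N : nat), 0 < e ->
    exists2 i, (N <= i)%N & forall k, k \in D -> `|y i k - U k| <= e.
Proof.
move=> hy.
pose K : set (prod_topology (fun _ : T => R)) :=
  [set f | forall k, `[a k, b k]%classic (f k)].
have cK : compact K.
  exact: (@tychonoff T (fun=> R) (fun k => `[a k, b k]%classic)
    (fun k => @segment_compact R (a k) (b k))).
have [|U [_ clU]] := cK ((y : nat -> prod_topology (fun _ : T => R)) @ \oo) _.
  by exists 0%N => // i _ k /=; rewrite in_itv /= hy.
exists U => D e N e0.
have nbD : nbhs (U : prod_topology (fun _ : T => R))
    [set f : prod_topology (fun _ : T => R) |
      forall k, k \in D -> `|f k - U k| <= e].
  elim: D => [|k D IH]; first exact: filterS filterT.
  have nbk : nbhs (U : prod_topology (fun _ : T => R))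
      [set f : prod_topology (fun _ : T => R) | `|f k - U k| <= e].
    have pk : (fun f : prod_topology (fun _ : T => R) => f k) f @[f --> U] --> U k.
      exact: (@proj_continuous T (fun=> R) k U).
    move/cvgrPdist_le : pk => /(_ _ e0).
    by apply: filterS => f /=; rewrite distrC.
  apply: filterS (filterI nbk IH) => f [fk fD] j; rewrite inE => /predU1P[->//|].
  exact: fD.
have tailN : ((y : nat -> prod_topology (fun _ : T => R)) @ \oo)
    [set f | exists2 i, (N <= i)%N & f = y i].
  by exists N => // i /= Ni; exists i.
have [_ [[i Ni ->] H]] := clU _ _ tailN nbD.
by exists i.
Qed.

Lemma monotone_bounded_cvg {R : realType} (f : nat -> R) (B : R) :
  (forall i, f i <= f i.+1) -> (forall i, f i <= B) ->
  exists l, forall e, 0 < e ->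
    exists N : nat, forall i, (N <= i)%N -> `|f i - l| <= e.
Proof.
move=> fmon fB.
have fm : nondecreasing_seq f by apply/nondecreasing_seqP.
have cf : cvgn f by apply: (nondecreasing_is_cvgn fm); exists B => _ [i _ <-].
exists (limn f) => e e0; move/cvgrPdist_le: cf => /(_ _ e0)[N _ hN].
by exists N => i /hN /=; rewrite distrC.
Qed.

(** * Chains of cells: energies of finite blocks *)

(** The admissible configurations of the chain along the axis [d]. *)
Definition between {R : realType} {n} (d : 'I_n) (v w u : config R n) :=
  [/\ cle v u, cle u w & periodic_from d.+2 u].

(** [A] is the energy of the cell [0], that of the cell [i] being obtained by
    translation along the axis [d]; [nu x y] is the distance of [x] and [y] on the
    cell [0]. The distance depends only on that cell ([ce_nu_le]) and is
    continuous for pointwise convergence, uniformly on the admissible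
    configurations ([ce_nu_small]); the energy depends only on the cells at
    distance at most [r] ([ce_lip]); the condition [ce_eq0] expresses that [v]
    and [w] are adjacent. *)
Record chain_energy {R : realType} {n} (d : 'I_n) (r : nat)
    (v w : config R n) (A : config R n -> R)
    (nu : config R n -> config R n -> R) (Lam : R) : Prop := ChainEnergy {
  ce_lt : clt v w ;
  ce_perv : periodic_from d.+1 v ;
  ce_perw : periodic_from d.+1 w ;
  ce_nu_refl : forall x, nu x x = 0 ;
  ce_nu_le : forall x y x' y', between d v w x -> between d v w y ->
    between d v w x' -> between d v w y' ->
    (forall z : lattice n, z ord0 d = 0 -> `|x z - y z| <= `|x' z - y' z|) ->
    nu x y <= nu x' y' ;
  ce_nu_triangle : forall x y z, between d v w x -> between d v w y ->
    between d v w z -> nu x z <= nu x y + nu y z ;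
  ce_nu_site : forall x y, between d v w x -> between d v w y ->
    `|x 0 - y 0| <= nu x y ;
  ce_nu_small : forall e, 0 < e -> exists (D : seq (lattice n)) (a : R),
    0 < a /\ forall x y, between d v w x -> between d v w y ->
    (forall z, z \in D -> `|x z - y z| <= a) -> nu x y <= e ;
  ce_Lam : 0 <= Lam ;
  ce_lip : forall x y a, between d v w x -> between d v w y ->
    (forall k : int, (`|k| <= r)%N ->
       nu (tau d.+1 k x) (tau d.+1 k y) <= a) -> `|A x - A y| <= Lam * a ;
  ce_sub : forall x y, between d v w x -> between d v w y ->
    A (cmin x y) + A (cmax x y) <= A x + A y ;
  ce_ge0 : forall x, between d v w x -> tau d.+1 1 x = x -> 0 <= A x ;
  ce_eq0 : forall x, between d v w x -> tau d.+1 1 x = x -> A x = 0 ->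
    x = v \/ x = w ;
  ce_v : A v = 0 ;
  ce_w : A w = 0 }.

Section Chain.
Context {R : realType} {n : nat} (d : 'I_n) (r : nat) (v w : config R n).
Context (A : config R n -> R) (nu : config R n -> config R n -> R) (Lam : R).
Hypothesis ce : chain_energy d r v w A nu Lam.
Implicit Types (u x y : config R n) (z : lattice n) (N M p q : nat).

Local Notation sh := (@tau R n d.+1).
Local Notation K := (between d v w).
Local Notation e := (@unitv n d.+1).

Let Lam0 := ce_Lam ce.

Lemma coord_shift z (i : int) : (z + i *: e) ord0 d = z ord0 d + i.
Proof. by rewrite !mxE eqxx mulr1. Qed.

Lemma sh0 u : sh 0 u = u.
Proof. by apply: funext => z; rewrite /tau scale0r addr0. Qed.

Lemma sh_sh (i j : int) u : sh i (sh j u) = sh (i + j) u.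
Proof. by apply: funext => z; rewrite /tau scalerDl addrA. Qed.

Lemma shv i : sh i v = v.
Proof. by apply: funext => z; rewrite /tau (periodicZ _ _ (ce_perv ce)). Qed.

Lemma shw i : sh i w = w.
Proof. by apply: funext => z; rewrite /tau (periodicZ _ _ (ce_perw ce)). Qed.

Lemma cmin_sh i x y : cmin (sh i x) (sh i y) = sh i (cmin x y).
Proof. by []. Qed.

Lemma cmax_sh i x y : cmax (sh i x) (sh i y) = sh i (cmax x y).
Proof. by []. Qed.

Lemma periodic_weaken m u : periodic_from m u -> periodic_from m.+1 u.
Proof. by move=> pu k /andP[mk kn]; apply: pu; rewrite kn ltnW. Qed.

Lemma between_low : K v.
Proof.
split; [by move=> z|by move=> z; exact/ltW/(ce_lt ce)|].
exact/periodic_weaken/(ce_perv ce).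
Qed.

Lemma between_high : K w.
Proof.
split; [by move=> z; exact/ltW/(ce_lt ce)|by move=> z|].
exact/periodic_weaken/(ce_perw ce).
Qed.

Lemma between_sh i u : K u -> K (sh i u).
Proof.
move=> [vu uw pu]; split.
- by move=> z; rewrite -[v]/(v) -(shv i); exact: vu.
- by move=> z; rewrite -(shw i); exact: uw.
- by move=> k hk z; rewrite /tau addrAC pu.
Qed.

Lemma between_cmin x y : K x -> K y -> K (cmin x y).
Proof.
move=> [vx xw px] [vy yw py]; split.
- by move=> z; rewrite le_min vx vy.
- by move=> z; rewrite ge_min xw.
- by move=> k hk z; rewrite /cmin px// py.
Qed.

Lemma between_cmax x y : K x -> K y -> K (cmax x y).
Proof.
move=> [vx xw px] [vy yw py]; split.
- by move=> z; rewrite le_max vx.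
- by move=> z; rewrite ge_max xw yw.
- by move=> k hk z; rewrite /cmax px// py.
Qed.

Hint Resolve between_low between_high between_sh between_cmin between_cmax : core.

Lemma nu_ge0 x y : K x -> K y -> 0 <= nu x y.
Proof.
move=> Kx Ky; rewrite -(ce_nu_refl ce x); apply: (ce_nu_le ce) => // z _.
by rewrite subrr normr0.
Qed.

Lemma nu_le_diam x y : K x -> K y -> nu x y <= nu w v.
Proof.
move=> Kx Ky; apply: (ce_nu_le ce) => // z _.
move: Kx Ky => [/(_ z) ? /(_ z) ? _] [/(_ z) ? /(_ z) ? _].
have := ce_lt ce z => vw; rewrite [leRHS]ger0_norm; last by lra.
by rewrite ler_norml; apply/andP; split; lra.
Qed.

Lemma nu_cell x y x' : K x -> K y -> K x' ->
  (forall z : lattice n, z ord0 d = 0 -> x z = x' z) -> nu x y = nu x' y.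
Proof.
move=> Kx Ky Kx' xx'; apply/le_anti/andP; split; apply: (ce_nu_le ce) => // z z0;
  by rewrite xx'.
Qed.

Lemma energy_near x y (a : R) : K x -> y = v \/ y = w ->
  (forall k : int, (`|k| <= r)%N -> nu (sh k x) y <= a) -> `|A x| <= Lam * a.
Proof.
move=> Kx [->|->] H.
  by rewrite -[A x]subr0 -(ce_v ce); apply: (ce_lip ce) => // k /H; rewrite shv.
by rewrite -[A x]subr0 -(ce_w ce); apply: (ce_lip ce) => // k /H; rewrite shw.
Qed.

Definition blk N u : R := \sum_(i < N) A (sh i%:Z u).

Lemma blk0 u : blk 0 u = 0.
Proof. exact: big_ord0. Qed.

Lemma blk1 u : blk 1 u = A u.
Proof. by rewrite /blk big_ord1 sh0. Qed.

(** Energy of the cells [- p, ..., q]. *)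
Definition win u p q : R := blk (p + q).+1 (sh (- p%:Z) u).

Lemma blk_cat M N u : blk (M + N) u = blk M u + blk N (sh M%:Z u).
Proof.
rewrite /blk big_split_ord /=; congr (_ + _); apply: eq_bigr => i _.
by rewrite sh_sh PoszD addrC.
Qed.

Lemma win_split u p q p' q' : (p <= p')%N -> (q <= q')%N ->
  win u p' q' = blk (p' - p) (sh (- p'%:Z) u) + win u p q +
    blk (q' - q) (sh (q.+1)%:Z u).
Proof.
move=> pp qq; rewrite /win.
have -> : (p' + q').+1 = ((p' - p) + ((p + q).+1 + (q' - q)))%N by lia.
rewrite blk_cat blk_cat !sh_sh addrA.
have -> : (p' - p)%N%:Z - p'%:Z = - p%:Z by lia.
by have -> : (p + q).+1%:Z - p%:Z = q.+1%:Z by lia.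
Qed.

Lemma blk_submodular N x y : K x -> K y ->
  blk N (cmin x y) + blk N (cmax x y) <= blk N x + blk N y.
Proof.
move=> Kx Ky; rewrite -!big_split /=; apply: ler_sum => i _.
by rewrite -cmin_sh -cmax_sh; apply: (ce_sub ce); exact: between_sh.
Qed.

Lemma blk_norm_le N u y (a : R) : K u -> y = v \/ y = w ->
  (forall i : int, - r%:Z <= i -> i < N%:Z + r%:Z -> nu (sh i u) y <= a) ->
  `|blk N u| <= N%:R * (Lam * a).
Proof.
move=> Ku hy H; apply: le_trans (ler_norm_sum _ _ _) _.
apply: le_trans (_ : \sum_(i < N) Lam * a <= _); last first.
  by rewrite big_const_ord iter_addr_0 mulr_natl.
apply: ler_sum => i _; apply: (energy_near (y := y)) => // [|k kr].
  exact: between_sh.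
by rewrite sh_sh; apply: H; have := ltn_ord i; lia.
Qed.

Fixpoint running_min u (k : nat) : config R n :=
  if k is k'.+1 then cmin (running_min u k') (sh k%:Z u) else u.

Lemma between_running_min u k : K u -> K (running_min u k).
Proof.
by move=> Ku; elim: k => //= k IH; apply: between_cmin => //; exact: between_sh.
Qed.

Lemma running_min_le u k i z : (i <= k)%N -> running_min u k z <= u (z + i%:Z *: e).
Proof.
elim: k i => [|k IH] i; first by rewrite leqn0 => /eqP ->; rewrite scale0r addr0.
rewrite leq_eqVlt => /predU1P[->|]; rewrite /= /cmin ge_min.
  by rewrite lexx orbT.
by rewrite ltnS => /IH ->.
Qed.

Lemma le_running_min u k z (c : R) : (forall i, (i <= k)%N -> c <= u (z + i%:Z *: e)) ->
  c <= running_min u k z.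
Proof.
elim: k => [|k IH] H; first by have := H 0%N (leqnn _); rewrite scale0r addr0.
by rewrite /= /cmin le_min IH => [|i ik]; apply: H => //; exact: leqW.
Qed.

Lemma blk_sh_periodic N u : sh N%:Z u = u -> forall k, blk N (sh k%:Z u) = blk N u.
Proof.
move=> pu; elim=> [|k IH]; first by rewrite sh0.
rewrite -[RHS]IH; set x := sh k%:Z u.
have -> : sh k.+1%:Z u = sh 1 x by rewrite /x sh_sh intS.
have px : sh N%:Z x = x by rewrite /x sh_sh addrC -sh_sh pu.
have E : blk N.+1 x = blk N x + A x.
  by rewrite -addn1 blk_cat px blk1.
apply: (addIr (A x)); rewrite -E -[N.+1]add1n blk_cat [RHS]addrC; by rewrite blk1.
Qed.

(** Periodic configurations have nonnegative energy: the infimum over all the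
    translates of an almost minimizer is still an almost minimizer, and it is
    invariant. *)
Lemma blk_periodic_ge0 N u : K u -> sh N%:Z u = u -> 0 <= blk N u.
Proof.
case: N => [|N]; first by rewrite /blk big_ord0.
move=> Ku pu; rewrite leNgt; apply/negP => neg.
pose P := [set x | K x /\ sh N.+1%:Z x = x].
(* A negative energy of [u] leaves room for [N + 1] errors of size [eps]: one for
   each of the [N] minima and one for the choice of the almost minimizer. *)
pose eps := - blk N.+1 u / N.+2%:R.
have eps0 : 0 < eps by rewrite divr_gt0// oppr_gt0.
have low x : P x -> - (N.+1%:R * (Lam * nu w v)) <= blk N.+1 x.
  move=> [Kx _]; have := @blk_norm_le N.+1 x v (nu w v) Kx (or_introl erefl).
  move=> /(_ (fun i _ _ => nu_le_diam (between_sh i Kx) between_low)).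
  by rewrite ler_norml => /andP[].
have [x [Kx px] minx] := near_minimum (ex_intro _ u (conj Ku pu)) low eps0.
have pinf k : sh N.+1%:Z (running_min x k) = running_min x k.
  elim: k => //= k IH; rewrite -cmin_sh IH; congr cmin.
  by rewrite sh_sh addrC -sh_sh px.
have Kinf k := between_running_min k Kx.
have Hk k : blk N.+1 (running_min x k) <= blk N.+1 x + k%:R * eps.
  elim: k => [|k IH]; first by rewrite mul0r addr0.
  have Kx' : K (sh k.+1%:Z x) by exact: between_sh.
  have Pmax : P (cmax (running_min x k) (sh k.+1%:Z x)).
    split; first exact: between_cmax.
    by rewrite -cmax_sh pinf sh_sh addrC -sh_sh px.
  have := blk_submodular N.+1 (Kinf k) Kx'; have := minx _ Pmax.
  by rewrite (blk_sh_periodic px) /= -natr1 mulrDl mul1r; lra.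
have per i : sh (i + N.+1)%:Z x = sh i%:Z x by rewrite PoszD -sh_sh px.
have ple i : cle (running_min x N) (sh i%:Z x).
  move=> z; have [m ->] : exists m, sh i%:Z x = sh (i %% N.+1 + m * N.+1)%:Z x.
    by exists (i %/ N.+1)%N; rewrite addnC -divn_eq.
  elim: m => [|m IH]; last by rewrite mulSn addnCA addnC per.
  by rewrite addn0; apply: running_min_le; rewrite -ltnS ltn_mod.
have inv : sh 1 (running_min x N) = running_min x N.
  apply: funext => z; apply/le_anti/andP; split.
    apply: le_running_min => i iN.
    rewrite -[u in _ <= u]/(sh i%:Z x z) -per addnS.
    have := ple (i + N)%N (z + 1 *: e); rewrite /tau -addrA -scalerDl.
    by rewrite -intS.
  apply: le_running_min => i _; have := ple i.+1 z.
  by rewrite /tau -addrA -scalerDl -intS.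
have invi i : sh i%:Z (running_min x N) = running_min x N.
  by elim: i => [|i IH]; rewrite ?sh0// intS -sh_sh IH.
have := Hk N; rewrite /blk (eq_bigr (fun=> A (running_min x N))) => [|i _]; last first.
  by rewrite invi.
rewrite big_const_ord iter_addr_0 => H1.
have A0 : 0 <= A (running_min x N) *+ N.+1.
  by rewrite mulrn_wge0// (ce_ge0 ce).
have := minx u (conj Ku pu); move: H1; rewrite -/(blk N.+1 x) => H1 H2.
have : 0 <= blk N.+1 u + N.+1%:R * eps by rewrite -natr1; lra.
have -> : blk N.+1 u = - (N.+2%:R * eps) by rewrite /eps; field.
by rewrite -[N.+2%:R]natr1; lra.
Qed.

Lemma energy_local x y : K x -> K y ->
  (forall k : int, (`|k| <= r)%N ->
     forall z, z ord0 d = 0 -> sh k x z = sh k y z) -> A x = A y.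
Proof.
move=> Kx Ky xy; apply/eqP; rewrite -subr_eq0 -normr_eq0 eq_le normr_ge0 andbT.
rewrite -[leRHS](mulr0 Lam); apply: (ce_lip ce) => // k kr.
rewrite (nu_cell _ _ _ (xy k kr)) ?(ce_nu_refl ce)//; exact: between_sh.
Qed.

(** The periodic extension of the values of [u] on the cells
    [- r, ..., N + r - 1]. *)
Definition periodize N u : config R n := fun z =>
  u (z + (((z ord0 d + r%:Z) %% (r + (N + r))%:Z)%Z - r%:Z - z ord0 d) *: e).

Lemma between_periodize N u : K u -> K (periodize N u).
Proof.
move=> [vu uw pu]; split => [z|z|k /andP[dk kn] z].
- by apply: le_trans (vu _); rewrite (periodicZ _ _ (ce_perv ce)).
- by apply: le_trans (uw _) _; rewrite (periodicZ _ _ (ce_perw ce)).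
rewrite /periodize.
have -> : (z + unitv k) ord0 d = z ord0 d.
  by rewrite !mxE (ltn_eqF dk) addr0.
by rewrite addrAC pu// dk.
Qed.

Lemma periodize_cell N u (j : int) z : z ord0 d = 0 ->
  sh j (periodize N u) z =
  sh (((j + r%:Z) %% (r + (N + r))%:Z)%Z - r%:Z) u z.
Proof.
move=> z0; rewrite /tau /periodize coord_shift z0 add0r -addrA -scalerDl.
by congr (u (_ + _ *: _)); lia.
Qed.

Lemma periodize_periodic N u :
  sh (r + (N + r))%:Z (periodize N u) = periodize N u.
Proof.
apply: funext => z; rewrite /tau /periodize coord_shift -addrA -scalerDl.
rewrite [z ord0 d + _ + r%:Z]addrAC modzDr; congr (u (_ + _ *: _)); lia.
Qed.

(** A block whose cells are all close to [v] (or to [w]) costs almost nothing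
    negative, whatever its length: only the [2 r] cells glued in by the periodic
    extension can contribute. *)
Lemma blk_lower N u y (a : R) : K u -> y = v \/ y = w -> 0 <= a ->
  (forall i : int, - r%:Z <= i -> i < N%:Z + r%:Z -> nu (sh i u) y <= a) ->
  - ((r + r)%:R * (Lam * a)) <= blk N u.
Proof.
move=> Ku hy a0 H; have [->|N0] := posnP N.
  by rewrite /blk big_ord0 oppr_le0 !mulr_ge0.
set g := periodize N u; have Kg : K g by exact: between_periodize.
have Ky : K y by case: hy => ->; [exact: between_low|exact: between_high].
have modE (j : int) : let m := ((j + r%:Z) %% (r + (N + r))%:Z)%Z in
    0 <= m < N%:Z + r%:Z + r%:Z.
  move=> m; rewrite modz_ge0/=; last by lia.
  have : m < (r + (N + r))%:Z by rewrite ltz_pmod//; lia.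
  lia.
have gy (i : int) : nu (sh i g) y <= a.
  rewrite (nu_cell _ _ _ (@periodize_cell N u i)) //; [|exact: between_sh..].
  by apply: H; have := modE i; lia.
have per : sh (r + (N + r))%:Z (sh (- r%:Z) g) = sh (- r%:Z) g.
  by rewrite sh_sh addrC -sh_sh periodize_periodic.
have := blk_periodic_ge0 (between_sh _ Kg) per.
rewrite blk_cat blk_cat !sh_sh subrr sh0.
have bound (j : int) : blk r (sh j g) <= r%:R * (Lam * a).
  apply: le_trans (ler_norm _) _; apply: (blk_norm_le (y := y)) => //.
    exact: between_sh.
  by move=> i _ _; rewrite sh_sh.
have -> : blk N g = blk N u.
  apply: eq_bigr => i _; apply: energy_local; [exact: between_sh..|].
  move=> k kr z z0; rewrite !sh_sh periodize_cell//.
  rewrite modz_small; last by have := ltn_ord i; lia.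
  by congr (u (_ + _ *: _)); lia.
have := bound (- r%:Z); have := bound (N%:Z + 0).
by rewrite [(r + r)%:R]natrD mulrDl; lra.
Qed.

Definition connecting u := [/\ K u,
  forall a, 0 < a -> exists N, forall i : nat, (N <= i)%N ->
    nu (sh (- i%:Z) u) v <= a &
  forall a, 0 < a -> exists N, forall i : nat, (N <= i)%N ->
    nu (sh i%:Z u) w <= a].

(** The energy of the whole chain, as a limit of windows: configurations with
    infinite energy have no action. *)
Definition has_action u (l : R) := pqcvg (win u) l.

Lemma win_ge u p q : K u -> - ((r + r)%:R * (Lam * nu w v)) <= win u p q.
Proof.
move=> Ku; have Ku' : K (sh (- p%:Z) u) by exact: between_sh.
apply: (blk_lower Ku' (or_introl erefl)) => [|i _ _].
  exact: nu_ge0 between_high between_low.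
by apply: nu_le_diam; [exact: between_sh|exact: between_low].
Qed.

(** Enlarging a window beyond which [u] stays near [v] and [w] decreases its
    energy by at most the two errors of [blk_lower]. *)
Lemma win_extend u p q (a : R) : K u -> 0 <= a ->
  (forall i : int, i < r%:Z - p%:Z -> nu (sh i u) v <= a) ->
  (forall i : int, q%:Z - r%:Z < i -> nu (sh i u) w <= a) ->
  forall p' q', (p <= p')%N -> (q <= q')%N ->
  win u p q - 2 * ((r + r)%:R * (Lam * a)) <= win u p' q'.
Proof.
move=> Ku a0 Hv Hw p' q' pp qq; rewrite (win_split _ pp qq).
have : - ((r + r)%:R * (Lam * a)) <= blk (p' - p) (sh (- p'%:Z) u).
  apply: (blk_lower (y := v)) => //; [exact: between_sh|by left|].
  by move=> i _ iN; rewrite sh_sh; apply: Hv; lia.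
have : - ((r + r)%:R * (Lam * a)) <= blk (q' - q) (sh q.+1%:Z u).
  apply: (blk_lower (y := w)) => //; [exact: between_sh|by right|].
  by move=> i iN _; rewrite sh_sh; apply: Hw; lia.
lra.
Qed.

Lemma connecting_ends u (a : R) : connecting u -> 0 < a -> exists N,
  (forall i : int, i < - N%:Z -> nu (sh i u) v <= a) /\
  (forall i : int, N%:Z < i -> nu (sh i u) w <= a).
Proof.
move=> [Ku Hv Hw] a0; have [N1 H1] := Hv _ a0; have [N2 H2] := Hw _ a0.
exists (N1 + N2)%N; split=> i Ni.
  have -> : i = - `|i|%N%:Z by lia.
  by apply: H1; lia.
have -> : i = `|i|%N%:Z by lia.
by apply: H2; lia.
Qed.

Lemma connecting_tail u (a : R) : connecting u -> 0 < a -> exists N, forall p q p' q',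
  (N <= p)%N -> (N <= q)%N -> (p <= p')%N -> (q <= q')%N ->
  win u p q - a <= win u p' q'.
Proof.
move=> Gu a0; pose C := 2 * ((r + r)%:R * Lam) + 1.
have C0 : 0 < C by rewrite ltr_wpDl// !mulr_ge0.
have aC : 0 < a / C by rewrite divr_gt0.
have [N [Hv Hw]] := connecting_ends Gu aC; have [Ku _ _] := Gu.
exists (N + r).+1 => p q p' q' Np Nq pp qq.
apply: le_trans (_ : win u p q - 2 * ((r + r)%:R * (Lam * (a / C))) <= _).
  rewrite lerD2l lerN2; apply: le_trans (_ : C * (a / C) <= _).
    by rewrite /C mulrDl mul1r; have := ltW aC; lra.
  by rewrite mulrC divfK// gt_eqF.
apply: win_extend => //; first exact: ltW.
  by move=> i ip; apply: Hv; lia.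
by move=> i iq; apply: Hw; lia.
Qed.

(** The energies of the windows are almost increasing, by [connecting_tail], so
    a finite lower limit is a limit. *)
Lemma action_of_frequently_le u (B : R) : connecting u ->
  (forall N, exists p q, [/\ (N <= p)%N, (N <= q)%N & win u p q <= B]) ->
  exists2 l, has_action u l & l <= B.
Proof.
move=> Gu H; have [Ku _ _] := Gu.
pose S := [set x : R | exists N, forall p q,
  (N <= p)%N -> (N <= q)%N -> x <= win u p q].
have SB (x : R) : S x -> x <= B.
  by move=> [N hN]; have [p [q [Np Nq]]] := H N; apply: le_trans; exact: hN.
have hS : has_sup S.
  split; last by exists B.
  by exists (- ((r + r)%:R * (Lam * nu w v))), 0%N => p q _ _; exact: win_ge.
exists (sup S); last by apply: ge_sup => //; case: hS.
move=> a a0; have [N hN] := connecting_tail Gu a0.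
have [x [N' hN'] xS] := sup_adherent a0 hS.
exists (maxn N N') => p q; rewrite !geq_max => /andP[Np N'p] /andP[Nq N'q].
have : win u p q - a <= sup S.
  apply: sup_upper_bound => //; exists (maxn p q) => p' q'.
  rewrite !geq_max => /andP[pp' _] /andP[_ qq'].
  exact: hN.
by have := hN' _ _ N'p N'q; move: xS; rewrite ler_norml; lra.
Qed.

Lemma win_sh u (k : int) p q : (`|k| <= p)%N -> (`|k| <= q)%N ->
  win (sh k u) p q = win u (absz (p%:Z - k)) (absz (q%:Z + k)).
Proof.
move=> kp kq; rewrite /win sh_sh.
have -> : - (absz (p%:Z - k))%:Z = - p%:Z + k by lia.
by have -> : (absz (p%:Z - k)%R + absz (q%:Z + k)%R = p + q)%N by lia.
Qed.

Lemma action_sh u (k : int) l : has_action u l -> has_action (sh k u) l.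
Proof.
move=> ul a a0; have [N hN] := ul _ a0.
exists (N + `|k|)%N => p q Np Nq; rewrite win_sh; [|lia|lia].
by apply: hN; lia.
Qed.

Lemma connecting_sh u (k : int) : connecting u -> connecting (sh k u).
Proof.
move=> Gu; have [Ku _ _] := Gu; split; first exact: between_sh.
  move=> a /(connecting_ends Gu)[N [hN _]]; exists (N + `|k|).+1 => i Ni.
  by rewrite sh_sh; apply: hN; lia.
move=> a /(connecting_ends Gu)[N [_ hN]]; exists (N + `|k|).+1 => i Ni.
by rewrite sh_sh; apply: hN; lia.
Qed.

Lemma connecting_cmin x y : connecting x -> connecting y -> connecting (cmin x y).
Proof.
move=> [Kx xv xw] [Ky yv yw]; split; first exact: between_cmin.
  move=> a /xv[N hN]; exists N => i /hN; apply: le_trans.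
  rewrite -cmin_sh; apply: (ce_nu_le ce); [|exact: between_low|
    exact: between_sh|exact: between_low|].
    by apply: between_cmin; exact: between_sh.
  move=> z _; have [/(_ z) vx _ _] := between_sh (- i%:Z) Kx.
  have [/(_ z) vy _ _] := between_sh (- i%:Z) Ky.
  rewrite /cmin; case: (leP (sh (- i%:Z) x z) (sh (- i%:Z) y z)) => xy;
    by rewrite !ger0_norm; lra.
move=> a a0; have a2 : 0 < a / 2 by rewrite divr_gt0.
have [N hN] := xw _ a2; have [M hM] := yw _ a2.
exists (maxn N M) => i; rewrite geq_max => /andP[/hN{}hN /hM{}hM].
have Kx' := between_sh i%:Z Kx; have Ky' := between_sh i%:Z Ky.
have Km := between_cmin Kx' Ky'; rewrite -cmin_sh.
apply: le_trans (ce_nu_triangle ce Km Kx' between_high) _.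
rewrite [leRHS](splitr a) lerD//; apply: le_trans hM.
apply: (ce_nu_le ce) => // z _.
have [_ /(_ z) x_w _] := Kx'; have [_ /(_ z) y_w _] := Ky'.
rewrite /cmin; case: (leP (sh i%:Z x z) (sh i%:Z y z)) => xy.
  by rewrite subrr normr0.
by rewrite !ler0_norm; lra.
Qed.

Lemma connecting_cmax x y : connecting x -> connecting y -> connecting (cmax x y).
Proof.
move=> [Kx xv xw] [Ky yv yw]; split; first exact: between_cmax.
  move=> a a0; have a2 : 0 < a / 2 by rewrite divr_gt0.
  have [N hN] := xv _ a2; have [M hM] := yv _ a2.
  exists (maxn N M) => i; rewrite geq_max => /andP[/hN{}hN /hM{}hM].
  have Kx' := between_sh (- i%:Z) Kx; have Ky' := between_sh (- i%:Z) Ky.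
  have Km := between_cmax Kx' Ky'; rewrite -cmax_sh.
  apply: le_trans (ce_nu_triangle ce Km Kx' between_low) _.
  rewrite [leRHS](splitr a) lerD//; apply: le_trans hM.
  apply: (ce_nu_le ce) => // z _.
  have [/(_ z) v_x _ _] := Kx'; have [/(_ z) v_y _ _] := Ky'.
  rewrite /cmax; case: (leP (sh (- i%:Z) x z) (sh (- i%:Z) y z)) => xy;
    last by rewrite subrr normr0.
  by rewrite !ger0_norm; lra.
move=> a /xw[N hN]; exists N => i /hN; apply: le_trans.
rewrite -cmax_sh; apply: (ce_nu_le ce); [|exact: between_high|
  exact: between_sh|exact: between_high|].
  by apply: between_cmax; exact: between_sh.
move=> z _; have [_ /(_ z) x_w _] := between_sh i%:Z Kx.
have [_ /(_ z) y_w _] := between_sh i%:Z Ky.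
by rewrite /cmax; case: (leP (sh i%:Z x z) (sh i%:Z y z)) => xy; rewrite !ler0_norm; lra.
Qed.

(** Submodularity passes to the limit; the actions of [cmin x y] and [cmax x y]
    exist because the windows of each are bounded below and those of their sum
    are bounded above. *)
Lemma action_submodular x y l l' : connecting x -> connecting y ->
  has_action x l -> has_action y l' ->
  exists m m', [/\ has_action (cmin x y) m, has_action (cmax x y) m' & m + m' <= l + l'].
Proof.
move=> Gx Gy xl yl'; have Gm := connecting_cmin Gx Gy; have GM := connecting_cmax Gx Gy.
have [Kx _ _] := Gx; have [Ky _ _] := Gy.
have [Km _ _] := Gm; have [KM _ _] := GM.
have sub p q : win (cmin x y) p q + win (cmax x y) p q <= win x p q + win y p q.
  rewrite /win -cmin_sh -cmax_sh.
  by apply: blk_submodular; exact: between_sh.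
have [N hN] := pqcvgD xl yl' ltr01.
set C := (r + r)%:R * (Lam * nu w v).
have bd p q : (N <= p)%N -> (N <= q)%N ->
    win (cmin x y) p q <= l + l' + 1 + C /\ win (cmax x y) p q <= l + l' + 1 + C.
  move=> Np Nq; have := hN _ _ Np Nq; rewrite ler_norml => /andP[_ h].
  have := sub p q; have := win_ge p q Km; have := win_ge p q KM; rewrite -/C.
  by split; lra.
have [m hm _] : exists2 m, has_action (cmin x y) m & m <= l + l' + 1 + C.
  apply: action_of_frequently_le => // M; exists (maxn M N), (maxn M N).
  by rewrite !leq_maxl; split => //; apply: (proj1 (bd _ _ _ _)); rewrite leq_maxr.
have [m' hm' _] : exists2 m, has_action (cmax x y) m & m <= l + l' + 1 + C.
  apply: action_of_frequently_le => // M; exists (maxn M N), (maxn M N).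
  by rewrite !leq_maxl; split => //; apply: (proj2 (bd _ _ _ _)); rewrite leq_maxr.
exists m, m'; split=> //; apply: (pqcvg_le (pqcvgD hm hm') (pqcvgD xl yl')).
by exists 0%N => p q _ _; exact: sub.
Qed.

Definition strip N u := [/\ K u,
  forall z, z ord0 d <= - N%:Z -> u z = v z &
  forall z, N%:Z <= z ord0 d -> u z = w z].

Lemma strip_low N u (i : int) : strip N u -> i <= - N%:Z -> nu (sh i u) v = 0.
Proof.
move=> [Ku uv _] iN; rewrite (@nu_cell _ _ v) ?(ce_nu_refl ce)//.
  exact: between_sh.
move=> z z0; rewrite /tau uv ?coord_shift ?z0 ?add0r//.
by rewrite (periodicZ _ _ (ce_perv ce)).
Qed.

Lemma strip_high N u (i : int) : strip N u -> N%:Z <= i -> nu (sh i u) w = 0.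
Proof.
move=> [Ku _ uw] iN; rewrite (@nu_cell _ _ w) ?(ce_nu_refl ce)//.
  exact: between_sh.
move=> z z0; rewrite /tau uw ?coord_shift ?z0 ?add0r//.
by rewrite (periodicZ _ _ (ce_perw ce)).
Qed.

Lemma strip_connecting N u : strip N u -> connecting u.
Proof.
move=> su; have [Ku _ _] := su; split => // a a0; exists N => i Ni.
  by rewrite (strip_low su); [exact: ltW|lia].
by rewrite (strip_high su); [exact: ltW|lia].
Qed.

(** Outside of the strip all the energies vanish. *)
Lemma strip_win N u p q : strip N u -> (N + r <= p)%N -> (N + r <= q)%N ->
  win u p q = win u (N + r) (N + r).
Proof.
move=> su Np Nq; have [Ku _ _] := su; rewrite (win_split _ Np Nq).
have : `|blk (p - (N + r)) (sh (- p%:Z) u)| <= (p - (N + r))%:R * (Lam * 0).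
  apply: (blk_norm_le (y := v)) => [||i _ iN]; [exact: between_sh|by left|].
  by rewrite sh_sh (strip_low su)//; lia.
have : `|blk (q - (N + r)) (sh (N + r).+1%:Z u)| <= (q - (N + r))%:R * (Lam * 0).
  apply: (blk_norm_le (y := w)) => [||i iN _]; [exact: between_sh|by right|].
  by rewrite sh_sh (strip_high su)//; lia.
by rewrite !mulr0 !normr_le0 => /eqP -> /eqP ->; rewrite add0r addr0.
Qed.

Lemma strip_action N u : strip N u -> has_action u (win u (N + r) (N + r)).
Proof.
move=> su a a0; exists (N + r)%N => p q Np Nq.
by rewrite (strip_win su Np Nq) subrr normr0 ltW.
Qed.

Lemma action_ge u l : K u -> has_action u l -> - ((r + r)%:R * (Lam * nu w v)) <= l.
Proof.
move=> Ku ul; apply: (pqcvg_le (pqcvg_cst _) ul).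
by exists 0%N => p q _ _; exact: win_ge.
Qed.

Lemma action_ge_win u p q (a l : R) : K u -> 0 <= a ->
  (forall i : int, i < r%:Z - p%:Z -> nu (sh i u) v <= a) ->
  (forall i : int, q%:Z - r%:Z < i -> nu (sh i u) w <= a) ->
  has_action u l -> win u p q - 2 * ((r + r)%:R * (Lam * a)) <= l.
Proof.
move=> Ku a0 Hv Hw ul; apply: (pqcvg_le (pqcvg_cst _) ul).
by exists (maxn p q) => p' q' pp qq; apply: win_extend => //; lia.
Qed.

(** The action of the cut configuration exceeds the energy of a large window of
    [u] only by the energies of the [4 r + 2] cells around the two cuts, which
    are close to [v] or [w]. *)
Lemma cutoff u (a l : R) : connecting u -> has_action u l -> 0 < a ->
  exists N y l', [/\ strip N y, has_action y l' & l' <= l + a].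
Proof.
move=> Gu ul a0; have [Ku _ _] := Gu.
pose C := 2 * ((r + r).+1%:R * Lam) + 1.
have C0 : 0 < C by rewrite ltr_wpDl// !mulr_ge0.
have a2 : 0 < a / 2 by rewrite divr_gt0.
pose b := a / 2 / C; have b0 : 0 < b by rewrite divr_gt0.
have [N1 [Hv Hw]] := connecting_ends Gu b0; have [N2 H2] := ul _ a2.
(* The blocks of radius [r] around the cuts, together with their neighbours
   within [r], lie beyond [N1]. *)
pose N := (N1 + N2 + (r + r) + 2)%N.
pose y : config R n := fun z => if z ord0 d <= - N%:Z then v z else
  if N%:Z <= z ord0 d then w z else u z.
have Ky : K y.
  have [vu uw pu] := Ku; have [vv vw pv] := between_low.
  have [_ _ pw] := between_high; split => [z|z|k hk z]; rewrite /y.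
  - by case: ifP => // _; case: ifP => // _.
  - by case: ifP => // _; case: ifP => // _.
  have -> : (z + unitv k) ord0 d = z ord0 d.
    by case/andP: hk => dk _; rewrite !mxE (ltn_eqF dk) addr0.
  by rewrite pu// pv// pw.
have sy : strip N y.
  split=> // z zN; rewrite /y; first by rewrite zN.
  by rewrite zN ifF//; apply/negP => zN'; move: zN zN'; rewrite /N; lia.
have yu (i : int) z : z ord0 d = 0 -> - N%:Z < i < N%:Z -> sh i y z = sh i u z.
  move=> z0 /andP[h1 h2]; rewrite /tau /y coord_shift z0 add0r.
  by rewrite !ifF//; apply/negP; lia.
exists N, y, (win y (N + r) (N + r)); split => //; first exact: strip_action.
have pq : (N - r - 1 <= N + r)%N by lia.
rewrite (win_split _ pq pq).
have e2 : ((N + r) - (N - r - 1) = (r + r).+1)%N by rewrite /N; lia.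
rewrite e2.
have : `|blk (r + r).+1 (sh (- (N + r)%:Z) y)| <= (r + r).+1%:R * (Lam * b).
  apply: (blk_norm_le (y := v)) => [||i h1 h2]; [exact: between_sh|by left|].
  rewrite sh_sh; have [iN|iN] := lerP (i - (N + r)%:Z) (- N%:Z).
    by rewrite (strip_low sy iN) ltW.
  rewrite (@nu_cell _ _ (sh (i - (N + r)%:Z) u)); [|exact: between_sh|
    exact: between_low|exact: between_sh|].
    by apply: Hv; rewrite /N; lia.
  by move=> z z0; apply: yu => //; move: iN h1 h2; rewrite /N; lia.
have : `|blk (r + r).+1 (sh (N - r - 1).+1%:Z y)| <= (r + r).+1%:R * (Lam * b).
  apply: (blk_norm_le (y := w)) => [||i h1 h2]; [exact: between_sh|by right|].
  rewrite sh_sh; have [iN|iN] := lerP N%:Z (i + (N - r - 1).+1%:Z).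
    by rewrite (strip_high sy iN) ltW.
  rewrite (@nu_cell _ _ (sh (i + (N - r - 1).+1%:Z) u)); [|exact: between_sh|
    exact: between_high|exact: between_sh|].
    by apply: Hw; rewrite /N; lia.
  by move=> z z0; apply: yu => //; move: iN h1 h2; rewrite /N; lia.
have -> : win y (N - r - 1) (N - r - 1) = win u (N - r - 1) (N - r - 1).
  apply: eq_bigr => i _; rewrite !sh_sh.
  apply: energy_local; [exact: between_sh..|] => k kr z z0.
  by rewrite !sh_sh; apply: yu => //; have := ltn_ord i; rewrite /N; lia.
have := H2 (N - r - 1)%N (N - r - 1)%N.
rewrite !ler_norml => /(_ ltac:(rewrite /N; lia) ltac:(rewrite /N; lia)).
have Cb : C * b = a / 2 by rewrite /b mulrC divfK// gt_eqF.
have Cb2 : 2 * ((r + r).+1%:R * (Lam * b)) <= C * b.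
  by have := ltW b0; rewrite /C; nra.
move=> /andP[_ h1] /andP[_ h2] /andP[_ h3]; lra.
Qed.

Lemma strip_running_min N u k : strip N u -> strip N (running_min u k).
Proof.
move=> [Ku uv uw]; split; first exact: between_running_min.
  move=> z zN; have [/(_ z) h1 _ _] := between_running_min k Ku.
  apply/le_anti; rewrite h1 andbT -(uv z zN).
  by have := @running_min_le u k 0 z (leq0n _); rewrite scale0r addr0.
move=> z zN; have [_ /(_ z) h1 _] := between_running_min k Ku.
apply/le_anti; rewrite h1; apply: le_running_min => i _.
rewrite uw; last by rewrite coord_shift; lia.
by rewrite (periodicZ _ _ (ce_perw ce)).
Qed.

(** The supremum in the submodularity inequality is a competitor for the same
    strip, up to a translation. *)
Lemma strip_cmax_running_min N u k : strip N u ->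
  strip N (sh (- k.+1%:Z) (cmax (running_min u k) (sh k.+1%:Z u))).
Proof.
move=> su; have [Ku uv uw] := su; have [Ki iv iw] := strip_running_min k su.
have E z : sh (- k.+1%:Z) (cmax (running_min u k) (sh k.+1%:Z u)) z =
    Num.max (running_min u k (z + (- k.+1%:Z) *: e)) (u z).
  by rewrite -cmax_sh sh_sh addNr sh0.
split; first by apply: between_sh; apply: between_cmax => //; exact: between_sh.
  move=> z zN; rewrite E uv// iv; last by rewrite coord_shift; lia.
  by rewrite (periodicZ _ _ (ce_perv ce))// maxxx.
move=> z zN; rewrite E uw// max_r//.
have [_ /(_ (z + (- k.+1%:Z) *: e)) + _] := Ki.
by rewrite (periodicZ _ _ (ce_perw ce)).
Qed.

(** In a strip of finite width, running infima of an almost minimizer remain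
    almost minimizers: what the infimum could gain, the supremum, a translate of
    a competitor, would have lost. After as many steps as the strip is wide the
    running infimum is monotone. *)
Lemma strip_monotone N (a : R) : 0 < a -> strip N !=set0 ->
  exists x l, [/\ strip N x, has_action x l, cle x (sh 1 x) &
    forall y l', strip N y -> has_action y l' -> l <= l' + a].
Proof.
move=> a0 [u0 su0].
pose b := a / (N + N).+1%:R; have b0 : 0 < b by rewrite divr_gt0.
pose P := [set p : config R n * R | strip N p.1 /\ has_action p.1 p.2].
have [||[u l] [su ul] /= minu] := @near_minimum R _ P snd
    (- ((r + r)%:R * (Lam * nu w v))) b _ _ b0.
- by exists (u0, win u0 (N + r) (N + r)); split => //; exact: strip_action.
- by move=> [x l] [[Kx _ _] xl]; exact: action_ge xl.
rewrite /= in su ul.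
have Hk k : exists l', has_action (running_min u k) l' /\ l' <= l + k%:R * b.
  elim: k => [|k [l' [al' l'k]]]; first by exists l; rewrite mul0r addr0.
  have Gu := strip_connecting su.
  have [m [m' [hm hm' mm]]] := action_submodular (strip_connecting (strip_running_min k su))
    (connecting_sh k.+1%:Z Gu) al' (action_sh k.+1%:Z ul).
  exists m; split => //.
  have h := minu (_, m') (conj (strip_cmax_running_min k su) (action_sh _ hm')).
  have {}h : l <= m' + b by exact: h.
  have -> : k.+1%:R * b = k%:R * b + b by rewrite -natr1 mulrDl mul1r.
  lra.
have [l' [al' l'l]] := Hk (N + N)%N.
have [Ku uv uw] := su.
exists (running_min u (N + N)), l'; split => //; first exact: strip_running_min.
  move=> z; rewrite [leRHS]/tau; apply: le_running_min => i.
  rewrite -addrA -scalerDl -intS leq_eqVlt => /predU1P[->|iN]; last first.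
    exact: running_min_le.
  have [zN|zN] := lerP (z ord0 d) (- N%:Z).
    apply: (@le_trans _ _ (u z)).
      by have := @running_min_le u (N + N) 0 z (leq0n _); rewrite scale0r addr0.
    rewrite uv// -(periodicZ (N + N).+1%:Z z (ce_perv ce) (leqnn d)).
    by have [vu _ _] := Ku; exact: vu.
  rewrite uw; last by rewrite coord_shift; lia.
  rewrite (periodicZ _ _ (ce_perw ce))//.
  by have [_ iw _] := between_running_min (N + N) Ku; exact: iw.
move=> y ly sy yly; have := minu (y, ly) (conj sy yly) => /= h.
apply: le_trans l'l _; apply: le_trans (_ : ly + b + (N + N)%:R * b <= _).
  by rewrite lerD2r.
rewrite -addrA lerD2l -{1}[b]mul1r -mulrDl addrC natr1.
by rewrite /b mulrC divfK// gt_eqF.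
Qed.

(** Distances controlled by finitely many sites: uniform continuity in the
    topology of pointwise convergence. *)
Definition fincont (f : config R n -> config R n -> R) := forall a, 0 < a ->
  exists (D : seq (lattice n)) (b : R), 0 < b /\ forall x y, K x -> K y ->
    (forall z, z \in D -> `|x z - y z| <= b) -> f x y <= a.

Lemma fincont_le f g : fincont g ->
  (forall x y, K x -> K y -> f x y <= g x y) -> fincont f.
Proof.
move=> cg fg a /cg[D [b [b0 H]]]; exists D, b; split=> // x y Kx Ky xy.
by apply: le_trans (fg _ _ Kx Ky) _; exact: H.
Qed.

Lemma fincontD f g : fincont f -> fincont g ->
  fincont (fun x y => f x y + g x y).
Proof.
move=> cf cg a a0; have a2 : 0 < a / 2 by rewrite divr_gt0.
have [D [b [b0 H]]] := cf _ a2; have [D' [b' [b'0 H']]] := cg _ a2.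
exists (D ++ D'), (Num.min b b'); rewrite lt_min b0 b'0; split=> // x y Kx Ky xy.
rewrite (splitr a) lerD//; [apply: H => // z zD|apply: H' => // z zD].
  by apply: le_trans (xy z _) _; rewrite ?mem_cat ?zD// ge_min lexx.
by apply: le_trans (xy z _) _; rewrite ?mem_cat ?zD ?orbT// ge_min lexx orbT.
Qed.

Lemma fincont0 : fincont (fun _ _ => 0).
Proof. by move=> a a0; exists [::], 1; split=> // x y _ _ _; exact: ltW. Qed.

Lemma fincont_sum (I : Type) (l : seq I) (f : I -> config R n -> config R n -> R) :
  (forall i, fincont (f i)) -> fincont (fun x y => \sum_(i <- l) f i x y).
Proof.
move=> cf; elim: l => [|i l IH].
  by apply: fincont_le fincont0 _ => x y _ _; rewrite big_nil.
by apply: fincont_le (fincontD (cf i) IH) _ => x y _ _; rewrite big_cons.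
Qed.

Lemma fincontZ f (c : R) : 0 <= c -> fincont f -> fincont (fun x y => c * f x y).
Proof.
move=> c0 cf a a0; have c1 : 0 < c + 1 by rewrite ltr_wpDl.
have [|D [b [b0 H]]] := cf (a / (c + 1)); first by rewrite divr_gt0.
exists D, b; split=> // x y Kx Ky xy.
apply: le_trans (_ : c * (a / (c + 1)) <= _); first by rewrite ler_wpM2l ?H.
by rewrite mulrA ler_pdivrMr// mulrC ler_wpM2l ?(ltW a0)// lerDl.
Qed.

Lemma fincont_sh f (i : int) : fincont f ->
  fincont (fun x y => f (sh i x) (sh i y)).
Proof.
move=> cf a /cf[D [b [b0 H]]]; exists [seq z + i *: e | z <- D], b; split=> //.
move=> x y Kx Ky xy; apply: H; [exact: between_sh..|] => z zD.
by apply: xy; apply/mapP; exists z.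
Qed.

Lemma fincont_nu : fincont nu.
Proof. exact: ce_nu_small ce. Qed.

(** The energy of a cell is controlled by the distances on the cells within
    [r]. *)
Lemma fincont_energy : fincont (fun x y => `|A x - A y|).
Proof.
pose l : seq int := [seq i%:Z - r%:Z | i <- iota 0 (r + r).+1].
apply: (fincont_le (g := fun x y =>
    Lam * \sum_(k <- l) nu (sh k x) (sh k y))).
  by apply: fincontZ => //; apply: fincont_sum => k; apply: fincont_sh fincont_nu.
move=> x y Kx Ky; apply: (ce_lip ce) => // k kr.
have kl : k \in l.
  apply/mapP; exists (absz (k + r%:Z)); last by lia.
  by rewrite mem_iota; lia.
elim: l kl => // i l IH; rewrite inE big_cons => /predU1P[->|kl].
  rewrite lerDl; apply: sumr_ge0 => j _.
  by apply: nu_ge0; exact: between_sh.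
by apply: le_trans (IH kl) _; rewrite lerDr nu_ge0//; exact: between_sh.
Qed.

Lemma fincont_win p q : fincont (fun x y => `|win x p q - win y p q|).
Proof.
pose E x y := `|A x - A y|.
apply: (fincont_le (g := fun x y => \sum_(i <- enum 'I_(p + q).+1)
    E (sh (i%:Z - p%:Z) x) (sh (i%:Z - p%:Z) y))).
  by apply: fincont_sum => i; apply: fincont_sh fincont_energy.
move=> x y Kx Ky; rewrite -sumrB big_enum.
apply: le_trans (ler_norm_sum _ _ _) _; apply: ler_sum => i _.
by rewrite !sh_sh.
Qed.

Lemma fincont_pointwise f (y : nat -> config R n) X : fincont f ->
  (forall i, K (y i)) -> K X ->
  (forall z a, 0 < a -> exists N, forall i, (N <= i)%N -> `|y i z - X z| <= a) ->
  forall a, 0 < a -> exists N, forall i, (N <= i)%N -> f (y i) X <= a.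
Proof.
move=> cf Ky KX yX a /cf[D [b [b0 H]]].
suff [N hN] : exists N, forall i, (N <= i)%N ->
    forall z, z \in D -> `|y i z - X z| <= b.
  by exists N => i Ni; apply: H => //; exact: hN.
elim: D {H} => [|z D [N IH]]; first by exists 0%N.
have [M hM] := yX z _ b0; exists (maxn N M) => i.
rewrite geq_max => /andP[Ni Mi] z'; rewrite inE => /predU1P[->|]; first exact: hM.
exact: IH.
Qed.

Lemma monotone_sh u (i j : int) : cle u (sh 1 u) -> i <= j ->
  cle (sh i u) (sh j u).
Proof.
move=> um ij; have -> : j = i + (absz (j - i))%:Z by lia.
elim: (absz _) => [|m IH] z; first by rewrite addr0.
apply: le_trans (IH z) _; have := um (z + (i + m%:Z) *: e).
rewrite /tau -addrA -scalerDl => /le_trans; apply.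
by rewrite le_eqVlt; apply/orP; left; apply/eqP; congr (u (_ + _ *: _)); lia.
Qed.

Lemma nu_monotone_low u (i j : int) : K u -> cle u (sh 1 u) -> i <= j ->
  nu (sh i u) v <= nu (sh j u) v.
Proof.
move=> Ku um ij; have Ki := between_sh i Ku; have Kj := between_sh j Ku.
apply: (ce_nu_le ce) => // z _; have [/(_ z) h _ _] := Ki.
by have h' := monotone_sh um ij z; rewrite !ger0_norm; lra.
Qed.

Lemma nu_monotone_high u (i j : int) : K u -> cle u (sh 1 u) -> i <= j ->
  nu (sh j u) w <= nu (sh i u) w.
Proof.
move=> Ku um ij; have Ki := between_sh i Ku; have Kj := between_sh j Ku.
apply: (ce_nu_le ce) => // z _; have [_ /(_ z) h _] := Kj.
by have h' := monotone_sh um ij z; rewrite !ler0_norm; lra.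
Qed.

(** The sign [sg] selects the end of the chain. Monotone bounded sequences
    converge at every site, and the limit along the chain does not see a
    translation. *)
Lemma end_limit u (sg : int) : K u -> cle u (sh 1 u) -> sg = 1 \/ sg = - 1 ->
  exists X, [/\ K X, sh 1 X = X & forall z a, 0 < a -> exists N, forall i : nat,
    (N <= i)%N -> `|sh (sg * i%:Z) u z - X z| <= a].
Proof.
move=> Ku um sgP; have [vu uw pu] := Ku.
have vlow z (i : int) : v z <= u (z + i *: e).
  by rewrite -(periodicZ i z (ce_perv ce) (leqnn d)); exact: vu.
have whigh z (i : int) : u (z + i *: e) <= w z.
  by rewrite -(periodicZ i z (ce_perw ce) (leqnn d)); exact: uw.
have Hz z : exists l, forall a, 0 < a -> exists N, forall i : nat, (N <= i)%N ->
    `|sh (sg * i%:Z) u z - l| <= a.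
  case: sgP => ->.
    have [|i|l Hl] := @monotone_bounded_cvg R
        (fun i => sh (1 * i%:Z) u z) (w z); last by exists l.
    - by move=> i; apply: (monotone_sh um); lia.
    - exact: whigh.
  have [|i|l Hl] := @monotone_bounded_cvg R
      (fun i => - sh (- 1 * i%:Z) u z) (- v z).
  - by move=> i; rewrite lerN2; apply: (monotone_sh um); lia.
  - by rewrite lerN2; exact: vlow.
  exists (- l) => a /Hl[N hN]; exists N => i /hN.
  by rewrite opprK -[in X in _ -> X]normrN opprD.
have [X HX] := choice Hz; exists X.
have uniq z z' : (forall a, 0 < a -> exists N, forall i : nat, (N <= i)%N ->
    `|sh (sg * i%:Z) u z' - X z| <= a) -> X z' = X z.
  move=> H; apply/eqP; rewrite -subr_eq0 -normr_le0; apply/ler_addgt0Pr => a a0.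
  have a2 : 0 < a / 2 by rewrite divr_gt0.
  have [N hN] := HX z' _ a2; have [M hM] := H _ a2.
  have := hN (maxn N M) (leq_maxl _ _); have := hM (maxn N M) (leq_maxr _ _).
  by rewrite !ler_norml; lra.
split => //.
  split=> [z|z|k hk z].
  - apply/ler_addgt0Pr => a a0; have [N hN] := HX z _ a0.
    have := hN N (leqnn N); have := vlow z (sg * N%:Z).
    by rewrite ler_norml /tau; lra.
  - apply/ler_addgt0Pr => a a0; have [N hN] := HX z _ a0.
    have := hN N (leqnn N); have := whigh z (sg * N%:Z).
    by rewrite ler_norml /tau; lra.
  - apply: uniq => a /(HX z)[N hN]; exists N => i /hN.
    by rewrite /tau addrAC pu.
apply: funext => z; apply: uniq => a /(HX z)[N hN]; exists N.+1 => i Ni.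
have := hN (absz (i%:Z + sg)); rewrite /tau -addrA -scalerDl.
have -> : sg * (absz (i%:Z + sg))%:Z = 1%:Z + sg * i%:Z.
  by case: sgP => ->; lia.
by apply; case: sgP => ->; lia.
Qed.

(** The ends of a monotone configuration of bounded energy are invariant and
    carry no energy, since a positive energy would be paid infinitely often. *)
Lemma monotone_end u (sg : int) (B : R) : K u -> cle u (sh 1 u) ->
  sg = 1 \/ sg = - 1 -> (forall p q, win u p q <= B) ->
  exists X, [/\ X = v \/ X = w,
    forall z a, 0 < a -> exists N, forall i : nat,
      (N <= i)%N -> `|sh (sg * i%:Z) u z - X z| <= a &
    forall a, 0 < a -> exists N, forall i : nat,
      (N <= i)%N -> nu (sh (sg * i%:Z) u) X <= a].
Proof.
move=> Ku um sgP uB; have [X [KX invX HX]] := end_limit Ku um sgP.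
have Ki (i : nat) : K (sh (sg * i%:Z) u) by exact: between_sh.
have nuX := fincont_pointwise fincont_nu Ki KX HX.
have AX := fincont_pointwise fincont_energy Ki KX HX.
exists X; split => //; apply: (ce_eq0 ce KX invX).
apply/eqP; rewrite eq_le (ce_ge0 ce KX invX) andbT leNgt; apply/negP => AX0.
have AX2 : 0 < A X / 2 by rewrite divr_gt0.
have [N hN] := AX _ AX2.
set C := (r + r)%:R * (Lam * nu w v).
have key m : m%:R * (A X / 2) <= B + C.
  have [j [jN [p [q [p' [q' jw]]]]]] : exists j : int,
      (forall i, (i < m)%N -> exists2 k, (N <= k)%N & i%:Z + j = sg * k%:Z) /\
      exists p q p' q', win u p q = blk m (sh j u) + win u p' q'.
    case: sgP => ->.
      exists N.+1%:Z; split; first by move=> i im; exists (N.+1 + i)%N; lia.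
      exists 0%N, (N + m)%N, 0%N, N.
      by rewrite (win_split _ (leqnn 0) (leq_addr m N)) subnn addKn blk0 add0r addrC.
    exists (- (N + m)%:Z); split.
      by move=> i im; exists (N + m - i)%N; lia.
    exists (N + m)%N, 0%N, N, 0%N.
    by rewrite (win_split _ (leq_addr m N) (leqnn 0)) subnn addKn blk0 addr0.
  have := uB p q; rewrite jw; have := win_ge p' q' Ku; rewrite -/C.
  have : m%:R * (A X / 2) <= blk m (sh j u).
    rewrite mulr_natl -[X in _ *+ X]card_ord -sumr_const; apply: ler_sum => i _.
    rewrite sh_sh; have [k Nk ->] := jN i (ltn_ord i).
    by have := hN k Nk; rewrite ler_norml; lra.
  lra.
have := key (Num.truncn ((B + C) / (A X / 2))).+1; rewrite leNgt => /negP; apply.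
by rewrite -ltr_pdivrMr// truncnS_gt.
Qed.

Lemma strip1_nonempty : strip 1 !=set0.
Proof.
pose u : config R n := fun z => if z ord0 d < 0 then v z else w z.
exists u; have [vv vw pv] := between_low; have [_ _ pw] := between_high.
split; [split=> [z|z|k hk z]|move=> z h|move=> z h]; rewrite /u.
- by case: ifP.
- by case: ifP.
- have -> : (z + unitv k) ord0 d = z ord0 d.
    by case/andP: hk => dk _; rewrite !mxE (ltn_eqF dk) addr0.
  by rewrite pv// pw.
- by rewrite ifT//; lia.
- by rewrite ifF//; apply/negP; lia.
Qed.

Definition least_action : R :=
  inf [set l | exists2 u, connecting u & has_action u l].

Lemma has_inf_action : has_inf [set l | exists2 u, connecting u & has_action u l].
Proof.
split.
  have [u su] := strip1_nonempty; exists (win u (1 + r) (1 + r)), u.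
    exact: strip_connecting su.
  exact: strip_action.
exists (- ((r + r)%:R * (Lam * nu w v))) => l [u [Ku _ _] ul].
exact: action_ge ul.
Qed.

Lemma least_action_le u l : connecting u -> has_action u l -> least_action <= l.
Proof.
by move=> Gu ul; apply: ge_inf; [case: has_inf_action | exists u].
Qed.

Let level : R := (v 0 + w 0) / 2.

(** The translation is fixed by the first cell at which the monotone almost
    minimizer reaches the level; this excludes that a limit of such
    configurations is constantly [v] or [w]. *)
Lemma monotone_almost_minimizer (a : R) : 0 < a -> exists x l,
  [/\ connecting x, has_action x l, cle x (sh 1 x), l <= least_action + a &
      x (- e) <= level /\ level <= x 0].
Proof.
move=> a0; have a3 : 0 < a / 3 by rewrite divr_gt0.
have [l0 [u Gu ul0] hl0] := inf_adherent a3 has_inf_action.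
have [N [y [l1 [sy yl1 hl1]]]] := cutoff Gu ul0 a3.
have [x [l [sx xl xm minx]]] := strip_monotone a3 (ex_intro _ y sy).
have vt : v 0 < level by rewrite /level; have := ce_lt ce 0; lra.
have tw : level < w 0 by rewrite /level; have := ce_lt ce 0; lra.
have cE (i : int) : (i *: e) ord0 d = i.
  by rewrite -[i *: e]add0r coord_shift mxE add0r.
have [_ xv xw] := sx.
have ex : exists i : nat, level <= x ((i%:Z - N%:Z) *: e).
  exists (N + N)%N; rewrite xw; last by rewrite cE; lia.
  by rewrite -[_ *: e]add0r (periodicZ _ _ (ce_perw ce))// ltW.
pose i := ex_minn ex; have [ti imin] : level <= x ((i%:Z - N%:Z) *: e) /\
    forall j : nat, level <= x ((j%:Z - N%:Z) *: e) -> (i <= j)%N.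
  by rewrite /i; case: ex_minnP.
exists (sh (i%:Z - N%:Z) x), l; split.
- exact/connecting_sh/(strip_connecting sx).
- exact: action_sh.
- rewrite sh_sh => z; have := xm (z + (i%:Z - N%:Z) *: e).
  by rewrite /tau -[z + _ + _]addrA -scalerDl [_ + 1]addrC.
- by have := minx _ _ sy yl1; rewrite -/least_action in hl0; lra.
rewrite /tau add0r; split => //; rewrite leNgt; apply/negP => tx.
have i0 : (0 < i)%N.
  rewrite lt0n; apply/eqP => i0; move: ti; rewrite i0 leNgt => /negP; apply.
  rewrite xv; last by rewrite cE; lia.
  by rewrite -[_ *: e]add0r (periodicZ _ _ (ce_perv ce)).
have : (i <= i.-1)%N; last by rewrite -ltnS prednK// ltnn.
apply: imin; apply: ltW; rewrite (_ : (i.-1%:Z - N%:Z) *: e = - e + (i%:Z - N%:Z) *: e)//.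
rewrite -scaleN1r -scalerDl; congr (_ *: _); lia.
Qed.

(** The cluster point [U] of normalized monotone almost minimizers [y i] is
    monotone and its windows have bounded energy, hence [U] connects [v] to [w].
    Its action is the least one: on a window beyond which [U] is near [v] and
    [w], some [y i] is close to [U], and being monotone it stays near [v] and
    [w] beyond the window, so that its tails are almost nonnegative. *)
Theorem action_minimizer_exists :
  exists2 U, connecting U & has_action U least_action.
Proof.
have inv_gt0 (k : nat) : 0 < k.+1%:R^-1 :> R by rewrite invr_gt0.
have [y Hy0] := choice (fun k => monotone_almost_minimizer (inv_gt0 k)).
have [l Hy] := choice Hy0.
have Ky k : K (y k) by have [[]] := Hy k.
have yl k : has_action (y k) (l k) by have [] := Hy k.
have ym k : cle (y k) (sh 1 (y k)) by have [] := Hy k.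
have lc k : l k <= least_action + k.+1%:R^-1 by have [] := Hy k.
have [U clU] := cluster_pointwise (a := v) (b := w) (y := y)
  (fun k z => introT andP (conj (let: And3 h _ _ := Ky k in h z)
                                (let: And3 _ h _ := Ky k in h z))).
(* Inequalities satisfied by all the [y k] hold for [U]. *)
have cl2 z z' (c : R) : (forall k, y k z <= y k z' + c) -> U z <= U z' + c.
  move=> H; apply/ler_addgt0Pr => a a0; have a2 : 0 < a / 2 by rewrite divr_gt0.
  have [k _ Hk] := clU [:: z; z'] _ 0%N a2.
  have := Hk z; have := Hk z'; rewrite !inE !eqxx orbT => /(_ isT) + /(_ isT).
  by have := H k; rewrite !ler_norml; lra.
have clle z (c : R) : (forall k, y k z <= c) -> U z <= c.
  move=> H; apply/ler_addgt0Pr => a a0; have [k _ Hk] := clU [:: z] _ 0%N a0.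
  by have := Hk z; rewrite inE eqxx ler_norml => /(_ isT); have := H k; lra.
have clge z (c : R) : (forall k, c <= y k z) -> c <= U z.
  move=> H; apply/ler_addgt0Pr => a a0; have [k _ Hk] := clU [:: z] _ 0%N a0.
  by have := Hk z; rewrite inE eqxx ler_norml => /(_ isT); have := H k; lra.
have KU : K U.
  split=> [z|z|k hk z].
  - by apply: clge => i; have [] := Ky i.
  - by apply: clle => i; have [] := Ky i.
  - apply/le_anti; rewrite -[X in _ <= X]addr0 -[X in _ && (_ <= X)]addr0.
    by apply/andP; split; apply: cl2 => i; have [_ _ /(_ k hk z) ->] := Ky i;
      rewrite addr0.
have Um : cle U (sh 1 U).
  by move=> z; rewrite -[leRHS]addr0; apply: cl2 => i; rewrite addr0; exact: ym.
have Ut : U (- e) <= level by apply: clle => i; have [_ _ _ _ []] := Hy i.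
have tU : level <= U 0 by apply: clge => i; have [_ _ _ _ []] := Hy i.
have cl f (a : R) M : fincont f -> 0 < a -> exists2 i, (M <= i)%N & f (y i) U <= a.
  move=> cf a0; have [D [b [b0 H]]] := cf a a0.
  have [i Mi Hi] := clU D b M b0.
  by exists i => //; apply: H.
pose C := (r + r)%:R * (Lam * nu w v).
have UB p q : win U p q <= least_action + 1 + 2 * C + 1.
  have [i _] := cl _ _ 0%N (fincont_win p q) ltr01.
  have := @action_ge_win (y i) p q (nu w v) (l i) (Ky i)
    (nu_ge0 between_high between_low)
    (fun j _ => nu_le_diam (between_sh j (Ky i)) between_low)
    (fun j _ => nu_le_diam (between_sh j (Ky i)) between_high) (yl i).
  have := lc i; have : i.+1%:R^-1 <= 1 :> R by rewrite invf_le1// ler1n.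
  by rewrite /= ler_norml -/C; move: (_^-1) => c ? ? ? /andP[? ?]; lra.
have vt : v 0 < level by rewrite /level; have := ce_lt ce 0; lra.
have tw : level < w 0 by rewrite /level; have := ce_lt ce 0; lra.
have GU : connecting U.
  have [X [XP Xlim Xnu]] := monotone_end KU Um (or_intror erefl) UB.
  have [Y [YP Ylim Ynu]] := monotone_end KU Um (or_introl erefl) UB.
  have Xv : X = v.
    case: XP => // Xw; suff : X (- e) <= level.
      by rewrite Xw -scaleN1r -[_ *: e]add0r (periodicZ _ _ (ce_perw ce))// leNgt tw.
    apply/ler_addgt0Pr => a a0; have [N hN] := Xlim (- e) _ a0.
    have := hN N (leqnn N); rewrite ler_norml.
    have := @monotone_sh U (-1 * N%:Z) 0 Um _ (- e); rewrite sh0.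
    by move=> /(_ ltac:(lia)); lra.
  have Yw : Y = w.
    case: YP => // Yv; suff : level <= Y 0 by rewrite Yv leNgt vt.
    apply/ler_addgt0Pr => a a0; have [N hN] := Ylim 0 _ a0.
    have := hN N (leqnn N); rewrite ler_norml.
    have := @monotone_sh U 0 (1 * N%:Z) Um _ 0; rewrite sh0.
    by move=> /(_ ltac:(lia)); lra.
  split => // a /[dup] a0.
    by move=> /Xnu[N hN]; exists N => i /hN; rewrite Xv mulN1r.
  by move=> /Ynu[N hN]; exists N => i /hN; rewrite Yw mul1r.
have final (a : R) : 0 < a -> exists N, forall p q, (N <= p)%N -> (N <= q)%N ->
    win U p q <= least_action + a.
  move=> a0; pose C1 := 4 * ((r + r)%:R * Lam) + 1.
  have C10 : 0 < C1 by rewrite ltr_wpDl// !mulr_ge0.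
  have a3 : 0 < a / 3 by rewrite divr_gt0.
  have a6 : 0 < a / 6 by rewrite divr_gt0.
  pose b := a / 3 / C1; have b0 : 0 < b by rewrite divr_gt0.
  have [N [Hv Hw]] := connecting_ends GU b0; exists (N + r).+1 => p q Np Nq.
  have m0 : 0 < Num.min b (a / 6) by rewrite lt_min b0.
  have [i Mi] := cl _ _ (Num.truncn (a / 6)^-1)
    (fincontD (fincontD (fincont_sh (r%:Z - p%:Z - 1) fincont_nu)
      (fincont_sh (q%:Z - r%:Z + 1) fincont_nu)) (fincont_win p q)) m0.
  rewrite /=; set f1 := nu _ _; set f2 := nu _ _; set f3 := `|_| => f123.
  have f10 : 0 <= f1 by apply: nu_ge0; exact: between_sh.
  have f20 : 0 <= f2 by apply: nu_ge0; exact: between_sh.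
  have f30 : 0 <= f3 by exact: normr_ge0.
  have mb : Num.min b (a / 6) <= b by rewrite ge_min lexx.
  have ma : Num.min b (a / 6) <= a / 6 by rewrite ge_min lexx orbT.
  have f1b : f1 <= b.
    by apply: le_trans mb; apply: le_trans f123; rewrite -addrA lerDl addr_ge0.
  have f2b : f2 <= b.
    by apply: le_trans mb; apply: le_trans f123; rewrite addrAC lerDr addr_ge0.
  have bb0 : 0 <= b + b by rewrite addr_ge0// ltW.
  have := @action_ge_win (y i) p q (b + b) (l i) (Ky i) bb0 _ _ (yl i).
  have -> : 2 * ((r + r)%:R * (Lam * (b + b))) = C1 * b - b by rewrite /C1; ring.
  have -> : C1 * b = a / 3 by rewrite /b mulrC divfK// gt_eqF.
  have li : l i <= least_action + a / 6.
    apply: le_trans (lc i) _; rewrite lerD2l invf_ple ?posrE//.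
    apply: le_trans (ltW (truncnS_gt _)) _.
    by rewrite ler_nat ltnS.
  have h3 : win U p q <= win (y i) p q + a / 6.
    have : f3 <= a / 6 by lra.
    by rewrite /f3 ler_norml; lra.
  move=> H; suff : win (y i) p q - (a / 3 - b) <= l i by lra.
  have Ks j : K (sh j (y i)) by exact: between_sh.
  have KUs j : K (sh j U) by exact: between_sh.
  apply: H => j hj.
    have hj1 : j <= r%:Z - p%:Z - 1 by clear -hj; lia.
    apply: le_trans (nu_monotone_low (Ky i) (ym i) hj1) _.
    apply: le_trans (ce_nu_triangle ce (Ks _) (KUs (r%:Z - p%:Z - 1)) between_low) _.
    by rewrite lerD//; apply: Hv; clear -Np; lia.
  have hj1 : q%:Z - r%:Z + 1 <= j by clear -hj; lia.
  apply: le_trans (nu_monotone_high (Ky i) (ym i) hj1) _.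
  apply: le_trans (ce_nu_triangle ce (Ks _) (KUs (q%:Z - r%:Z + 1)) between_high) _.
  by rewrite lerD//; apply: Hw; clear -Nq; lia.
have [L UL] : exists l, has_action U l.
  have [N hN] := final 1 ltr01.
  have [l0 ? _] := @action_of_frequently_le U (least_action + 1) GU (fun M =>
    ex_intro _ (maxn M N) (ex_intro _ (maxn M N) (And3 (leq_maxl _ _) (leq_maxl _ _)
      (hN _ _ (leq_maxr _ _) (leq_maxr _ _))))).
  by exists l0.
exists U => //; suff -> : least_action = L by [].
apply/le_anti; rewrite (least_action_le GU UL)/=; apply/ler_addgt0Pr => a /final[N hN].
by apply: (pqcvg_le UL (pqcvg_cst _)); exists N.
Qed.

End Chain.

(** * Chains of cells: properties of the minimizers *)

Section ChainMinimizers.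
Context {R : realType} {n r : nat} (s : (lball n r -> R) -> R).
Hypotheses (s_C2 : C2 s) (s_S3 : S3 s) (r_gt0 : (0 < r)%N).
Context (d : 'I_n) (v w : config R n).
Context (A : config R n -> R) (nu : config R n -> config R n -> R) (Lam : R).
Hypothesis ce : chain_energy d r v w A nu Lam.
Hypotheses (ELv : forall x, EL s v x = 0) (ELw : forall x, EL s w x = 0).
Implicit Types (u U V : config R n) (x y z : lattice n) (N M p q : nat).

Local Notation sh := (@tau R n d.+1).
Local Notation K := (between d v w).
Local Notation e := (@unitv n d.+1).
Local Notation connecting := (connecting d v w nu).
Local Notation has_action := (has_action d A).
Local Notation win := (win d A).
Local Notation c := (least_action d v w A nu).

(** Moving the values on an orbit by [t] changes the energy by [t EL + o(t)]; the
    window may depend on [t], as only its limit matters. *)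
Hypothesis variation : forall u x (a : R), K u -> 0 < a ->
  exists2 b : R, 0 < b & forall t, `|t| <= b -> K (bump d.+1 x t u) ->
    exists N, forall p q, (N <= p)%N -> (N <= q)%N ->
    `|win (bump d.+1 x t u) p q - win u p q - t * EL s u x| <= a * `|t|.

Definition minimizer U := connecting U /\ has_action U c.

Lemma bump_connecting u x t : connecting u -> K (bump d.+1 x t u) ->
  connecting (bump d.+1 x t u).
Proof.
move=> [Ku Hv Hw] Kb; split => //.
  move=> a /Hv[N hN]; exists (N + (absz (x ord0 d)).+1)%N => i Ni.
  rewrite (nu_cell ce (x' := sh (- i%:Z) u)); [apply: hN; lia|exact: between_sh ce _ _ _|
    exact: between_low ce|exact: between_sh ce _ _ _|].
  move=> z z0; rewrite /tau /bump ifF//; apply/negP => /agreeP/(_ d (ltnSn _)).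
  by rewrite coord_shift z0; lia.
move=> a /Hw[N hN]; exists (N + (absz (x ord0 d)).+1)%N => i Ni.
rewrite (nu_cell ce (x' := sh i%:Z u)); [apply: hN; lia|exact: between_sh ce _ _ _|
  exact: between_high ce|exact: between_sh ce _ _ _|].
move=> z z0; rewrite /tau /bump ifF//; apply/negP => /agreeP/(_ d (ltnSn _)).
by rewrite coord_shift z0; lia.
Qed.

Lemma between_bump u x t : K u -> v x <= u x + t <= w x ->
  K (bump d.+1 x t u).
Proof.
move=> Ku /andP[vt tw]; have [vu uw pu] := Ku.
have [_ _ pv] := between_low ce; have [_ _ pw] := between_high ce.
split => [z|z|k /andP[dk kn] z]; rewrite /bump.
- case: ifP => // zx.
  by rewrite (periodic_agree pu zx) (periodic_agree pv zx).
- case: ifP => // zx.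
  by rewrite (periodic_agree pu zx) (periodic_agree pw zx).
have zk : agree d.+1 (z + unitv k) z.
  apply/agreeP => j jd; rewrite !mxE (_ : (j.+1 == k) = false) ?addr0//.
  by apply/negP => /eqP jk; move: dk; rewrite -jk ltnS ltnNge -ltnS jd.
have -> : agree d.+1 (z + unitv k) x = agree d.+1 z x.
  apply/idP/idP => H; last exact: agree_trans zk H.
  by apply: agree_trans H; rewrite agree_sym.
by rewrite pu// dk.
Qed.

(** Letting [t] tend to zero on the admissible side gives the sign of [EL]. *)
Lemma one_sided_variation U x (a : R) : minimizer U -> 0 < a ->
  exists2 b, 0 < b & forall t, `|t| <= b -> v x <= U x + t <= w x ->
    - (a * `|t|) <= t * EL s U x.
Proof.
move=> [GU cU] a0; have [KU _ _] := GU.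
have [b b0 Hb] := variation x KU a0; exists b => // t tb hx.
have Kb := between_bump KU hx; have Gb := bump_connecting GU Kb.
have [N hN] := Hb t tb Kb.
set W := bump _ _ _ _ in Kb Gb hN.
have [M hM] := cU _ ltr01.
have [l Wl _] : exists2 l, has_action W l & l <= c + 1 + t * EL s U x + a * `|t|.
  apply: (action_of_frequently_le ce Gb) => M'.
  pose m := (N + M + M')%N.
  have hNm : (N <= m)%N by rewrite /m; lia.
  have hMm : (M <= m)%N by rewrite /m; lia.
  exists m, m; split; [by rewrite /m; lia..|].
  have := hN m m hNm hNm; have := hM m m hMm hMm.
  by rewrite !ler_norml => /andP[? ?] /andP[? ?]; lra.
have cl : c <= l by apply: (least_action_le ce Gb Wl).
suff : l <= c + (t * EL s U x + a * `|t|) by lra.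
apply: (pqcvg_le Wl (pqcvgD cU (pqcvg_cst _))); exists N => p q Np Nq.
by have := hN p q Np Nq; rewrite ler_norml => /andP[_ h]; lra.
Qed.

(** At a site where [U] lies strictly above [v] it can be lowered, so that [EL] is
    nonpositive; where it touches [v], comparison with the solution [v] gives the
    same sign. The opposite sign comes from [w] in the same way. *)
Theorem minimizer_EL U : minimizer U -> forall x, EL s U x = 0.
Proof.
move=> mU x; have [[[vU Uw pU] _ _] _] := mU.
apply/le_anti/andP; split.
- have [vx|vx] := eqVneq (v x) (U x).
    by rewrite -(ELv x); apply: (EL_le s_C2 s_S3).
  have vUx : v x < U x by rewrite lt_neqAle vx vU.
  apply/ler_addgt0Pr => a a0; have [b b0 H] := one_sided_variation x mU a0.
  pose t := Num.min b (U x - v x).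
  have t0 : 0 < t by rewrite lt_min b0 subr_gt0.
  have tb : t <= b by rewrite ge_min lexx.
  have tv : t <= U x - v x by rewrite ge_min lexx orbT.
  have := H (- t); rewrite normrN (gtr0_norm t0) tb => /(_ isT).
  have -> : v x <= U x + - t <= w x.
    by have := Uw x; move=> h; apply/andP; split; lra.
  by move=> /(_ isT); rewrite mulNr lerN2 mulrC ler_pM2r// add0r.
have [wx|wx] := eqVneq (U x) (w x).
  by rewrite -(ELw x); apply: (EL_le s_C2 s_S3).
have Uwx : U x < w x by rewrite lt_neqAle wx Uw.
apply/ler_addgt0Pr => a a0; have [b b0 H] := one_sided_variation x mU a0.
pose t := Num.min b (w x - U x).
have t0 : 0 < t by rewrite lt_min b0 subr_gt0.
have tb : t <= b by rewrite ge_min lexx.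
have tv : t <= w x - U x by rewrite ge_min lexx orbT.
have := H t; rewrite (gtr0_norm t0) tb => /(_ isT).
have -> : v x <= U x + t <= w x.
  by have := vU x; move=> h; apply/andP; split; lra.
move=> /(_ isT); rewrite -mulNr mulrC ler_pM2l//; lra.
Qed.

(** Both actions are at least [c], and their sum is at most [2 c]. *)
Lemma minimizer_cmin_cmax U V : minimizer U -> minimizer V ->
  minimizer (cmin U V) /\ minimizer (cmax U V).
Proof.
move=> [GU cU] [GV cV].
have Gm := connecting_cmin ce GU GV; have GM := connecting_cmax ce GU GV.
have [m [m' [hm hm' mm]]] := action_submodular ce GU GV cU cV.
have := least_action_le ce Gm hm; have := least_action_le ce GM hm' => h1 h2.
have e1 : m = c by apply/le_anti/andP; split; lra.
have e2 : m' = c by apply/le_anti/andP; split; lra.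
by rewrite e1 in hm; rewrite e2 in hm'.
Qed.

Lemma minimizer_touch U V x : minimizer U -> minimizer V -> cle U V ->
  U x = V x -> U = V.
Proof.
move=> mU mV UV UVx; apply: (EL_touch s_C2 s_S3 r_gt0 UV UVx) => y.
by rewrite !minimizer_EL.
Qed.

(** If [U] and [V] meet, both meet the minimizer [cmin U V] from above and are
    equal to it; if they do not meet, [cmin U V] coincides with the smaller one
    at the origin, hence everywhere. *)
Theorem minimizer_ordered U V : minimizer U -> minimizer V ->
  [\/ clt U V, U = V | clt V U].
Proof.
move=> mU mV; have [mm _] := minimizer_cmin_cmax mU mV.
have mlU : cle (cmin U V) U by move=> z; rewrite /cmin ge_min lexx.
have mlV : cle (cmin U V) V by move=> z; rewrite /cmin ge_min lexx orbT.
have [[x UVx]|nUV] := pselect (exists x, U x = V x).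
  apply: Or32; transitivity (cmin U V).
    by apply/esym/(@minimizer_touch _ _ x) => //; rewrite /cmin UVx minxx.
  by apply: (@minimizer_touch _ _ x) => //; rewrite /cmin UVx minxx.
have ne z : U z != V z by apply/eqP => UVz; apply: nUV; exists z.
case: (ltgtP (U 0) (V 0)) => [h|h|h]; last by case/eqP: (ne 0).
  apply: Or31 => z; rewrite lt_neqAle ne.
  have <- : cmin U V = U.
    by apply: (@minimizer_touch _ _ 0) => //; rewrite /cmin min_l// ltW.
  exact: mlV.
apply: Or33 => z; rewrite lt_neqAle eq_sym ne.
have <- : cmin U V = V.
  by apply: (@minimizer_touch _ _ 0) => //; rewrite /cmin min_r// ltW.
exact: mlU.
Qed.

Lemma minimizer_sh U (i : int) : minimizer U -> minimizer (sh i U).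
Proof. by move=> [GU cU]; split; [apply: (connecting_sh ce) | apply: (action_sh ce)]. Qed.

(** Otherwise [U] would be nonincreasing along the chain, although it goes from
    [v] to the larger [w]. *)
Theorem minimizer_strictly_monotone U : minimizer U -> clt U (sh 1 U).
Proof.
move=> mU; suff H : ~ cle (sh 1 U) U.
  case: (minimizer_ordered mU (minimizer_sh 1 mU)) => // [UU|lt].
    by case: H; rewrite -UU => z.
  by case: H => z; exact/ltW/lt.
move=> dec; have [GU _] := mU; have [KU _ _] := GU.
pose a := (w 0 - v 0) / 3.
have a0 : 0 < a by rewrite divr_gt0// subr_gt0; exact: ce_lt ce 0.
have [N [hv hw]] := connecting_ends ce GU a0.
have decn (m : nat) z : U (z + m%:Z *: e) <= U z.
  elim: m => [|m IH]; first by rewrite scale0r addr0.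
  apply: le_trans IH; have := dec (z + m%:Z *: e).
  by rewrite /tau -addrA -scalerDl -[(_ + 1)%R]addrC -intS.
have := hv (- N.+1%:Z) ltac:(lia); have := hw N.+1%:Z ltac:(lia).
have := ce_nu_site ce (between_sh ce N.+1%:Z KU) (between_high ce).
have := ce_nu_site ce (between_sh ce (- N.+1%:Z) KU) (between_low ce).
have := decn (N.+1 + N.+1)%N (- N.+1%:Z *: e).
rewrite -scalerDl (_ : - N.+1%:Z + (N.+1 + N.+1)%N%:Z = N.+1%:Z); last by lia.
rewrite /tau !add0r => h1 h2 h3 h4 h5.
have := le_trans h2 h5; have := le_trans h3 h4; rewrite !ler_norml /a.
have := ce_lt ce 0 => h6 /andP[? ?] /andP[? ?]; lra.
Qed.

Section Functional.
(* The functional of the problem is a lower limit in the extended reals; it is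
   only compared with the windows of the chain on [connecting]. *)
Context (J : config R n -> \bar R).
Hypothesis J_win : forall u, connecting u -> exists a : int -> int -> \bar R,
  J u = liminf_pq a /\ forall p q : nat, a (- p%:Z) q%:Z = (win u p q)%:E.

Lemma J_action u l : connecting u -> has_action u l -> J u = l%:E.
Proof. by move=> /J_win[a [-> aE]] ul; exact: liminf_pq_lim aE ul. Qed.

Lemma J_ge u : connecting u -> (c%:E <= J u)%E.
Proof.
move=> Gu; rewrite leNgt; apply/negP => Jc; have [a [Ja aE]] := J_win Gu.
have lt1 : (liminf_pq a < c%:E)%E by rewrite -Ja.
have [l ul _] := action_of_frequently_le ce Gu (liminf_pq_lt aE lt1).
by move: Jc; rewrite (J_action Gu ul) lte_fin ltNge (least_action_le ce Gu ul).
Qed.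

Lemma inf_J : ereal_inf [set J u | u in connecting] = c%:E.
Proof.
apply/eqP; rewrite eq_le; apply/andP; split.
  have [U GU cU] := action_minimizer_exists ce.
  by apply: ereal_inf_lbound; exists U => //; exact: J_action.
by apply: le_ereal_inf_tmp => _ [u Gu <-]; exact: J_ge.
Qed.

(** The minimizers of the lower limit have finite energy, which is therefore a
    limit. *)
Lemma minimizerP u : connecting u /\ J u = ereal_inf [set J u | u in connecting] <->
  minimizer u.
Proof.
rewrite inf_J; split=> [[Gu Ju]|[Gu cu]]; last by split=> //; exact: J_action.
split=> //; have [a [Ja aE]] := J_win Gu.
have lt1 : (liminf_pq a < (c + 1)%:E)%E by rewrite -Ja Ju lte_fin ltrDl.
have [l ul _] := action_of_frequently_le ce Gu (liminf_pq_lt aE lt1).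
by move: (J_action Gu ul); rewrite Ju => -[->].
Qed.

End Functional.

End ChainMinimizers.

(** * The first level: cells are sites *)

Lemma cvg0P {R : realType} (f : nat -> R) : (forall i, 0 <= f i) ->
  f i @[i --> \oo] --> 0 <->
  forall a, 0 < a -> exists N : nat, forall i, (N <= i)%N -> f i <= a.
Proof.
move=> f0; split=> [/cvgrPdist_le H a /H[N _ hN]|H].
  by exists N => i /hN /=; rewrite sub0r normrN ger0_norm.
apply/cvgrPdist_le => a /H[N hN]; exists N => // i /= /hN.
by rewrite sub0r normrN ger0_norm.
Qed.

Lemma fsbig_window {M : Type} (idx : M) (op : Monoid.com_law idx) (f : int -> M)
    (p q : nat) :
  \big[op/idx]_(i \in [set i : int | (- p%:Z <= i <= q%:Z)%R]) f i =
  \big[op/idx]_(i < (p + q).+1) f (i%:Z - p%:Z).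
Proof.
pose l : seq int := [seq i%:Z - p%:Z | i : nat <- iota 0 (p + q).+1].
have -> : [set i : int | (- p%:Z <= i <= q%:Z)%R] = [set` l].
  apply/seteqP; split=> [i /= iq|i /= /mapP[j + ->]].
    by apply/mapP; exists (absz (i + p%:Z)); rewrite ?mem_iota; lia.
  by rewrite mem_iota; lia.
rewrite -fsbig_seq; last by rewrite map_inj_uniq ?iota_uniq // => i j; lia.
by rewrite big_map -[iota _ _]/(index_iota 0 (p + q).+1) big_mkord.
Qed.

Section FirstLevel.
Context {R : realType} {n r : nat} (n_gt0 : (0 < n)%N).
Context (s : (lball n r -> R) -> R).
Hypotheses (s_C2 : C2 s) (s_adm : admissible s) (r_gt0 : (0 < r)%N).
Context (v0 w0 : config R n) (adj0 : adjacent_in (M0 s) v0 w0).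
Implicit Types (u x y : config R n).

Let s_S3 : S3 s. Proof. by have [] := s_adm. Qed.

Definition dir1 : 'I_n := Ordinal n_gt0.

Definition energy1 u : R := local_potential s 0 u - c0 s.

Definition dist1 x y : R := `|x 0 - y 0|.

Lemma Gamma0_cst u z : Gamma0 u -> u z = u 0.
Proof. by move=> pu; apply: (periodic_agree (m := 0) pu); apply/agreeP. Qed.

Lemma c0_le u : Gamma0 u -> c0 s <= J0 s u.
Proof.
have [_ [[m hm] _] _] := s_adm.
by move=> Gu; apply: ge_inf; [exists m => _ [x _ <-]; exact: hm | exists u].
Qed.

Let v0_min : M0 s v0. Proof. by have [] := adj0. Qed.
Let w0_min : M0 s w0. Proof. by have [] := adj0. Qed.

(** For a constant configuration, [EL] is the derivative of [s] along the
    constants, where [u] is a minimum. *)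
Lemma M0_EL u (x : lattice n) : M0 s u -> EL s u x = 0.
Proof.
move=> [Gu Ju].
have -> : EL s u x = \sum_(k <- ball_enum n r) partial k s (loc u 0).
  apply: eq_bigr => k _; congr (partial k s _); apply: funext => j.
  by rewrite /loc Gamma0_cst// [RHS]Gamma0_cst.
set S := \sum_(k <- _) _; have H (a : R) : 0 < a -> exists2 b : R, 0 < b &
    forall t, `|t| <= b -> - (a * `|t|) <= t * S.
  move=> a0; have [b b0 hb] := C1_expansion (ball_enum_uniq n r)
    (@mem_ball_enum n r) predT (loc u 0) (proj1 s_C2) a0.
  exists b => // t /hb; rewrite /=; set X := s _ => hX.
  have : s (loc u 0) <= X.
    have -> : X = J0 s (fun _ => u 0 + t).
      rewrite /J0 local_potentialE; congr s; apply: funext => j.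
      by rewrite /loc Gamma0_cst.
    by rewrite -local_potentialE -/(J0 s u) Ju; apply: c0_le => k _ i.
  by move: hX; rewrite -/S ler_norml => /andP[? ?] ?; lra.
apply/eqP; rewrite -normr_le0; apply/ler_addgt0Pr => a a0; rewrite add0r.
have [b b0 hb] := H a a0; rewrite ler_norml; apply/andP; split.
  have := hb b; rewrite gtr0_norm// lexx => /(_ isT).
  by rewrite -mulNr [b * S]mulrC ler_pM2r.
have := hb (- b); rewrite normrN gtr0_norm// lexx => /(_ isT).
by rewrite mulNr lerN2 mulrC ler_pM2r.
Qed.

Lemma between1_box u z : between dir1 v0 w0 u -> v0 0 <= u z <= w0 0.
Proof.
move=> [vu uw _]; have := vu z; have := uw z.
rewrite (Gamma0_cst z (proj1 v0_min)) (Gamma0_cst z (proj1 w0_min)).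
by move=> -> ->.
Qed.

Lemma between1_inv u : between dir1 v0 w0 u -> tau dir1.+1 1 u = u -> Gamma0 u.
Proof.
move=> [_ _ pu] tu k /andP[k1 kn] z; have [k2|k2] := leqP 2 k.
  by apply: pu; rewrite k2.
have -> : k = 1%N by lia.
by rewrite -{2}tu /tau scale1r.
Qed.

Lemma first_level_chain :
  exists Lam, chain_energy dir1 r v0 w0 energy1 dist1 Lam.
Proof.
have [L L0 hL] := local_potential_lipschitz s_C2 (v0 0) (w0 0).
exists (L * (size (ball_enum n r))%:R); split.
- by have [] := adj0.
- by have [] := v0_min.
- by have [] := w0_min.
- by move=> x; rewrite /dist1 subrr normr0.
- by move=> x y x' y' _ _ _ _; apply; rewrite mxE.
- by move=> x y z _ _ _; exact: ler_distD.
- by move=> x y _ _.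
- move=> a a0; exists [:: 0], a; split=> // x y _ _; apply; exact: mem_head.
- by rewrite mulr_ge0.
- move=> x y a Kx Ky H; rewrite /energy1 opprB addrA subrK.
  apply: le_trans (hL x y 0 _ _) _; [by move=> z; exact: between1_box..|].
  rewrite -mulrA ler_wpM2l//.
  apply: le_trans (_ : \sum_(k <- ball_enum n r) a <= _); last first.
    by rewrite big_const_seq count_predT iter_addr_0 mulr_natl.
  apply: ler_sum => k _; have [_ _ px] := Kx; have [_ _ py] := Ky.
  have kE : agree 1 (val k + 0) (0 + (val k ord0 dir1) *: unitv dir1.+1).
    apply/agreeP => j j0; have -> : j = dir1 by apply/val_inj; rewrite /=; lia.
    by rewrite coord_shift addr0 mxE add0r.
  rewrite (periodic_agree px kE) (periodic_agree py kE).
  apply: H; exact: leq_trans (lnorm_coord _ _) (valP k).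
- move=> x y _ _; have := local_potential_submodular s_C2 s_S3 x y 0.
  by rewrite /energy1; lra.
- move=> x Kx invx; rewrite /energy1 subr_ge0; apply: c0_le.
  exact: between1_inv Kx invx.
- move=> x Kx invx /eqP; rewrite subr_eq0 => /eqP Jx.
  have Gx := between1_inv Kx invx; have [vx xw _] := Kx.
  have [//|xv] := pselect (x = v0); first by left.
  have [//|xw'] := pselect (x = w0); first by right.
  by have [_ _ _ []] := adj0; exists x; split.
- by rewrite /energy1 -[local_potential _ _ _]/(J0 s v0) (proj2 v0_min) subrr.
- by rewrite /energy1 -[local_potential _ _ _]/(J0 s w0) (proj2 w0_min) subrr.
Qed.

Local Notation win1 := (win dir1 energy1).
Local Notation connecting1 := (connecting dir1 v0 w0 dist1).

Lemma J1i_energy1 (i : int) u : J1i s i u = energy1 (tau 1 i u).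
Proof.
rewrite /J1i /energy1 !local_potentialE; congr (s _ - _).
by apply: funext => k; rewrite /loc /tau addr0.
Qed.

Lemma J1pq_win u (p q : nat) : J1pq s (- p%:Z) q%:Z u = win1 u p q.
Proof.
rewrite /J1pq fsbig_window; apply: eq_bigr => i _.
by rewrite J1i_energy1 sh_sh.
Qed.

Lemma connecting1E : connecting1 = Gamma1 v0 w0.
Proof.
apply/funext => u; apply/propext.
have E (c0 : config R n) (f : nat -> int) : Gamma0 c0 ->
    (fun i => `|u (T_ (f i)) - c0 (T_ (f i))|) =
    (fun i => dist1 (tau dir1.+1 (f i) u) c0).
  move=> Gc; apply: funext => i.
  by rewrite /dist1 /tau add0r (Gamma0_cst (T_ (f i)) Gc).
have Gv := proj1 v0_min; have Gw := proj1 w0_min.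
have Ev := E v0 (fun i => - i%:Z) Gv; have Ew := E w0 (fun i => i%:Z) Gw.
split=> [[Ku Hv Hw]|[Ku]].
  split=> //; first by rewrite Ev; apply/cvg0P => // i; exact: normr_ge0.
  by rewrite Ew; apply/cvg0P => // i; exact: normr_ge0.
rewrite Ev Ew !cvg0P => [? ?|i|i]; [by split | exact: normr_ge0..].
Qed.

Lemma window1 (p q : nat) (x : lattice n) : let l := [seq (T_ (i%:Z - p%:Z) : lattice n) |
    i : nat <- iota 0 (p + q).+1] in
  (lnorm x + r <= p)%N -> (lnorm x + r <= q)%N ->
  [/\ uniq l, {in l &, forall y z : lattice n, agree 1 y z -> y = z} &
    forall k : lball n r, exists2 y, y \in l & agree 1 (val k + y) x].
Proof.
move=> l xp xq.
have T0 (i : int) : (T_ i : lattice n) ord0 dir1 = i.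
  by rewrite /T_ -[_ *: _]add0r (coord_shift dir1) mxE add0r.
have injl : {in l &, forall y z : lattice n, agree 1 y z -> y = z}.
  move=> _ _ /mapP[i _ ->] /mapP[j _ ->] /agreeP/(_ dir1 isT).
  by rewrite !T0 => ->.
split => //.
  rewrite map_inj_uniq ?iota_uniq// => i j /(congr1 (fun z : lattice n => z ord0 dir1)).
  by rewrite !T0; lia.
move=> k; have := lnorm_coord (val k) dir1; have := valP k; rewrite /=.
have := lnorm_coord x dir1.
set a := x ord0 dir1; set b := val k ord0 dir1 => h1 h2 h3.
exists (T_ (a - b)).
  apply/mapP; exists (absz (a - b + p%:Z)); last by congr T_; lia.
  by rewrite mem_iota; lia.
apply/agreeP => j j0; have -> : j = dir1 by apply/val_inj; rewrite /=; lia.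
by rewrite mxE T0 -/a -/b; lia.
Qed.

Lemma variation1 u (x : lattice n) (a : R) : between dir1 v0 w0 u -> 0 < a ->
  exists2 b : R, 0 < b & forall t, `|t| <= b ->
    between dir1 v0 w0 (bump dir1.+1 x t u) ->
    exists N, forall p q, (N <= p)%N -> (N <= q)%N ->
    `|win1 (bump dir1.+1 x t u) p q - win1 u p q - t * EL s u x| <= a * `|t|.
Proof.
move=> [_ _ pu] a0.
have [b b0 H] := first_variation s_C2 x pu a0; exists b => // t /H{}H _.
exists (lnorm x + r)%N => p q xp xq; set u' := bump _ _ _ _ in H *.
have [h1 h2 h3] := window1 xp xq; have := H _ h1 h2 h3.
rewrite big_map -[iota _ _]/(index_iota 0 (p + q).+1) big_mkord.
suff -> : win1 u' p q - win1 u p q = \sum_(i < (p + q).+1)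
    (local_potential s (T_ (i%:Z - p%:Z)) u' -
     local_potential s (T_ (i%:Z - p%:Z)) u) by [].
rewrite -!J1pq_win /J1pq !fsbig_window -sumrB; apply: eq_bigr => i _.
by rewrite /J1i opprB addrA subrK.
Qed.

Local Notation min1 := (minimizer dir1 v0 w0 energy1 dist1).

Lemma M1P u : M1 s v0 w0 u <-> min1 u.
Proof.
have [Lam ce] := first_level_chain.
rewrite /M1 /c1 -connecting1E; apply: (minimizerP ce) => {}u _.
exists (fun p q => (J1pq s p q u)%:E); split=> // p q.
by rewrite J1pq_win.
Qed.

Lemma c1E : c1 s v0 w0 = (least_action dir1 v0 w0 energy1 dist1)%:E.
Proof.
have [Lam ce] := first_level_chain.
rewrite /c1 -connecting1E; apply: (inf_J ce) => u _.
exists (fun p q => (J1pq s p q u)%:E); split=> // p q.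
by rewrite J1pq_win.
Qed.

Let ELv0 (x : lattice n) : EL s v0 x = 0. Proof. exact: M0_EL. Qed.
Let ELw0 (x : lattice n) : EL s w0 x = 0. Proof. exact: M0_EL. Qed.

Lemma M1_EL u : M1 s v0 w0 u -> forall x : lattice n, EL s u x = 0.
Proof.
have [Lam ce] := first_level_chain.
by move=> /M1P; exact: (minimizer_EL s_C2 s_S3 r_gt0 ce ELv0 ELw0 variation1).
Qed.

Lemma M1_ordered : ordered (M1 s v0 w0).
Proof.
have [Lam ce] := first_level_chain.
by move=> u u' /M1P mu /M1P mu';
  exact: (minimizer_ordered s_C2 s_S3 r_gt0 ce ELv0 ELw0 variation1 mu mu').
Qed.

Lemma M1_tau u : M1 s v0 w0 u -> M1 s v0 w0 (tau 1 1 u).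
Proof.
have [Lam ce] := first_level_chain.
by move=> /M1P mu; apply/M1P; exact: (minimizer_sh ce 1 mu).
Qed.

Lemma M1_strictly_monotone u : M1 s v0 w0 u -> clt u (tau 1 1 u).
Proof.
have [Lam ce] := first_level_chain.
move=> /M1P mu.
exact: (minimizer_strictly_monotone s_C2 s_S3 r_gt0 ce ELv0 ELw0 variation1 mu).
Qed.

(** The translate of [v1] is a minimizer above [v1], and adjacency leaves no room
    for it strictly between [v1] and [w1]. *)
Lemma M1_adjacent_translate v1 w1 : adjacent_in (M1 s v0 w0) v1 w1 ->
  cle w1 (tau 1 1 v1).
Proof.
move=> [mv mw vw nadj]; have tv := M1_strictly_monotone mv.
have [tw|->|wt] := M1_ordered (M1_tau mv) mw => z; [|by []|exact/ltW/wt].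
case: nadj; exists (tau 1 1 v1); split.
- exact: M1_tau.
- by move=> y; exact/ltW/tv.
- by move=> y; exact/ltW/tw.
- by move=> E; have := tv 0; rewrite E ltxx.
- by move=> E; have := tw 0; rewrite E ltxx.
Qed.

End FirstLevel.

(** * Sums over the integers *)

Section FiniteSums.
Context {R : realType}.
Implicit Types (f g h : int -> R) (l : seq int).

Definition sums_le f (B : R) := forall l, uniq l -> \sum_(i <- l) f i <= B.

(** For a nonnegative family with bounded finite sums this is its sum; working
    with suprema of finite sums avoids any enumeration of the integers. *)
Definition rsum f : R :=
  sup [set B | exists2 l : seq int, uniq l & \sum_(i <- l) f i = B].

Lemma has_sup_sums f B : sums_le f B ->
  has_sup [set B | exists2 l : seq int, uniq l & \sum_(i <- l) f i = B].
Proof.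
move=> fB; split; last by exists B => _ [l ul <-]; exact: fB.
by exists 0, [::] => //; rewrite big_nil.
Qed.

Lemma sums_le_rsum f B : sums_le f B -> sums_le f (rsum f).
Proof.
by move=> /has_sup_sums fB l ul; apply: sup_upper_bound => //; exists l.
Qed.

Lemma rsum_le f B : sums_le f B -> rsum f <= B.
Proof.
move=> fB; apply: ge_sup; first by have [] := has_sup_sums fB.
by move=> _ [l ul <-]; exact: fB.
Qed.

Lemma sums_leW f g B : (forall i, f i <= g i) -> sums_le g B -> sums_le f B.
Proof.
by move=> fg gB l ul; apply: le_trans (gB l ul); apply: ler_sum => i _.
Qed.

Lemma rsum_ge0 f B : sums_le f B -> 0 <= rsum f.
Proof. by move=> /sums_le_rsum/(_ [::] isT); rewrite big_nil. Qed.

Lemma sums_leD f g B C : sums_le f B -> sums_le g C ->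
  sums_le (fun i => f i + g i) (B + C).
Proof. by move=> fB gC l ul; rewrite big_split lerD ?fB ?gC. Qed.

Lemma sums_leZ f (c : R) B : 0 <= c -> sums_le f B ->
  sums_le (fun i => c * f i) (c * B).
Proof. by move=> c0 fB l ul; rewrite -mulr_sumr ler_wpM2l ?fB. Qed.

Lemma sums_le_sum (I : Type) (s : seq I) (F : I -> int -> R) (B : I -> R) :
  (forall k, sums_le (F k) (B k)) ->
  sums_le (fun i => \sum_(k <- s) F k i) (\sum_(k <- s) B k).
Proof.
by move=> FB l ul; rewrite exchange_big; apply: ler_sum => k _; exact: FB.
Qed.

Lemma sums_le_shift f (c : int) B : sums_le f B ->
  sums_le (fun i => f (i + c)) B.
Proof.
move=> fB l ul; have := fB [seq i + c | i <- l]; rewrite big_map; apply.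
by rewrite map_inj_uniq // => i j /addIr.
Qed.

Lemma sum_subset f l l' : (forall i, 0 <= f i) -> uniq l -> {subset l <= l'} ->
  \sum_(i <- l) f i <= \sum_(i <- l') f i.
Proof.
move=> f0; elim: l l' => [|i l IH] l'; first by rewrite big_nil sumr_ge0.
move=> /= /andP[il ul] sl; have il' : i \in l' by apply: sl; exact: mem_head.
rewrite big_cons (perm_big _ (perm_to_rem il')) big_cons lerD2l; apply: IH => //.
move=> j jl; have : j \in i :: rem i l'.
  by rewrite -(perm_mem (perm_to_rem il')) sl// inE jl orbT.
by rewrite inE => /predU1P[ji|//]; move: il; rewrite -ji jl.
Qed.

Lemma big_window f (p q : nat) : \sum_(i < (p + q).+1) f (i%:Z - p%:Z) =
  \sum_(i <- [seq i%:Z - p%:Z | i : nat <- iota 0 (p + q).+1]) f i.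
Proof. by rewrite big_map -[iota _ _]/(index_iota 0 (p + q).+1) big_mkord. Qed.

Lemma window_uniq (p q : nat) :
  uniq [seq i%:Z - p%:Z | i : nat <- iota 0 (p + q).+1].
Proof. by rewrite map_inj_uniq ?iota_uniq // => i j; lia. Qed.

Lemma window_cover l : exists N : nat, forall p q, (N <= p)%N -> (N <= q)%N ->
  {subset l <= [seq i%:Z - p%:Z | i : nat <- iota 0 (p + q).+1]}.
Proof.
elim: l => [|i l [N IH]]; first by exists 0%N.
exists (maxn N (absz i)) => p q; rewrite !geq_max => /andP[Np ip] /andP[Nq iq] j.
rewrite inE => /predU1P[->|]; last exact: IH.
by apply/mapP; exists (absz (i + p%:Z)); rewrite ?mem_iota; lia.
Qed.

Lemma rsum_near f B (a : R) : sums_le f B -> 0 < a ->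
  exists2 l, uniq l & rsum f - a <= \sum_(i <- l) f i.
Proof.
move=> fB a0; have [_ [l ul <-] h] := sup_adherent a0 (has_sup_sums fB).
by exists l => //; exact: ltW.
Qed.

Lemma rsum_pqcvg f B : (forall i, 0 <= f i) -> sums_le f B ->
  pqcvg (fun p q => \sum_(i < (p + q).+1) f (i%:Z - p%:Z)) (rsum f).
Proof.
move=> f0 fB a a0; have [l ul hl] := rsum_near fB a0.
have [N hN] := window_cover l; exists N => p q Np Nq; rewrite big_window.
have h1 := sum_subset f0 ul (hN p q Np Nq).
have h2 := sums_le_rsum fB (window_uniq p q).
by rewrite ler_norml; lra.
Qed.

(** A dominated signed family is the difference of the nonnegative families
    [f + g] and [g]. *)
Lemma dominated_pqcvg f g B : (forall i, `|f i| <= g i) -> sums_le g B ->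
  exists L, pqcvg (fun p q => \sum_(i < (p + q).+1) f (i%:Z - p%:Z)) L.
Proof.
move=> fg gB; have g0 i : 0 <= g i by exact: le_trans (normr_ge0 _) (fg i).
have fg0 i : 0 <= f i + g i by have := fg i; rewrite ler_norml; lra.
have fgB : sums_le (fun i => f i + g i) (B + B).
  apply: sums_leD => //; apply: sums_leW gB => i.
  exact: le_trans (ler_norm _) (fg i).
have h1 := rsum_pqcvg fg0 fgB; have h2 := pqcvgZ (-1) (rsum_pqcvg g0 gB).
eexists; apply: pqcvg_eventually (pqcvgD h1 h2) _.
by exists 0%N => p q _ _; rewrite big_split /=; ring.
Qed.

(** The terms outside of [l0] are dominated by a small tail of the sum of [g]. *)
Lemma rsum_dominated_near g B (a : R) : sums_le g B -> 0 < a ->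
  exists2 l0, uniq l0 & forall f, (forall i, 0 <= f i <= g i) ->
    rsum f <= \sum_(i <- l0) f i + a.
Proof.
move=> gB a0; have [l0 ul0 hl0] := rsum_near gB a0; exists l0 => // f fg.
apply: rsum_le => l ul.
have f0 i : 0 <= f i by have /andP[] := fg i.
pose l1 := [seq i <- l | i \notin l0].
have ul1 : uniq (l0 ++ l1).
  rewrite cat_uniq ul0 filter_uniq//= andbT; apply/hasPn => i.
  by rewrite mem_filter => /andP[].
have : \sum_(i <- l0 ++ l1) g i <= rsum g by exact: sums_le_rsum gB _ ul1.
have : \sum_(i <- l) f i <= \sum_(i <- l0 ++ l1) f i.
  apply: sum_subset => // i il; rewrite mem_cat mem_filter il andbT.
  by case: (i \in l0).
have : \sum_(i <- l1) f i <= \sum_(i <- l1) g i.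
  by apply: ler_sum => i _; have /andP[] := fg i.
by rewrite !big_cat /=; lra.
Qed.

(** The link with the sums in the extended reals that define [norm_on]. *)
Lemma esum_rsum f B : (forall i, 0 <= f i) -> sums_le f B ->
  (\esum_(i in [set: int]) (f i)%:E)%E = (rsum f)%:E.
Proof.
move=> f0 fB; have H : (\esum_(i in [set: int]) (f i)%:E <= (rsum f)%:E)%E.
  apply: ge_ereal_sup => _ [X [finX _] <-].
  have [l XE] := (finite_seqP X).1 finX.
  have -> : X = [set` undup l].
    by rewrite XE; apply/seteqP; split=> i /=; rewrite mem_undup.
  rewrite -fsbig_seq ?undup_uniq// sumEFin lee_fin.
  exact: sums_le_rsum fB _ (undup_uniq l).
apply/eqP; rewrite eq_le H/=.
have E0 : (0 <= \esum_(i in [set: int]) (f i)%:E)%E.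
  by apply: esum_ge0 => i _; rewrite lee_fin.
have finE : (\esum_(i in [set: int]) (f i)%:E)%E \is a fin_num.
  by rewrite ge0_fin_numE//; apply: le_lt_trans H (ltry _).
rewrite -(fineK finE) lee_fin; apply: rsum_le => l ul.
rewrite -lee_fin fineK// -sumEFin.
apply: esum_ge; exists [set` l]; last by rewrite -fsbig_seq.
by split => //; exact: finite_seq.
Qed.

Lemma pqcvg_sum (I : Type) (s : seq I) (b : I -> nat -> nat -> R) (L : I -> R) :
  (forall i, pqcvg (b i) (L i)) ->
  pqcvg (fun p q => \sum_(i <- s) b i p q) (\sum_(i <- s) L i).
Proof.
move=> bL; elim: s => [|i s IH].
  apply: pqcvg_eventually (pqcvg_cst _) _.
  by exists 0%N => p q _ _; rewrite !big_nil.
rewrite big_cons; apply: pqcvg_eventually (pqcvgD (bL i) IH) _.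
by exists 0%N => p q _ _; rewrite big_cons.
Qed.

End FiniteSums.

(** * The second level: cells are rows *)

Section SecondLevel.
Context {R : realType} {n r : nat} (n_gt1 : (1 < n)%N) (r_gt0 : (0 < r)%N).
Context (s : (lball n r -> R) -> R).
Hypotheses (s_C2 : C2 s) (s_adm : admissible s).
Context (v0 w0 : config R n) (adj0 : adjacent_in (M0 s) v0 w0).
Context (v1 w1 : config R n) (adj1 : adjacent_in (M1 s v0 w0) v1 w1).
Implicit Types (u x y : config R n) (z : lattice n).

Let s_S3 : S3 s. Proof. by have [] := s_adm. Qed.
Let n_gt0 : (0 < n)%N. Proof. exact: ltnW. Qed.

Local Notation d1 := (dir1 n_gt0).
Definition dir2 : 'I_n := Ordinal n_gt1.

Local Notation energy1 := (energy1 s).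
Local Notation win1 := (win d1 energy1).
Local Notation c := (least_action d1 v0 w0 energy1 (@dist1 R n)).
Local Notation K := (between dir2 v1 w1).
Local Notation site a := (T_ a : lattice n).

(** [J1] is finite on the configurations between [v1] and [w1], see
    [row_energy_cvg], so that taking the real part loses nothing there. *)
Definition energy2 u : R := fine (J1 s u) - c.

Definition dist2 x y : R := rsum (fun a : int => `|x (site a) - y (site a)|).

Let v1_min : M1 s v0 w0 v1. Proof. by have [] := adj1. Qed.
Let w1_min : M1 s v0 w0 w1. Proof. by have [] := adj1. Qed.

Let v1_connecting : connecting d1 v0 w0 (@dist1 R n) v1.
Proof. by rewrite (connecting1E n_gt0 adj0); have [] := v1_min. Qed.
Let w1_connecting : connecting d1 v0 w0 (@dist1 R n) w1.
Proof. by rewrite (connecting1E n_gt0 adj0); have [] := w1_min. Qed.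

Let v1_w1 z : v1 z < w1 z. Proof. by have [_ _ + _] := adj1; apply. Qed.

Lemma site_coord1 (a : int) : site a ord0 d1 = a.
Proof. by rewrite /T_ -[_ *: _]add0r (coord_shift d1) mxE add0r. Qed.

Lemma site_coord2 (a : int) : site a ord0 dir2 = 0.
Proof. by rewrite !mxE /= mulr0. Qed.

Lemma up_coord1 (i : int) : (i *: unitv 2 : lattice n) ord0 d1 = 0.
Proof. by rewrite !mxE /= mulr0. Qed.

Lemma up_coord2 (i : int) : (i *: unitv 2 : lattice n) ord0 dir2 = i.
Proof. by rewrite !mxE /= mulr1. Qed.

Lemma coordD (z z' : lattice n) j : (z + z') ord0 j = z ord0 j + z' ord0 j.
Proof. by rewrite mxE. Qed.

Lemma agree2P z z' : z ord0 d1 = z' ord0 d1 -> z ord0 dir2 = z' ord0 dir2 ->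
  agree 2 z z'.
Proof.
move=> h1 h2; apply/agreeP => j j2.
have [->//|->//] : j = d1 \/ j = dir2.
by case: j j2 => [[|[|//]] jn] _; [left|right]; apply/val_inj.
Qed.

(** Since [w1] lies below the translate of [v1], the sum of [w1 - v1] over a row
    is at most the telescoping sum of the increments of [v1]. *)
Lemma gap_sums : exists B, sums_le (fun a : int => w1 (site a) - v1 (site a)) B.
Proof.
exists (w0 0 - v0 0) => l ul.
have g0 (a : int) : 0 <= w1 (site a) - v1 (site a) by rewrite subr_ge0 ltW.
have [N hN] := window_cover l.
apply: le_trans (sum_subset g0 ul (hN N N (leqnn _) (leqnn _))) _.
rewrite -big_window.
have step (a : int) : w1 (site a) <= v1 (site (a + 1)).
  have := M1_adjacent_translate n_gt0 s_C2 s_adm r_gt0 adj0 adj1 (site a).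
  by rewrite /tau /T_ scalerDl.
apply: le_trans (_ : \sum_(i < (N + N).+1)
    (v1 (site (i.+1%:Z - N%:Z)) - v1 (site (i%:Z - N%:Z))) <= _).
  apply: ler_sum => i _; rewrite lerD2r; apply: le_trans (step _) _.
  by rewrite (_ : i%:Z - N%:Z + 1 = i.+1%:Z - N%:Z)//; lia.
rewrite -(big_mkord xpredT (fun i : nat =>
  v1 (site (i.+1%:Z - N%:Z)) - v1 (site (i%:Z - N%:Z)))).
rewrite (telescope_sumr (fun i : nat => v1 (site (i%:Z - N%:Z)))) //.
have [Kv _ _] := v1_connecting.
apply: lerB; [have /andP[_] := between1_box adj0 (site ((N + N).+1%:Z - N%:Z)) Kv
  |have /andP[] := between1_box adj0 (site (0%N%:Z - N%:Z)) Kv]; by [].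
Qed.

Lemma between21 u : K u -> forall z, v0 0 <= u z <= w0 0.
Proof.
move=> [vu uw _] z; have [Kv _ _] := v1_connecting; have [Kw _ _] := w1_connecting.
have /andP[h1 _] := between1_box adj0 z Kv; have /andP[_ h2] := between1_box adj0 z Kw.
by rewrite (le_trans h1 (vu z)) (le_trans (uw z) h2).
Qed.

Lemma diff_le_gap x y z : K x -> K y -> `|x z - y z| <= w1 z - v1 z.
Proof.
by move=> [/(_ z) ? /(_ z) ? _] [/(_ z) ? /(_ z) ? _]; rewrite ler_norml; lra.
Qed.

Lemma dist2_sums x y : K x -> K y ->
  exists B, sums_le (fun a : int => `|x (site a) - y (site a)|) B.
Proof.
move=> Kx Ky; have [B hB] := gap_sums; exists B.
by apply: sums_leW hB => a; exact: diff_le_gap.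
Qed.

Lemma win1E u (p q : nat) : win1 u p q =
  \sum_(i < (p + q).+1) (local_potential s (site (i%:Z - p%:Z)) u - c0 s).
Proof. by rewrite -J1pq_win /J1pq fsbig_window. Qed.

Let v1_per : periodic_from 2 v1. Proof. by have [[]] := v1_connecting. Qed.
Let w1_per : periodic_from 2 w1. Proof. by have [[]] := w1_connecting. Qed.

Let Kv : K v1.
Proof.
by split; [by move=> z|by move=> z; exact/ltW|exact: periodic_weaken v1_per].
Qed.

Let Kw : K w1.
Proof.
by split; [by move=> z; exact/ltW|by move=> z|exact: periodic_weaken w1_per].
Qed.

Lemma energy1_sums : exists2 L : R, 0 <= L & forall x y, K x -> K y ->
  forall a : int,
    `|local_potential s (site a) x - local_potential s (site a) y| <=
    L * \sum_(k <- ball_enum n r)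
      `|x (val k + site a) - y (val k + site a)|.
Proof.
have [L L0 hL] := local_potential_lipschitz s_C2 (v0 0) (w0 0).
by exists L => // x y Kx Ky a; apply: hL => z; exact: between21.
Qed.

(** A displacement [k] of the ball moves the row by its second coordinate and the
    position in the row by the first one. *)
Lemma row_shift u (k : lball n r) (a : int) : K u ->
  u (val k + site a) = tau 2 (val k ord0 dir2) u (site (a + val k ord0 d1)).
Proof.
move=> [_ _ pu]; apply: (periodic_agree pu); apply: agree2P.
  by rewrite !coordD !site_coord1 up_coord1 addr0 addrC.
by rewrite !coordD !site_coord2 up_coord2 addr0 add0r.
Qed.

Lemma between2_tau (i : int) u : K u -> K (tau 2 i u).
Proof.
move=> [vu uw pu]; split=> [z|z|k hk z].
- rewrite -(@periodicZ _ _ 1 v1 dir2 i z v1_per (leqnn _)); exact: vu.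
- rewrite -(@periodicZ _ _ 1 w1 dir2 i z w1_per (leqnn _)); exact: uw.
- by rewrite /tau addrAC pu.
Qed.

(** The energies of [u] and [v1] along a row differ by an absolutely summable
    amount, and those of [v1] converge since [v1] is a minimizer. *)
Lemma row_energy_cvg u : K u -> pqcvg (win1 u) (fine (J1 s u)).
Proof.
move=> Ku; have [Lam1 ce1] := first_level_chain n_gt0 s_C2 s_adm r_gt0 adj0.
have [L L0 hL] := energy1_sums; have [B hB] := gap_sums.
have [l hl] : exists l, pqcvg (fun p q => \sum_(i < (p + q).+1)
    (local_potential s (site (i%:Z - p%:Z)) u -
     local_potential s (site (i%:Z - p%:Z)) v1)) l.
  apply: (dominated_pqcvg (f := fun a => local_potential s (site a) u -
     local_potential s (site a) v1) (g := fun a => L * \sum_(k <- ball_enum n r)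
      `|u (val k + site a) - v1 (val k + site a)|)
      (B := L * \sum_(k <- ball_enum n r) B)).
    by move=> a; exact: hL.
  apply: sums_leZ => //; apply: sums_le_sum => k.
  apply: sums_leW (sums_le_shift (val k ord0 d1) hB) => a.
  rewrite (row_shift k a Ku) (row_shift k a Kv).
  by apply: diff_le_gap; exact: between2_tau.
have [_ cv] : minimizer d1 v0 w0 energy1 (@dist1 R n) v1.
  by apply/(M1P n_gt0 s_C2 s_adm r_gt0 adj0).
have ul : pqcvg (win1 u) (c + l).
  apply: pqcvg_eventually (pqcvgD cv hl) _; exists 0%N => p q _ _.
  by rewrite !win1E -big_split /=; apply: eq_bigr => i _; ring.
have -> : J1 s u = (c + l)%:E; last by [].
by apply: liminf_pq_lim ul => p q; rewrite (J1pq_win n_gt0).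
Qed.

Lemma J1E u : K u -> J1 s u = (fine (J1 s u))%:E.
Proof.
move=> Ku; apply: liminf_pq_lim (row_energy_cvg Ku) => p q.
by rewrite (J1pq_win n_gt0).
Qed.

Lemma energy2_cvg u : K u -> pqcvg (fun p q => win1 u p q - c) (energy2 u).
Proof. by move=> Ku; apply: (pqcvgD (row_energy_cvg Ku) (pqcvg_cst (- c))). Qed.

(** An invariant configuration between [v1] and [w1] is a competitor at the first
    level, squeezed between two connecting ones. This gives both the sign of the
    energy and, by adjacency, its zeros. *)
Lemma invariant_connecting u : K u -> tau dir2.+1 1 u = u ->
  connecting d1 v0 w0 (@dist1 R n) u.
Proof.
move=> Ku tu; have [vu uw pu] := Ku.
have [Kv1 va vb] := v1_connecting; have [Kw1 wa wb] := w1_connecting.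
have Bv z : v0 z = v0 0 by apply: Gamma0_cst; have [[]] := adj0.
have Bw z : w0 z = w0 0 by apply: Gamma0_cst; have [_ []] := adj0.
split.
- split=> [z|z|k /andP[k2 kn] z].
  + by rewrite Bv; have /andP[] := between21 Ku z.
  + by rewrite Bw; have /andP[] := between21 Ku z.
  + have [k3|k3] := leqP 3 k; first by apply: pu; rewrite k3.
    have -> : k = 2%N by lia.
    by rewrite -{2}tu /tau scale1r.
- move=> a /wa[N hN]; exists N => i /hN; apply: le_trans.
  rewrite /dist1 /tau add0r; set z := _ *: _.
  have /andP[h1 _] := between21 Ku z; have h2 := uw z.
  by rewrite !ger0_norm; lra.
move=> a /vb[N hN]; exists N => i /hN; apply: le_trans.
rewrite /dist1 /tau add0r; set z := _ *: _.
have /andP[_ h1] := between21 Ku z; have h2 := vu z.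
by rewrite !ler0_norm; lra.
Qed.

Lemma minimal_energy u : K u -> M1 s v0 w0 u -> fine (J1 s u) = c.
Proof.
move=> Ku /(M1P n_gt0 s_C2 s_adm r_gt0 adj0)[_ uc].
exact: (pqcvg_uniq (row_energy_cvg Ku) uc).
Qed.

Lemma second_level_chain :
  exists Lam, chain_energy dir2 r v1 w1 energy2 dist2 Lam.
Proof.
have [Lam1 ce1] := first_level_chain n_gt0 s_C2 s_adm r_gt0 adj0.
have [L L0 hL] := energy1_sums.
exists (L * (size (ball_enum n r))%:R); split.
- exact: v1_w1.
- exact: v1_per.
- exact: w1_per.
- move=> x; apply/le_anti/andP.
  have x0 : sums_le (fun a : int => `|x (site a) - x (site a)|) 0.
    by move=> l _; rewrite big1// => i _; rewrite subrr normr0.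
  by split; [exact: rsum_le x0|exact: rsum_ge0 x0].
- move=> x y x' y' Kx Ky Kx' Ky' H; have [B hB] := dist2_sums Kx' Ky'.
  apply: rsum_le; apply: sums_leW (sums_le_rsum hB) => a; apply: H.
  exact: site_coord2.
- move=> x y z Kx Ky Kz.
  have [B hB] := dist2_sums Kx Ky; have [C hC] := dist2_sums Ky Kz.
  apply: rsum_le; apply: sums_leW (sums_leD (sums_le_rsum hB) (sums_le_rsum hC)).
  by move=> a; exact: ler_distD.
- move=> x y Kx Ky; have [B hB] := dist2_sums Kx Ky.
  have := sums_le_rsum hB (l := [:: 0]) isT.
  by rewrite big_seq1 /T_ scale0r.
- move=> a a0; have a2 : 0 < a / 2 by rewrite divr_gt0.
  have [B hB] := gap_sums; have [l ul hl] := rsum_dominated_near hB a2.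
  pose b := a / 2 / (size l).+1%:R; have b0 : 0 < b by rewrite !divr_gt0.
  exists [seq site i | i <- l], b; split=> // x y Kx Ky H.
  have := hl (fun i : int => `|x (site i) - y (site i)|).
  move=> /(_ (fun i => introT andP (conj (normr_ge0 _)
    (diff_le_gap (site i) Kx Ky)))) /le_trans; apply.
  rewrite [leRHS](splitr a) lerD2r; apply: le_trans (_ : \sum_(i <- l) b <= _).
    rewrite big_seq [leRHS]big_seq; apply: ler_sum => i il.
    by apply: H; apply/mapP; exists i.
  rewrite big_const_seq count_predT iter_addr_0 -[leLHS]mulr_natr.
  by rewrite /b -mulrA ler_piMr ?(ltW a2)// mulrC ler_pdivrMr// mul1r ler_nat.
- by rewrite mulr_ge0.
- move=> x y a Kx Ky H; set C := _ * _.
  pose G (j : int) := L * \sum_(k <- ball_enum n r)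
    `|x (val k + site j) - y (val k + site j)|.
  have GC : sums_le G C.
    rewrite /C -mulrA; apply: sums_leZ => //.
    have -> : (size (ball_enum n r))%:R * a = \sum_(k <- ball_enum n r) a.
      by rewrite big_const_seq count_predT iter_addr_0 mulr_natl.
    apply: sums_le_sum => k.
    have Kx' := between2_tau (val k ord0 dir2) Kx; have Ky' := between2_tau (val k ord0 dir2) Ky.
    have [B hB] := dist2_sums Kx' Ky'.
    have kr : (`|val k ord0 dir2| <= r)%N.
      exact: leq_trans (lnorm_coord _ _) (valP k).
    apply: (sums_leW (g := fun j : int =>
        `|tau 2 (val k ord0 dir2) x (site (j + val k ord0 d1)) -
          tau 2 (val k ord0 dir2) y (site (j + val k ord0 d1))|)).
      by move=> j; rewrite (row_shift k j Kx) (row_shift k j Ky).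
    move=> l ul; apply: le_trans (H _ kr).
    exact: (sums_le_shift (val k ord0 d1) (sums_le_rsum hB)).
  have hC p q : `|win1 x p q - win1 y p q| <= C.
    rewrite !win1E -sumrB.
    apply: le_trans (ler_norm_sum _ _ _) _.
    apply: le_trans (_ : \sum_(i < (p + q).+1) G (i%:Z - p%:Z) <= _).
      by apply: ler_sum => i _; rewrite opprB addrA subrK; exact: hL.
    by rewrite big_window; apply: GC; exact: window_uniq.
  have cx := energy2_cvg Kx; have cy := energy2_cvg Ky.
  rewrite ler_norml; apply/andP; split.
    suff : energy2 y <= energy2 x + C by lra.
    apply: (pqcvg_le cy (pqcvgD cx (pqcvg_cst C))); exists 0%N => p q _ _.
    by have := hC p q; rewrite ler_norml; lra.
  suff : energy2 x <= energy2 y + C by lra.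
  apply: (pqcvg_le cx (pqcvgD cy (pqcvg_cst C))); exists 0%N => p q _ _.
  by have := hC p q; rewrite ler_norml; lra.
- move=> x y Kx Ky.
  have Km := between_cmin Kx Ky; have KM := between_cmax Kx Ky.
  apply: (pqcvg_le (pqcvgD (energy2_cvg Km) (energy2_cvg KM))
                   (pqcvgD (energy2_cvg Kx) (energy2_cvg Ky))).
  exists 0%N => p q _ _; rewrite !win1E.
  suff : \sum_(i < (p + q).+1)
      (local_potential s (site (i%:Z - p%:Z)) (cmin x y) - c0 s) +
    \sum_(i < (p + q).+1)
      (local_potential s (site (i%:Z - p%:Z)) (cmax x y) - c0 s) <=
    \sum_(i < (p + q).+1) (local_potential s (site (i%:Z - p%:Z)) x - c0 s) +
    \sum_(i < (p + q).+1) (local_potential s (site (i%:Z - p%:Z)) y - c0 s).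
    by lra.
  rewrite -!big_split /=; apply: ler_sum => i _.
  have := local_potential_submodular s_C2 s_S3 x y (site (i%:Z - p%:Z)); lra.
- move=> x Kx tx; rewrite subr_ge0.
  exact: (least_action_le ce1 (invariant_connecting Kx tx) (row_energy_cvg Kx)).
- move=> x Kx tx /eqP; rewrite subr_eq0 => /eqP xc.
  have mx : M1 s v0 w0 x.
    apply/(M1P n_gt0 s_C2 s_adm r_gt0 adj0); split; first exact: invariant_connecting.
    by rewrite -xc; exact: row_energy_cvg.
  have [vx xw _] := Kx.
  have [|xv] := pselect (x = v1); first by left.
  have [|xw'] := pselect (x = w1); first by right.
  by have [_ _ _ []] := adj1; exists x; split.
- by apply/eqP; rewrite subr_eq0; apply/eqP/(minimal_energy Kv v1_min).
- by apply/eqP; rewrite subr_eq0; apply/eqP/(minimal_energy Kw w1_min).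
Qed.

Local Notation win2 := (win dir2 energy2).
Local Notation connecting2 := (connecting dir2 v1 w1 dist2).

Lemma local_potential_tau z (i : int) u :
  local_potential s z (tau 2 i u) = local_potential s (z + i *: unitv 2) u.
Proof.
rewrite !local_potentialE; congr s; apply: funext => k.
by rewrite /loc /tau addrA.
Qed.

Definition window2 (p' q' p q : nat) : seq (lattice n) :=
  [seq (site a + b *: unitv 2 : lattice n) |
    a : int <- [seq i%:Z - p'%:Z | i : nat <- iota 0 (p' + q').+1],
    b : int <- [seq i%:Z - p%:Z | i : nat <- iota 0 (p + q).+1]].

Lemma window2P (p' q' p q : nat) z :
  (lnorm z + r <= p')%N -> (lnorm z + r <= q')%N ->
  (lnorm z + r <= p)%N -> (lnorm z + r <= q)%N ->
  [/\ uniq (window2 p' q' p q),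
    {in window2 p' q' p q &, forall y y' : lattice n, agree 2 y y' -> y = y'} &
    forall k : lball n r,
      exists2 y, y \in window2 p' q' p q & agree 2 (val k + y) z].
Proof.
move=> zp' zq' zp zq.
have inj (a b a' b' : int) :
    agree 2 (site a + b *: unitv 2) (site a' + b' *: unitv 2) ->
    a = a' /\ b = b'.
  move=> /agreeP H; have := H d1 isT; have := H dir2 isT.
  by rewrite !coordD !site_coord1 !site_coord2 !up_coord1 !up_coord2 !addr0 !add0r.
split.
- apply: allpairs_uniq; [exact: window_uniq..|] => -[a b] [a' b'] _ _ /= E.
  have [-> ->] // : a = a' /\ b = b'.
  by apply: inj; rewrite E; exact: agree_refl.
- move=> _ _ /allpairsP[[a b] [_ _ ->]] /allpairsP[[a' b'] [_ _ ->]] /=.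
  by move=> /inj[-> ->].
move=> k; have := valP k; have := lnorm_coord (val k) d1.
have := lnorm_coord (val k) dir2; have := lnorm_coord z d1.
have := lnorm_coord z dir2; rewrite /=.
set z1 := z ord0 d1; set z2 := z ord0 dir2.
set k1 := val k ord0 d1; set k2 := val k ord0 dir2 => h1 h2 h3 h4 h5.
exists (site (z1 - k1) + (z2 - k2) *: unitv 2).
  apply: (allpairs_f (fun a b : int => site a + b *: unitv 2)); apply/mapP.
    by exists (absz (z1 - k1 + p'%:Z)); rewrite ?mem_iota; lia.
  by exists (absz (z2 - k2 + p%:Z)); rewrite ?mem_iota; lia.
apply: agree2P; rewrite !coordD.
  by rewrite site_coord1 up_coord1 -/k1 -/z1; lia.
by rewrite site_coord2 up_coord2 -/k2 -/z2; lia.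
Qed.

Lemma win2E u (p q : nat) :
  win2 u p q = \sum_(i < (p + q).+1) energy2 (tau 2 (i%:Z - p%:Z) u).
Proof. by apply: eq_bigr => i _; rewrite sh_sh. Qed.

(** The energy of a row being a limit of finite sums, the first variation is
    computed on rectangles before passing to the limit along the rows. *)
Lemma variation2 u z (a : R) : K u -> 0 < a ->
  exists2 b : R, 0 < b & forall t, `|t| <= b ->
    K (bump dir2.+1 z t u) ->
    exists N, forall p q, (N <= p)%N -> (N <= q)%N ->
    `|win2 (bump dir2.+1 z t u) p q - win2 u p q - t * EL s u z| <= a * `|t|.
Proof.
move=> Ku a0; have [_ _ pu] := Ku.
have [b b0 H] := first_variation s_C2 z pu a0; exists b => // t /H{}H Kb.
exists (lnorm z + r)%N => p q zp zq; set u' := bump _ _ _ _ in H Kb *.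
pose X (p' q' : nat) := \sum_(i < (p + q).+1)
  (win1 (tau 2 (i%:Z - p%:Z) u') p' q' - win1 (tau 2 (i%:Z - p%:Z) u) p' q').
have Xcvg : pqcvg X (win2 u' p q - win2 u p q).
  rewrite !win2E -sumrB /X; apply: pqcvg_sum => i.
  have h1 := energy2_cvg (between2_tau (i%:Z - p%:Z) Kb).
  have h2 := pqcvgZ (-1) (energy2_cvg (between2_tau (i%:Z - p%:Z) Ku)).
  have -> : energy2 (tau 2 (i%:Z - p%:Z) u') - energy2 (tau 2 (i%:Z - p%:Z) u) =
    energy2 (tau 2 (i%:Z - p%:Z) u') + -1 * energy2 (tau 2 (i%:Z - p%:Z) u).
    by ring.
  apply: pqcvg_eventually (pqcvgD h1 h2) _.
  by exists 0%N => p' q' _ _ /=; ring.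
have XE (p' q' : nat) : (lnorm z + r <= p')%N -> (lnorm z + r <= q')%N ->
    `|X p' q' - t * EL s u z| <= a * `|t|.
  move=> zp' zq'; have [h1 h2 h3] := window2P zp' zq' zp zq.
  have := H _ h1 h2 h3; rewrite big_allpairs_dep exchange_big.
  suff -> : X p' q' = \sum_(j <- [seq i%:Z - p%:Z | i : nat <- iota 0 (p + q).+1])
      \sum_(i <- [seq i%:Z - p'%:Z | i : nat <- iota 0 (p' + q').+1])
      (local_potential s (site i + j *: unitv 2) u' -
       local_potential s (site i + j *: unitv 2) u) by [].
  rewrite -(big_window (fun j => \sum_(i <- _) _)); apply: eq_bigr => j _.
  rewrite -(big_window (fun i => local_potential s (site i + _) u' - _)).
  rewrite !win1E -sumrB; apply: eq_bigr => i _.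
  by rewrite !local_potential_tau opprB addrA subrK.
have h1 := pqcvg_le Xcvg (pqcvg_cst (t * EL s u z + a * `|t|)).
have h2 := pqcvg_le (pqcvg_cst (t * EL s u z - a * `|t|)) Xcvg.
have {}h1 : win2 u' p q - win2 u p q <= t * EL s u z + a * `|t|.
  apply: h1; exists (lnorm z + r)%N => p' q' /XE{}XE /XE.
  by rewrite ler_norml; lra.
have {}h2 : t * EL s u z - a * `|t| <= win2 u' p q - win2 u p q.
  apply: h2; exists (lnorm z + r)%N => p' q' /XE{}XE /XE.
  by rewrite ler_norml; lra.
by rewrite ler_norml; lra.
Qed.

Lemma norm_on_row u x (i : int) : K u -> K x -> (forall j, tau 2 j x = x) ->
  norm_on (E_ i) (fun z => u z - x z) = (dist2 (tau 2 i u) x)%:E.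
Proof.
move=> Ku Kx tx; have [B hB] := dist2_sums (between2_tau i Ku) Kx.
rewrite /norm_on /E_ esum_image; last first.
  move=> a a' _ _ /(congr1 (fun z : lattice n => z ord0 d1)).
  by rewrite !coordD !up_coord1 !site_coord1 !addr0.
rewrite -(esum_rsum _ hB) => [|a]; last exact: normr_ge0.
apply: eq_esum => a _.
by have -> : x (site a) = x (site a + i *: unitv 2) by rewrite -[in LHS](tx i).
Qed.

Lemma cvgE0P (g : nat -> R) :
  (g i)%:E @[i --> \oo] --> 0%E <-> g i @[i --> \oo] --> 0.
Proof.
split=> [/fine_cvgP[_]|H]; first by [].
by apply/fine_cvgP; split => //; exists 0%N.
Qed.

Let tau_v1 j : tau 2 j v1 = v1.
Proof.
by apply: funext => z; rewrite /tau (@periodicZ _ _ 1 v1 dir2 j z v1_per (leqnn _)).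
Qed.

Let tau_w1 j : tau 2 j w1 = w1.
Proof.
by apply: funext => z; rewrite /tau (@periodicZ _ _ 1 w1 dir2 j z w1_per (leqnn _)).
Qed.

Lemma connecting2E : connecting2 = Gamma2 v1 w1.
Proof.
apply/funext => u; apply/propext.
have dist_ge0 x y : K x -> K y -> 0 <= dist2 x y.
  by move=> Kx Ky; have [B hB] := dist2_sums Kx Ky; exact: rsum_ge0 hB.
have Ev (Ku : K u) : (fun i : nat => norm_on (E_ (- i%:Z)) (fun z => u z - v1 z)) =
    (fun i : nat => (dist2 (tau 2 (- i%:Z) u) v1)%:E).
  by apply: funext => i; rewrite norm_on_row.
have Ew (Ku : K u) : (fun i : nat => norm_on (E_ i%:Z) (fun z => u z - w1 z)) =
    (fun i : nat => (dist2 (tau 2 i%:Z u) w1)%:E).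
  by apply: funext => i; rewrite norm_on_row.
split=> [[Ku Hv Hw]|[Ku]].
  split => //.
    rewrite (Ev Ku); apply/cvgE0P/cvg0P => // i.
    by apply: dist_ge0 => //; exact: between2_tau.
  rewrite (Ew Ku); apply/cvgE0P/cvg0P => // i.
  by apply: dist_ge0 => //; exact: between2_tau.
rewrite (Ev Ku) (Ew Ku) !cvgE0P !cvg0P => [Hv Hw|i|i]; first by split.
  by apply: dist_ge0 => //; exact: between2_tau.
by apply: dist_ge0 => //; exact: between2_tau.
Qed.

Lemma J2_win u : K u -> exists a : int -> int -> \bar R,
  J2 s v0 w0 u = liminf_pq a /\
  forall p q : nat, a (- p%:Z) q%:Z = (win2 u p q)%:E.
Proof.
move=> Ku; exists (fun p q => J2pq s v0 w0 p q u); split => // p q.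
rewrite /J2pq fsbig_window win2E -sumEFin; apply: eq_bigr => i _.
rewrite /J2i (J1E (between2_tau _ Ku)) (c1E n_gt0 s_C2 s_adm r_gt0 adj0).
by rewrite -EFinB.
Qed.

Local Notation min2 := (minimizer dir2 v1 w1 energy2 dist2).

Lemma M2P u : M2 s v0 w0 v1 w1 u <-> min2 u.
Proof.
have [Lam ce] := second_level_chain.
rewrite /M2 /c2 -connecting2E; apply: (minimizerP ce) => {}u [Ku _ _].
exact: J2_win.
Qed.

Let ELv1 z : EL s v1 z = 0.
Proof. exact: (M1_EL n_gt0 s_C2 s_adm r_gt0 adj0). Qed.
Let ELw1 z : EL s w1 z = 0.
Proof. exact: (M1_EL n_gt0 s_C2 s_adm r_gt0 adj0). Qed.

Lemma M2_nonempty : M2 s v0 w0 v1 w1 !=set0.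
Proof.
have [Lam ce] := second_level_chain.
by have [U GU cU] := action_minimizer_exists ce; exists U; apply/M2P.
Qed.

Lemma M2_EL u : M2 s v0 w0 v1 w1 u -> forall z, EL s u z = 0.
Proof.
have [Lam ce] := second_level_chain.
by move=> /M2P; exact: (minimizer_EL s_C2 s_S3 r_gt0 ce ELv1 ELw1 variation2).
Qed.

Lemma M2_ordered : ordered (M2 s v0 w0 v1 w1).
Proof.
have [Lam ce] := second_level_chain.
by move=> u u' /M2P mu /M2P mu';
  exact: (minimizer_ordered s_C2 s_S3 r_gt0 ce ELv1 ELw1 variation2 mu mu').
Qed.

Lemma M2_monotone2 u : M2 s v0 w0 v1 w1 u -> clt u (tau 2 1 u).
Proof.
have [Lam ce] := second_level_chain.
move=> /M2P mu.
exact: (minimizer_strictly_monotone s_C2 s_S3 r_gt0 ce ELv1 ELw1 variation2 mu).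
Qed.

Lemma EL_tau u (k : nat) (i : int) z :
  EL s (tau k i u) z = EL s u (z + i *: unitv k).
Proof.
apply: eq_bigr => k' _; congr (partial k' s _); apply: funext => j.
by rewrite /loc /tau [z + _ - _]addrAC !addrA.
Qed.

(** Monotonicity along the first axis: [U <= w1 <= tau v1 <= tau U], and the
    strong maximum principle makes the inequality strict. *)
Lemma M2_monotone1 U : M2 s v0 w0 v1 w1 U -> clt U (tau 1 1 U).
Proof.
move=> mU; have [Lam ce] := second_level_chain.
have /M2P[GU _] := mU; have [[vU Uw _] _ _] := GU.
have wv := M1_adjacent_translate n_gt0 s_C2 s_adm r_gt0 adj0 adj1.
have Utau : cle U (tau 1 1 U).
  by move=> z; apply: le_trans (Uw z) (le_trans (wv z) (vU _)).
move=> z; rewrite lt_neqAle Utau andbT; apply/eqP => Uz.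
have UU : U = tau 1 1 U.
  apply: (EL_touch s_C2 s_S3 r_gt0 Utau Uz) => y.
  by rewrite EL_tau !(M2_EL mU).
have Uw1 : U = w1.
  apply: funext => y; apply/le_anti; rewrite Uw/=.
  by apply: le_trans (wv y) _; rewrite UU; exact: vU.
have [_ + _] := GU; have g0 : 0 < (w1 0 - v1 0) / 2.
  by rewrite divr_gt0// subr_gt0.
move=> /(_ _ g0)[N /(_ N (leqnn N))]; rewrite Uw1 tau_w1.
have := ce_nu_site ce Kw Kv; rewrite ler_norml => /andP[_ h1] h2.
by have := le_trans h1 h2; have := v1_w1 0; lra.
Qed.

End SecondLevel.

Theorem theorem4p9 (R : realType) (n r : nat) (hn : (2 <= n)%N)
    (hr : (1 <= r)%N) (s : (lball n r -> R) -> R)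
    (s_C2 : C2 s) (s_adm : admissible s)
    (v0 w0 : config R n) (adj0 : adjacent_in (M0 s) v0 w0)
    (v1 w1 : config R n) (adj1 : adjacent_in (M1 s v0 w0) v1 w1) :
  (exists U2 : config R n, M2 s v0 w0 v1 w1 U2 /\ EL_solution s U2) /\
  ordered (M2 s v0 w0 v1 w1) /\
  (forall U : config R n, M2 s v0 w0 v1 w1 U -> EL_solution s U) /\
  (forall U : config R n, M2 s v0 w0 v1 w1 U ->
     clt U (tau 1 1 U) /\ clt U (tau 2 1 U)).
Proof.
have EL0 U : M2 s v0 w0 v1 w1 U -> EL_solution s U.
  by move=> mU; apply/EL_solutionE; exact: (M2_EL hn hr s_C2 s_adm adj0 adj1 mU).
split.
  have [U mU] := M2_nonempty hn hr s_C2 s_adm adj0 adj1.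
  by exists U; split => //; exact: EL0.
split; first exact: (M2_ordered hn hr s_C2 s_adm adj0 adj1).
split=> // U mU; split.
  exact: (M2_monotone1 hn hr s_C2 s_adm adj0 adj1 mU).
exact: (M2_monotone2 hn hr s_C2 s_adm adj0 adj1 mU).
Qed.
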